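(* Let $H\in(0,1)$, let $B=\{B_t\}_{t\ge 0}$ be a real-valued fractional Brownian motion with Hurst parameter $H$ and continuous sample paths, and let $G(B)=\{(t,B_t): t\in[0,1]\}\subset\mathbb{R}^2$ be its graph over $[0,1]$. Then, almost surely, $\dim_{\rm F} G(B)=1$, where $\dim_{\rm F}$ denotes the Fourier dimension.
   Context: A fractional Brownian motion with Hurst parameter $H\in(0,1)$ is a centered Gaussian process $B=\{B_t\}_{t\ge0}$ on a complete probability space with covariance $\mathbb{E}[B_sB_t]=\frac12\left(|s|^{2H}+|t|^{2H}-|t-s|^{2H}\right)$ for $s,t\ge 0$. For a Borel probability measure $\mu$ on $\mathbb{R}^n$, its Fourier transform is $\hat\mu(\xi)=\int_{\mathbb{R}^n}e^{-2\pi i\,\xi\cdot x}\,d\mu(x)$, $\xi\in\mathbb{R}^n$. For a Borel set $A\subset\mathbb{R}^n$, let $\mathcal{P}(A)$ be the set of Borel probability measures $\mu$ on $\mathbb{R}^n$ with $\mu(A)=1$. The Fourier dimension of $A$ is $$\dim_{\rm F}A=\sup\left\{\beta\in[0,n]:\ \exists\,\mu\in\mathcal{P}(A)\text{ and } C<\infty\text{ such that } |\hat\mu(\xi)|\le C|\xi|^{-\beta/2}\text{ for all }\xi\in\mathbb{R}^n\setminus\{0\}\right\}.$$ *)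

(* Defs.v *)
From mathcomp Require Import all_boot all_order all_algebra.
From mathcomp Require Import all_classical all_reals all_analysis.
From mathcomp.real_closed Require Export complex.
Import Order.TTheory GRing.Theory Num.Theory.
Import numFieldNormedType.Exports.

Set Implicit Arguments.
Unset Strict Implicit.
Unset Printing Implicit Defensive.

Local Open Scope classical_set_scope.
Local Open Scope ring_scope.
Local Open Scope complex_scope.

Section gaussian.
Context d (T : measurableType d) (R : realType) (P : probability T R).

(* [normal_prob m 0] is a junk value (the uniform law on [0, 1]), so the
   degenerate Gaussian laws are written as Dirac masses. *)
Definition gaussian_rv (X : T -> R) : Prop :=
  measurable_fun setT X /\
  ((exists m : R, forall A : set R, measurable A -> P (X @^-1` A) = \d_m A) \/
   (exists m s : R, 0 < s /\
      forall A : set R, measurable A -> P (X @^-1` A) = normal_prob m s A)).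

Definition gaussian_process (I : Type) (D : set I) (X : I -> T -> R) : Prop :=
  (forall t, D t -> measurable_fun setT (X t)) /\
  forall (k : nat) (t : 'I_k -> I) (a : 'I_k -> R), (forall i, D (t i)) ->
    gaussian_rv (fun w => \sum_(i < k) a i * X (t i) w).

(* Time is [0, +oo[: the values [B t] for [t < 0] are unconstrained. *)
Definition fractional_brownian_motion (H : R) (B : R -> T -> R) : Prop :=
  [/\ gaussian_process `[0, +oo[ B,
      forall t, 0 <= t -> 'E_P[B t]%E = 0%E &
      forall s t, 0 <= s -> 0 <= t ->
        'E_P[B s \* B t]%E =
        (2^-1 * (`|s| `^ (2 * H) + `|t| `^ (2 * H) - `|t - s| `^ (2 * H)))%:E].

End gaussian.

Definition expi (R : realType) (x : R) : R[i] := cos x +i* sin x.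

Definition cintegral d (T : measurableType d) (R : realType)
    (mu : {measure set T -> \bar R}) (f : T -> R[i]) : R[i] :=
  (\int[mu]_x complex.Re (f x)) +i* (\int[mu]_x complex.Im (f x)).

Section fourier_dimension.
Context (R : realType) (n : nat).

(* R^n with the sigma-algebra generated by its open sets. *)
Definition borelRV := g_sigma_algebraType (@open 'rV[R]_n).

Definition dotp (x y : 'rV[R]_n) : R := \sum_(i < n) x 0 i * y 0 i.

(* The library norm on ['rV_n] is the sup norm. *)
Definition enorm (x : 'rV[R]_n) : R := Num.sqrt (dotp x x).

Definition fourier_transform (mu : probability borelRV R)
    (xi : 'rV[R]_n) : R[i] :=
  cintegral mu (fun x => expi (- (2 * pi * dotp xi x))).

(* Meant for Borel sets A (a measure takes arbitrary values on other sets).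
   The supremum is that of a subset of [0, n], which contains 0 as soon as A
   carries a probability measure; for empty A it is [sup set0 = 0]. *)
Definition fourier_dim (A : set 'rV[R]_n) : R :=
  sup [set b : R | 0 <= b <= n%:R /\
    exists (mu : probability borelRV R) (C : R),
      mu A = 1%E /\
      forall xi : 'rV[R]_n, xi != 0 ->
        `|fourier_transform mu xi| <= (C * enorm xi `^ (- (b / 2)))%:C].

End fourier_dimension.

Definition graph01 (R : realType) (f : R -> R) : set 'rV[R]_2 :=
  [set \row_(i < 2) (if i == 0 then t else f t) | t in `[0, 1]].

(* Main.v *)
(* Lower bound.  The measure is the image, under [t |-> (t, B_t)], of the
   uniform law on [[1/2, 1]].  For [|xi| ~ X], let [F] be the real (or the
   imaginary) part of its Fourier transform at [xi]; it is enough to prove that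
   [E F^(2q) <= C X^(-q(1 - d))] for all [q] and [d], because Borel-Cantelli on
   a polynomially dense set of frequencies, together with the Lipschitz
   dependence of [F] on [xi], then gives an almost sure decay
   [X^(-b/2)] for every [b < 1].
   Discretise [F] into a mean [S] of oscillating terms [x_k].  Expanding one
   factor of [S^(2q)] and splitting [S] into the terms at distance more or less
   than [r = X^(d - 1)] from [t_k] gives a recursion on the moments, provided
   that the product of [x_k] with terms far from [t_k] has a tiny mean.  When
   the variance at scale [r] of the Brownian phase is large, this follows from
   the local nondeterminism of the process.  Otherwise the deterministic phase
   oscillates with half-period [h = 1 / (2X)], much smaller than [r]; since it
   changes sign after a time [h], [x_k] may be replaced by an iterated half
   difference of step [h], whose mean against far terms is an iterated
   difference of [exp (- th^2 V(t) / 2)], with [V] smooth at scale [r].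

   Upper bound.  If [|mu^(xi)|^2 <= C |xi|^(-1 - 2e)], sum [|mu^|^2] over all
   differences of points of [[0, N) x [0, M)].  The sum is [o(N M^2)], but it is
   also the double integral of a squared exponential sum, which is at least
   [(N M / 2)^2] for two points whose abscissas are at distance [O(1 / N)]: when
   [N] is large with respect to [M], so that their ordinates are at distance
   [O(1 / M)], this bounds the sum below by a multiple of [N M^2]. *)

Require Import Defs.
From mathcomp Require Import all_boot all_order all_algebra.
From mathcomp Require Import all_classical all_reals all_analysis.
From mathcomp Require Import measurable_realfun gauss_integral ring lra zify.
Import Order.TTheory GRing.Theory Num.Theory.
Import numFieldNormedType.Exports.

Set Implicit Arguments.
Unset Strict Implicit.
Unset Printing Implicit Defensive.

Local Open Scope classical_set_scope.
Local Open Scope ring_scope.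

(** * Iterated differences *)

(** The obstacle is that the paths are rough: nothing can be integrated by parts against the
    deterministic phase path by path. Smoothness reappears only in mean, because the variance of
    [B_t + Y], with [Y] a combination of values at distance at least [r] from [t], is a combination
    of powers of the distances from [t] to the times of [Y] and to [0]. The origin counts among
    these singular times, which is why the uniform law is taken on [[1/2, 1]] and not on [[0, 1]].
    The real and imaginary parts are both written as cosines with a free phase [a]: a product of two
    cosines is a half sum of cosines, so that all products of terms stay in one family, and only
    combinations [Y] with coefficients 1 and -1 occur. In the upper bound, [N] is known only after
    [M], through the modulus of continuity of the path, so the estimates must be uniform in [N]. The
    decay [|xi|^(-1 - 2e)] is therefore spent as exponent [1 + e] on the abscissas, which gives a
    convergent series, and [e] on the ordinates, which gives averages tending to 0. *)

Definition dif (V : zmodType) (f : nat -> V) (i : nat) : V := f i.+1 - f i.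

Section smooth_sequences.
Context (R : realType) (k : R).
Hypothesis k_ge0 : 0 <= k.

(** Amounts to [|iter n dif f i| <= A * k ^+ n] whenever [n + i <= N], so that only [f 0, ..., f N]
    are constrained. The recursive form lets products and exponentials be treated by induction on
    [N] through [dif]. *)
Fixpoint smooth (N : nat) (A : R) (f : nat -> R) : Prop :=
  (forall i, (i <= N)%N -> `|f i| <= A) /\
  (if N is M.+1 then smooth M (A * k) (dif f) else True).

Lemma smooth_bound N A f i : smooth N A f -> (i <= N)%N -> `|f i| <= A.
Proof. by case: N => [|N] [+ _]; exact. Qed.

Lemma smooth_le N A B f : A <= B -> smooth N A f -> smooth N B f.
Proof.
elim: N A B f => [|N IH] A B f AB [fA] /= Df; split=> //.
- by move=> i /fA /le_trans; apply.
- by move=> i /fA /le_trans; apply.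
- by apply: IH Df; rewrite ler_wpM2r.
Qed.

Lemma smooth_pred N A f : smooth N.+1 A f -> smooth N A f.
Proof.
elim: N A f => [|N IH] A f [fA Df]; split=> //.
- by move=> i iN; apply: fA; rewrite (leq_trans iN).
- by move=> i iN; apply: fA; rewrite (leq_trans iN).
- exact: IH Df.
Qed.

Lemma smooth_shift N A f : smooth N.+1 A f -> smooth N A (fun i => f i.+1).
Proof.
elim: N A f => [|N IH] A f [fA Df]; split=> //.
- by move=> i iN; apply: fA.
- by move=> i iN; apply: fA.
- exact: (IH _ _ Df).
Qed.

Lemma smoothD N A B f g :
  smooth N A f -> smooth N B g -> smooth N (A + B) (fun i => f i + g i).
Proof.
elim: N A B f g => [|N IH] A B f g [fA Df] [gB Dg]; split=> //.
- by move=> i iN; rewrite (le_trans (ler_normD _ _))// lerD ?fA ?gB.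
- by move=> i iN; rewrite (le_trans (ler_normD _ _))// lerD ?fA ?gB.
- rewrite mulrDl (_ : dif _ = fun i => dif f i + dif g i); first exact: IH.
  by apply/funext => i; rewrite /dif; ring.
Qed.

(** Discrete Leibniz rule: the difference of [f * g] is [dif f] times the shift of [g], plus [f]
    times [dif g]. Each order produces two terms, whence the factor [2 ^+ N]. *)
Lemma smoothM N A B f g : 0 <= A -> 0 <= B ->
  smooth N A f -> smooth N B g -> smooth N (2 ^+ N * A * B) (fun i => f i * g i).
Proof.
elim: N A B f g => [|N IH] A B f g A0 B0 sf sg.
  split=> // i iN; rewrite expr0 mul1r normrM.
  by rewrite ler_pM ?(smooth_bound sf) ?(smooth_bound sg).
split.
  move=> i iN; rewrite -mulrA normrM.
  rewrite (@le_trans _ _ (1 * (A * B)))// ?mul1r; last first.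
    by rewrite ler_peMl ?mulr_ge0// exprn_ege1// ler1n.
  by rewrite ler_pM ?(smooth_bound sf) ?(smooth_bound sg).
rewrite (_ : dif _ = fun i => dif f i * g i.+1 + f i * dif g i); last first.
  by apply/funext => i; rewrite /dif; ring.
rewrite (_ : _ * k = 2 ^+ N * (A * k) * B + 2 ^+ N * A * (B * k)); last first.
  by rewrite exprS; ring.
have [[_ Df] [_ Dg]] := (sf, sg).
by apply: smoothD; apply: IH => //; rewrite ?mulr_ge0//;
  [exact: smooth_shift|exact: smooth_pred].
Qed.

Lemma smooth0 N A : 0 <= A -> smooth N A (fun=> 0).
Proof.
elim: N A => [|N IH] A A0; (split; first by move=> i _; rewrite normr0); first by [].
rewrite (_ : dif _ = fun=> 0); last by apply/funext => i; rewrite /dif subrr.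
by apply: IH; rewrite mulr_ge0.
Qed.

Lemma smooth_cst N c : smooth N `|c| (fun=> c).
Proof.
case: N => [|N]; split=> //.
rewrite (_ : dif _ = fun=> 0); last by apply/funext => i; rewrite /dif subrr.
by apply: smooth0; rewrite mulr_ge0.
Qed.

Lemma expR_sub1_le (x : R) : `|x| <= 1 -> `|expR x - 1| <= 3 * `|x|.
Proof.
rewrite !ler_norml => /andP[x1 x1'].
have e1 := expR_ge1Dx x.
have [x0|x0] := leP 0 x; apply/andP; split; rewrite ?(ger0_norm x0) ?(ltr0_norm x0).
- lra.
(* On [[0, 1]], [expR (x / 2) <= 1 / (1 - x / 2) <= 1 + x], and squaring gives at most [1 + 3 x]. *)
- have -> : expR x = expR (x / 2) ^+ 2 by rewrite expr2 -expRD; congr expR; lra.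
  have hp := expR_gt0 (x / 2).
  have h2 : expR (x / 2) * (1 - x / 2) <= 1.
    rewrite -[leRHS](_ : expR (x / 2) * expR (- (x / 2)) = 1).
      by rewrite ler_wpM2l ?(ltW hp)// expR_ge1Dx.
    by rewrite -expRD subrr expR0.
  have h3 : expR (x / 2) <= 1 + x by nra.
  have h4 : expR (x / 2) ^+ 2 <= (1 + x) ^+ 2.
    by rewrite lerXn2r ?nnegrE ?(ltW hp)//; lra.
  by have h5 : (1 + x) ^+ 2 <= 1 + 3 * x; [nra|lra].
- lra.
- have : expR x <= 1 by rewrite -expR0 ler_expR ltW.
  lra.
Qed.

Fixpoint expC (N : nat) : R :=
  if N is M.+1 then 3 + 2 ^+ M * (1 + expC M) * expC M else 3.

Lemma expC_ge0 N : 0 <= expC N.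
Proof.
by elim: N => [|N IH] //=; rewrite addr_ge0// !mulr_ge0// ?exprn_ge0 ?addr_ge0.
Qed.

(** Subtracting 1 keeps the bound proportional to [A]. Since the difference of [expR p] is
    [expR p * (expR (dif p) - 1)], order [N.+1] follows from order [N] for [p] and for [dif p],
    whose size is [A * k]; [expC] collects the constants. *)
Lemma smooth_expR N A p : k <= 1 -> 0 <= A <= 1 -> smooth N A p ->
  smooth N (expC N * A) (fun i => expR (p i) - 1).
Proof.
move=> k1; elim: N A p => [|N IH] A p /andP[A0 A1] sp.
  split=> // i iN; have pA := smooth_bound sp iN.
  by rewrite (le_trans (expR_sub1_le (le_trans pA A1)))// ler_wpM2l.
have [pA Dp] := sp; split.
  move=> i iN; have {}pA := pA _ iN.
  rewrite (le_trans (expR_sub1_le (le_trans pA A1)))// ler_pM//=.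
  by rewrite lerDl !mulr_ge0// ?exprn_ge0 ?addr_ge0 ?expC_ge0.
have Ak1 : 0 <= A * k <= 1.
  by rewrite mulr_ge0//= mulr_ile1.
have e1 := IH _ _ Ak1 Dp.
have e2 : smooth N (1 + expC N) (fun i => 1 + (expR (p i) - 1)).
  apply: smoothD.
    by rewrite -[X in smooth _ X](@normr1 R); exact: smooth_cst.
  apply: (@smooth_le _ (expC N * A)); first by rewrite ler_piMr ?expC_ge0.
  by apply: IH (smooth_pred sp); rewrite A0.
rewrite (_ : dif _ = fun i => (1 + (expR (p i) - 1)) * (expR (dif p i) - 1)).
  apply: smooth_le (smoothM _ _ e2 e1); rewrite ?mulr_ge0 ?addr_ge0 ?expC_ge0//.
  rewrite /= !mulrA ler_wpM2r// ler_wpM2r// lerDr//.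
apply/funext => i; rewrite /dif expRD expRN.
by have := expR_gt0 (p i); move=> /lt0r_neq0 e0; field.
Qed.

Lemma iter_dif_bound N A f : smooth N A f ->
  `|iter N (@dif R) f 0%N| <= A * k ^+ N.
Proof.
elim: N A f => [|N IH] A f [fA Df]; first by rewrite mulr1 fA.
by rewrite iterSr exprS mulrA; exact: IH.
Qed.

Lemma smooth_iter N A f :
  (forall n i, (n + i <= N)%N -> `|iter n (@dif R) f i| <= A * k ^+ n) ->
  smooth N A f.
Proof.
elim: N A f => [|N IH] A f H; (split=> [i iN|//]).
- by have := H 0%N i iN; rewrite mulr1.
- by have := H 0%N i iN; rewrite mulr1.
- by apply: IH => n i niN; rewrite -iterSr -mulrA -exprS; exact: H.
Qed.

End smooth_sequences.

Section binomial_weights.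
Context (R : realType).

(** The signed binomial coefficient [(-1)^(N - i) C(N, i)], by Pascal's rule. *)
Fixpoint dw (N : nat) (i : nat) : R :=
  if N is M.+1 then (if i is j.+1 then dw M j else 0) - dw M i
  else (i == 0)%:R.

Lemma dw_gt N i : (N < i)%N -> dw N i = 0.
Proof.
elim: N i => [|N IH] [|i] //= Ni.
by rewrite !IH// ?subr0// (ltn_trans _ Ni).
Qed.

Lemma sum_dw (V : lmodType R) N (f : nat -> V) :
  iter N (@dif V) f 0%N = \sum_(i < N.+1) dw N i *: f i.
Proof.
elim: N f => [|N IH] f; first by rewrite big_ord_recl big_ord0 /= scale1r addr0.
rewrite iterSr IH.
rewrite [RHS](eq_bigr (fun i : 'I_N.+2 =>
  (if val i is j.+1 then dw N j else 0) *: f i - dw N i *: f i)); last first.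
  by move=> i _; rewrite /= scalerBl.
rewrite sumrB [X in _ = X - _]big_ord_recl [X in _ = _ - X]big_ord_recr/=.
rewrite scale0r add0r dw_gt// scale0r addr0 -sumrB.
by apply: eq_bigr => i _; rewrite /dif scalerBr.
Qed.

Lemma sum_norm_dw N : \sum_(i < N.+1) `|dw N i| <= 2 ^+ N.
Proof.
elim: N => [|N IH]; first by rewrite big_ord_recl big_ord0 /= normr1 addr0.
apply: (@le_trans _ _ (\sum_(i < N.+2)
  (`|if val i is j.+1 then dw N j else 0| + `|dw N i|))).
  by apply: ler_sum => i _; exact: ler_normB.
rewrite big_split/= [X in X + _]big_ord_recl [X in _ + X]big_ord_recr/=.
by rewrite normr0 add0r dw_gt// normr0 addr0 exprS mulr2n mulrDl mul1r lerD.
Qed.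

(** Each difference multiplies the alternating sequence by -2. This is why the half difference of a
    term that changes sign at every step is that term again, up to sign. *)
Lemma sum_dw_sign N : \sum_(i < N.+1) dw N i * (-1) ^+ i = (- 2) ^+ N.
Proof.
have := @sum_dw R^o N (fun i => (-1) ^+ i).
rewrite /GRing.scale/= => <-.
suff -> : iter N (@dif R^o) (fun i => (-1) ^+ i) =
    fun i => (- 2) ^+ N * (-1) ^+ i by rewrite mulr1.
elim: N => [|N IH] /=; first by apply/funext => i; rewrite mul1r.
by apply/funext => i; rewrite IH /dif exprS [in RHS]exprS; ring.
Qed.

End binomial_weights.

Section power_differences.
Context (R : realType).
Implicit Types (h x a : R) (F G : R -> R).

Definition difh h F x := F (x + h) - F x.

Lemma is_derive_iter_difh h n a x : 0 < x -> 0 < x + n%:R * h ->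
  is_derive x (1 : R) (iter n (difh h) (@powR R ^~ a))
    (a * iter n (difh h) (@powR R ^~ (a - 1)) x).
Proof.
elim: n x => [|n IH] x x0 xn0; first exact: is_derive1_powR.
have xn : 0 < x + n%:R * h.
  have [h0|h0] := leP 0 h; first by rewrite ltr_wpDr// mulr_ge0.
  by rewrite (lt_le_trans xn0)// lerD2l -natr1 mulrDl mul1r gerDl ltW.
have xh : 0 < x + h.
  have [h0|h0] := leP 0 h; first by rewrite ltr_wpDr.
  rewrite (lt_le_trans xn0)// lerD2l -natr1 mulrDl mul1r gerDr.
  by rewrite mulr_ge0_le0// ltW.
rewrite /= {2}/difh mulrBr; apply: is_deriveB; last exact: IH.
have e : x + h + n%:R * h = x + n.+1%:R * h by rewrite -natr1; ring.
have IHh := IH (x + h) xh; rewrite e in IHh.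
have := @is_derive1_comp _ _ (fun y => y + h) x _ 1 (IHh xn0).
rewrite mulr1; apply.
rewrite -[X in is_derive _ _ _ X]addr0; exact: is_deriveD.
Qed.

Lemma ler_powR_npos a x y : a <= 0 -> 0 < x -> x <= y -> y `^ a <= x `^ a.
Proof.
move=> a0 x0 xy; have y0 := lt_le_trans x0 xy.
rewrite -(opprK a) !(powRN _ (- a)) lef_pV2 ?posrE ?powR_gt0//.
by rewrite ge0_ler_powR ?nnegrE ?oppr_ge0// ltW.
Qed.

Lemma MVT_any F G x y :
  (forall z, Num.min x y <= z -> z <= Num.max x y -> is_derive z (1 : R) F (G z)) ->
  exists c, [/\ Num.min x y <= c, c <= Num.max x y & F y - F x = G c * (y - x)].
Proof.
wlog xy : x y / x <= y.
  move=> H; have [xy|/ltW yx] := leP x y; first by have := H x y xy; rewrite (min_l xy) (max_r xy).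
  move=> D; have [|c [c1 c2 c3]] := H y x yx.
    by rewrite minC maxC (min_r yx) (max_l yx) => z; exact: D.
  exists c; split; [by rewrite -(min_r yx) minC|by rewrite -(max_l yx) maxC|].
  by rewrite -opprB c3 -mulrN opprB.
rewrite (min_l xy) (max_r xy) => D.
have [z zI||c] := @MVT_segment R F G x y xy.
- by apply: D; move: zI; rewrite in_itv/= => /andP[/ltW ? /ltW].
- apply: derivable_within_continuous => z; rewrite in_itv/= => /andP[xz zy].
  by have [] := D _ xz zy.
- by rewrite in_itv/= => /andP[cx cy] e; exists c.
Qed.

(** The mean value theorem trades one difference for a factor [h] and one derivative, which lowers
    the exponent by 1. The condition [a <= n%:R] makes the last power nonincreasing, hence largest
    at [x0]; as [h] may be negative, both ends of the range are kept above [x0]. *)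
Lemma iter_difh_powR_le n : forall a, exists2 K : R, 0 <= K &
  forall h x x0, a <= n%:R -> 0 < x0 -> x0 <= x -> x0 <= x + n%:R * h ->
  `|iter n (difh h) (@powR R ^~ a) x| <= K * `|h| ^+ n * x0 `^ (a - n%:R).
Proof.
elim: n => [|n IH] a.
  exists 1 => // h x x0 a0 x00 x0x _ /=.
  rewrite expr0 !mul1r subr0 ger0_norm ?powR_ge0//.
  exact: ler_powR_npos.
have [K K0 IHK] := IH (a - 1).
exists (`|a| * K); first by rewrite mulr_ge0.
move=> h x x0 an x00 x0x x0xn /=.
rewrite {1}/difh.
have an1 : a - 1 <= n%:R by rewrite lerBlDr natr1.
have seg z : Num.min x (x + h) <= z -> z <= Num.max x (x + h) ->
    x0 <= z /\ x0 <= z + n%:R * h.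
  move: x0xn; rewrite -natr1 mulrDl mul1r => x0xn.
  have nn : 0 <= n%:R :> R by [].
  have [h0|h0] := leP 0 h.
    have xxh : x <= x + h by rewrite lerDl.
    rewrite (min_l xxh) (max_r xxh) => xz zx.
    by split; rewrite ?ler_wpDr ?mulr_ge0// (le_trans x0x).
  have xxh : x + h <= x by rewrite gerDl ltW.
  have nh : n%:R * h <= 0 by rewrite mulr_ge0_le0// ltW.
  by rewrite (min_r xxh) (max_l xxh) => xz zx; split; lra.
have [|c [c1 c2 ->]] := @MVT_any (iter n (difh h) (@powR R ^~ a))
  (fun z => a * iter n (difh h) (@powR R ^~ (a - 1)) z) x (x + h).
  move=> z z1 z2; have [z3 z4] := seg z z1 z2.
  by apply: is_derive_iter_difh; exact: lt_le_trans x00 _.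
have [c3 c4] := seg c c1 c2.
rewrite (addrC x) addrK !normrM exprS.
have := IHK h c x0 an1 x00 c3 c4.
rewrite -addrA -opprD nat1r => {}IHK.
rewrite -!mulrA ler_wpM2l// mulrC mulrCA.
by rewrite ler_wpM2l// mulrA.
Qed.

End power_differences.

(** * Local nondeterminism *)

Section covariance.
Context (R : realType) (H : R).
Implicit Types (l : seq (R * R)).

Definition fcov (s t : R) : R :=
  2^-1 * (`|s| `^ (2 * H) + `|t| `^ (2 * H) - `|t - s| `^ (2 * H)).

(* A list of pairs [(c, t)] stands for the random variable [\sum c * B t]. *)
Definition bform l l' : R :=
  \sum_(p <- l) \sum_(q <- l') p.1 * q.1 * fcov p.2 q.2.

Definition qform l : R := bform l l.

Definition scale (a : R) l := [seq (a * p.1, p.2) | p <- l].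

Lemma fcovC s t : fcov s t = fcov t s.
Proof. by rewrite /fcov distrC [in RHS](addrC (`|t| `^ _)). Qed.

Lemma bformC l l' : bform l l' = bform l' l.
Proof.
rewrite /bform exchange_big/=; apply: eq_bigr => q _; apply: eq_bigr => p _.
by rewrite fcovC (mulrC p.1).
Qed.

Lemma bform_catl l1 l2 l' : bform (l1 ++ l2) l' = bform l1 l' + bform l2 l'.
Proof. by rewrite /bform big_cat. Qed.

Lemma bform_catr l1 l2 l' : bform l' (l1 ++ l2) = bform l' l1 + bform l' l2.
Proof. by rewrite bformC bform_catl !(bformC l'). Qed.

Lemma bform_scalel a l l' : bform (scale a l) l' = a * bform l l'.
Proof.
rewrite /bform /scale big_map mulr_sumr; apply: eq_bigr => p _.
by rewrite mulr_sumr; apply: eq_bigr => q _ /=; rewrite !mulrA.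
Qed.

Lemma bform_scaler a l l' : bform l' (scale a l) = a * bform l' l.
Proof. by rewrite bformC bform_scalel bformC. Qed.

Lemma qform_scale_cat a b l l' : qform (scale a l ++ scale b l') =
  a ^+ 2 * qform l + 2 * a * b * bform l l' + b ^+ 2 * qform l'.
Proof.
rewrite /qform bform_catl !bform_catr !bform_scalel !bform_scaler (bformC l' l).
by ring.
Qed.

Lemma bform_cons p l l' : bform (p :: l) l' = bform [:: p] l' + bform l l'.
Proof. exact: (bform_catl [:: p]). Qed.

Lemma bform_consr p l l' : bform l' (p :: l) = bform l' [:: p] + bform l' l.
Proof. exact: (bform_catr [:: p]). Qed.

Lemma bform11 a s b t : bform [:: (a, s)] [:: (b, t)] = a * b * fcov s t.
Proof. by rewrite /bform !big_seq1. Qed.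

Definition fvar l (t : R) : R := qform ((1, t) :: l).

Hypothesis H_gt0 : 0 < H.
Hypothesis qform_ge0 : forall l, (forall p, p \in l -> 0 <= p.2) -> 0 <= qform l.

Let H2_neq0 : 2 * H != 0. Proof. by rewrite mulf_neq0// lt0r_neq0. Qed.

Lemma fcov_incr s t : fcov s s + fcov t t - 2 * fcov s t = `|t - s| `^ (2 * H).
Proof. by rewrite /fcov !subrr normr0 powR0//; field. Qed.

Lemma fvarE l t :
  fvar l t = fcov t t + 2 * bform [:: (1, t)] l + qform l.
Proof.
rewrite /fvar /qform (bform_cons _ l) (bformC [:: _]) (bformC l).
rewrite (bform_cons _ l [:: _]) (bform_cons _ l l) bform11 (bformC l [:: _]).
by rewrite !mul1r; ring.
Qed.

(* [B_t + Y], with [Y] the combination [l], is the sum of [B_s + Y] and of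
   the increment [B_t - B_s]. *)
Lemma fvar_incr l s t : fvar l t = fvar l s +
  2 * bform ((1, s) :: l) [:: (1, t); (-1, s)] + `|t - s| `^ (2 * H).
Proof.
rewrite -fcov_incr !fvarE (bform_cons _ l) !(bform_consr _ [:: (-1, s)]).
rewrite (bformC l [:: (1, t)]) (bformC l) !bform11.
have -> : bform [:: (-1, s)] l = - bform [:: (1, s)] l.
  by rewrite -[RHS]mulN1r -bform_scalel /scale/= mulr1.
by ring.
Qed.

Lemma qform_incr s t : qform [:: (1, t); (-1, s)] = `|t - s| `^ (2 * H).
Proof.
rewrite -fcov_incr /qform bform_cons !(bform_consr _ [:: (-1, s)]) !bform11.
by rewrite (fcovC t s); ring.
Qed.

Let nneg_times l s t : (forall p, p \in l -> 0 <= p.2) -> 0 <= s -> 0 <= t ->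
  forall a b p, p \in scale a ((1, s) :: l) ++ scale b [:: (1, t); (-1, s)] -> 0 <= p.2.
Proof.
move=> l0 s0 t0 a b p; rewrite mem_cat => /orP[] /mapP[q + -> /=].
  by rewrite inE => /predU1P[->//|]; exact: l0.
by rewrite !inE => /orP[] /eqP->.
Qed.

Lemma fvar_ge0 l t : (forall p, p \in l -> 0 <= p.2) -> 0 <= t -> 0 <= fvar l t.
Proof.
move=> l0 t0; apply: qform_ge0 => p; rewrite inE => /predU1P[->//|].
exact: l0.
Qed.

(** Nonnegativity of the variance of [x (B_s + Y) - (B_t - B_s)], divided by [x], bounds twice the
    covariance of the increment with [B_s + Y]. The parameter [x] stays free: 1 for crude
    comparisons, a small value when the factor of [fvar l s] must be close to 1. *)
Lemma fvar_lip l s t x : (forall p, p \in l -> 0 <= p.2) -> 0 <= s -> 0 <= t ->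
  0 < x -> fvar l t <= (1 + x) * fvar l s + (1 + x^-1) * `|t - s| `^ (2 * H).
Proof.
move=> l0 s0 t0 x0.
have := qform_ge0 (@nneg_times l s t l0 s0 t0 x (-1)).
rewrite qform_scale_cat qform_incr (fvar_incr l s t) -/(fvar l s).
set V := fvar l s; set W := bform _ _; set D := powR _ _ => h.
rewrite -subr_ge0.
rewrite (_ : _ - _ = (x ^+ 2 * V + 2 * x * -1 * W + (-1) ^+ 2 * D) / x).
  by rewrite divr_ge0// ltW.
by field; exact: lt0r_neq0.
Qed.

(** The sum of [B_s + Y] and [B_t + Y] is [2 (B_s + Y) + (B_t - B_s)], whose variance is
    nonnegative. Thus the two variances cannot both be small compared with that of the increment. *)
Lemma fvar_parallelogram l s t : (forall p, p \in l -> 0 <= p.2) ->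
  0 <= s -> 0 <= t -> `|t - s| `^ (2 * H) <= 2 * fvar l s + 2 * fvar l t.
Proof.
move=> l0 s0 t0; have := qform_ge0 (@nneg_times l s t l0 s0 t0 2 1).
rewrite qform_scale_cat qform_incr (fvar_incr l s t) -/(fvar l s); lra.
Qed.

(* As a function of [t], the variance of [B_t + Y] is a combination of powers
   of the distances from [t] to [0] and to the times of [Y]. *)
Definition charges l : seq (R * R) :=
  (1 + \sum_(p <- l) p.1, 0) :: scale (-1) l.

Lemma fvar_charges l t : fvar l t =
  \sum_(p <- charges l) p.1 * `|t - p.2| `^ (2 * H) +
  (\sum_(p <- l) p.1 * `|p.2| `^ (2 * H) + qform l).
Proof.
rewrite fvarE /fcov subrr normr0 powR0// /charges big_cons/= !subr0 big_map/=.
rewrite /bform big_seq1 mulr_sumr.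
rewrite (eq_bigr (fun p => p.1 * `|t| `^ (2 * H) + p.1 * `|p.2| `^ (2 * H)
    + -1 * p.1 * `|t - p.2| `^ (2 * H))); last first.
  by move=> p _; rewrite /= /fcov (distrC p.2); field.
by rewrite !big_split/= -mulr_suml; field.
Qed.

End covariance.

(** * Smoothness and lower bound of the variance away from its singular times *)

Section variance_differences.
Context (R : realType).

Lemma eq_iter_dif n (f g : nat -> R) : (forall i, (i <= n)%N -> f i = g i) ->
  iter n (@dif R) f 0%N = iter n (@dif R) g 0%N.
Proof.
move=> fg; rewrite !(@sum_dw R R^o).
by apply: eq_bigr => i _; rewrite fg// -ltnS.
Qed.

Lemma iter_difD n (f g : nat -> R) i : iter n (@dif R) (fun j => f j + g j) i =
  iter n (@dif R) f i + iter n (@dif R) g i.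
Proof. by elim: n i => //= n IH i; rewrite /dif !IH; ring. Qed.

Lemma iter_difZ n c (f : nat -> R) i :
  iter n (@dif R) (fun j => c * f j) i = c * iter n (@dif R) f i.
Proof. by elim: n i => //= n IH i; rewrite /dif !IH; ring. Qed.

Lemma iter_dif_cst n (c : R) i : iter n.+1 (@dif R) (fun=> c) i = 0.
Proof.
elim: n i => [|n IH] i; first by rewrite /= /dif subrr.
by rewrite iterS {1}/dif !IH subrr.
Qed.

Lemma iter_dif_sum n (I : Type) (s : seq I) (f : I -> nat -> R) i :
  iter n (@dif R) (fun j => \sum_(p <- s) f p j) i =
  \sum_(p <- s) iter n (@dif R) (f p) i.
Proof.
elim: s => [|p s IH].
  rewrite big_nil -[RHS](mul0r (iter n (@dif R) (fun=> 0) i)) -iter_difZ.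
  by congr (iter n _ _ _); apply/funext => j; rewrite big_nil mul0r.
rewrite big_cons -IH -iter_difD.
by congr (iter n _ _ _); apply/funext => j; rewrite big_cons.
Qed.

Lemma iter_dif_addn n (f : nat -> R) i :
  iter n (@dif R) f i = iter n (@dif R) (fun j => f (i + j)%N) 0%N.
Proof.
suff H j : iter n (@dif R) f (i + j)%N = iter n (@dif R) (fun j => f (i + j)%N) j.
  by rewrite -H addn0.
by elim: n j => //= n IH j; rewrite /dif -!IH addnS.
Qed.

Lemma difhE h (F : R -> R) x : difh h F x = F (x + h) - F x.
Proof. by []. Qed.

Lemma iter_dif_difh n h (F : R -> R) x i :
  iter n (@dif R) (fun i => F (x + i%:R * h)) i = iter n (difh h) F (x + i%:R * h).
Proof.
elim: n i => //= n IH i; rewrite /dif !IH difhE.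
by congr (iter n (difh h) F _ - _); rewrite -natr1; ring.
Qed.

Lemma iter_difh_opp n h (F : R -> R) u x :
  iter n (difh h) (fun x => F (u - x)) x = iter n (difh (- h)) F (u - x).
Proof.
elim: n x => //= n IH x; rewrite !difhE !IH.
by congr (iter n (difh (- h)) F _ - _); ring.
Qed.

Lemma iter_dif_dist_le n a : exists2 K : R, 0 <= K &
  forall h x u r : R, a <= n%:R -> 0 < r -> n%:R * `|h| + r <= `|x - u| ->
  `|iter n (@dif R) (fun i => `|x + i%:R * h - u| `^ a) 0%N| <=
    K * `|h| ^+ n * r `^ (a - n%:R).
Proof.
have [K K0 HK] := @iter_difh_powR_le R n a; exists K => // h x u r an r0 sep.
have hn i : (i <= n)%N -> `|i%:R * h| <= n%:R * `|h|.
  by move=> iN; rewrite normrM normr_nat ler_wpM2r// ler_nat.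
have [ux|xu] := leP u x.
  rewrite (@ger0_norm _ (x - u)) ?subr_ge0// in sep.
  rewrite (@eq_iter_dif _ _ (fun i => ((x - u) + i%:R * h) `^ a)); last first.
    move=> i /hn; rewrite ler_norml => /andP[ih _].
    by rewrite ger0_norm; [rewrite addrAC|lra].
  rewrite (iter_dif_difh n h (@powR R ^~ a)) mul0r addr0 HK//.
    by rewrite (le_trans _ sep)// lerDr mulr_ge0.
  by have := hn n (leqnn n); rewrite ler_norml => /andP[]; lra.
rewrite (@ltr0_norm _ (x - u)) ?subr_lt0// in sep.
rewrite (@eq_iter_dif _ _ (fun i => (u - (x + i%:R * h)) `^ a)); last first.
  move=> i /hn; rewrite ler_norml => /andP[_ ih].
  by rewrite ler0_norm; [rewrite opprB|lra].
rewrite (iter_dif_difh n h (fun y => (u - y) `^ a)) mul0r addr0.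
rewrite (iter_difh_opp n h (@powR R ^~ a)) -(normrN h) HK//.
  have : 0 <= n%:R * `|h| by rewrite mulr_ge0.
  by lra.
by have := hn n (leqnn n); rewrite ler_norml => /andP[]; lra.
Qed.

Context (H : R).
Hypotheses (H_gt0 : 0 < H) (H_lt1 : H < 1).
Hypothesis qform_ge0 :
  forall l, (forall p, p \in l -> 0 <= p.2) -> 0 <= qform H l.

(** Coefficients bounded by 1 are enough: the combinations come from expanding products of cosines,
    which only adds or subtracts phases. *)
Definition far (m : nat) (r t : R) (l : seq (R * R)) : Prop :=
  (size l <= m)%N /\
  forall p, p \in l -> [/\ `|p.1| <= 1, 0 <= p.2 & r <= `|t - p.2|].

Lemma sum_charges_le m r t l : far m r t l ->
  \sum_(p <- charges l) `|p.1| <= 1 + 2 * m%:R.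
Proof.
move=> [sl lP].
have lm : \sum_(p <- l) `|p.1| <= m%:R.
  rewrite (@le_trans _ _ (\sum_(p <- l) 1))//.
    by rewrite big_seq [leRHS]big_seq ler_sum// => p /lP[].
  by rewrite big_const_seq count_predT iter_addr addr0 ler_nat.
rewrite /charges big_cons/= big_map/=.
rewrite [X in _ + X](eq_bigr (fun p => `|p.1|)); last by move=> p; rewrite mulN1r normrN.
have : `|1 + \sum_(p <- l) p.1| <= 1 + m%:R.
  rewrite (le_trans (ler_normD _ _))// normr1 lerD2l.
  by rewrite (le_trans (ler_norm_sum _ _ _)).
by lra.
Qed.

(** Each charge contributes a power of a distance that stays at least [r] along the progression; for
    the charge at time 0 this is ensured by [2 * r <= t]. At least two differences are taken, so
    that [2 * H <= n]. *)
Lemma iter_dif_fvar_le n : (2 <= n)%N -> exists2 K : R, 0 <= K &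
  forall m l t h r, 0 < r -> n%:R * `|h| <= r -> 2 * r <= t -> far m (2 * r) t l ->
  `|iter n (@dif R) (fun i => fvar H l (t + i%:R * h)) 0%N| <=
    (1 + 2 * m%:R) * (K * `|h| ^+ n * r `^ (2 * H - n%:R)).
Proof.
move=> n2; have [K K0 HK] := iter_dif_dist_le n (2 * H); exists K => //.
move=> m l t h r r0 hr rt fl.
have Hn : 2 * H <= n%:R.
  have : 2 <= n%:R :> R by rewrite ler_nat.
  by move: H_lt1; lra.
rewrite (_ : (fun i => _) = (fun i : nat =>
  \sum_(p <- charges l) p.1 * `|t + i%:R * h - p.2| `^ (2 * H) +
  (\sum_(p <- l) p.1 * `|p.2| `^ (2 * H) + qform H l))); last first.
  by apply/funext => i; rewrite fvar_charges.
rewrite iter_difD; case: n n2 {hr}HK Hn hr => // n n2 HK Hn hr.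
rewrite iter_dif_cst addr0 iter_dif_sum.
rewrite (le_trans (ler_norm_sum _ _ _))//.
apply: (@le_trans _ _ (\sum_(p <- charges l)
    `|p.1| * (K * `|h| ^+ n.+1 * r `^ (2 * H - n.+1%:R)))); last first.
  rewrite -mulr_suml ler_wpM2r// ?(sum_charges_le fl)//.
  by rewrite !mulr_ge0 ?exprn_ge0 ?powR_ge0.
rewrite big_seq [leRHS]big_seq; apply: ler_sum => p pl.
rewrite iter_difZ normrM ler_wpM2l// HK//.
suff : 2 * r <= `|t - p.2| by lra.
move: pl; rewrite inE => /predU1P[->/=|/mapP[q ql -> /=]].
  by rewrite subr0 (le_trans rt)// ler_norm.
by have [_ /(_ _ ql)[]] := fl.
Qed.

(* If the variance were small at [t], it would be at least of order [y^(2H)]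
   at [t - y] and [t + y]; but its second difference is only of order [y^2]. *)
Lemma fvar_lower_bound m : exists2 c : R, 0 < c &
  forall l t r, 0 < r -> r <= t -> far m r t l -> c * r `^ (2 * H) <= fvar H l t.
Proof.
have [K K0 HK] := @iter_dif_fvar_le 2 isT.
pose M := 1 + (1 + 2 * m%:R) * K.
have MK0 : 0 <= (1 + 2 * m%:R) * K by rewrite mulr_ge0// addr_ge0// mulr_ge0.
have M1 : 1 <= M by rewrite lerDl.
have M0 : 0 < M by rewrite (lt_le_trans _ M1).
have HH : 0 < 2 - 2 * H by move: H_lt1; lra.
(* With [k^(2 - 2H) = 1 / (64 M)] and [y = k r], the bound of order [y^2 r^(2H - 2)] on the second
   difference is a small multiple of [y^(2H)]. *)
pose k := (64 * M)^-1 `^ (2 - 2 * H)^-1.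
have b0 : 0 < (64 * M)^-1 by rewrite invr_gt0 mulr_gt0.
have k0 : 0 < k by rewrite powR_gt0.
have kE : k `^ (2 - 2 * H) = (64 * M)^-1.
  by rewrite -powRrM mulVf ?lt0r_neq0// powRr1// ltW.
(* This keeps [t - y] and [t + y] at distance comparable to [r] from the times of [l] and from 0. *)
have k8 : k <= 8^-1.
  have b64 : (64 * M)^-1 <= 64^-1 by rewrite lef_pV2 ?posrE ?mulr_gt0// ler_peMr.
  rewrite (@le_trans _ _ ((64 * M)^-1 `^ 2^-1))//.
    rewrite /k; apply: ger_powR; last by rewrite lef_pV2 ?posrE//; move: H_gt0; lra.
    by rewrite b0 (le_trans b64)// invf_le1// ler1n.
  rewrite powR12_sqrt ?(ltW b0)// -[leRHS]ger0_norm ?invr_ge0// -sqrtr_sqr ler_wsqrtr//.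
  by rewrite (le_trans b64)//; lra.
have k2E : k ^+ 2 = k `^ (2 * H) * (64 * M)^-1.
  rewrite -kE -powRD; last by rewrite (lt0r_neq0 k0) implybT.
  by rewrite addrC subrK -powR_mulrn// ltW.
exists (k `^ (2 * H) / 8); first by rewrite divr_gt0// powR_gt0.
move=> l t r r0 rt fl.
have [sl lP] := fl.
pose y := k * r.
have y0 : 0 < y by rewrite mulr_gt0.
have yr : y <= r / 8 by rewrite (mulrC r) ler_wpM2r// ltW.
have l0 p : p \in l -> 0 <= p.2 by move=> /lP[].
have [t0 t1 t2] : [/\ 0 <= t - y, 0 <= t & 0 <= t + y] by split; lra.
have := HK m l (t - y) y (r / 4).
rewrite /= /dif mul0r addr0 mul1r subrK (ger0_norm (ltW y0)).
rewrite (_ : t - y + 2 * y = t + y); last by ring.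
have -> : (r / 4) `^ (2 * H - 2) = r `^ (2 * H) / r ^+ 2 * 4^-1 `^ (2 * H - 2).
  rewrite powRM ?invr_ge0// ?(ltW r0)// powRB ?(lt0r_neq0 r0) ?implybT//.
  by rewrite powR_mulrn ?(ltW r0).
have q16 : 4^-1 `^ (2 * H - 2) <= 16 :> R.
  have -> : 4^-1 = 4 `^ (-1) :> R by rewrite powR_inv1.
  rewrite -powRrM (_ : 16 = 4 `^ 2%:R); last by rewrite powR_mulrn//; ring.
  by apply: ler_powR; rewrite ?ler1n//; move: H_gt0; lra.
have {lP}fl' : far m (2 * (r / 4)) (t - y) l.
  split=> // p /lP[p1 p2 p3]; split=> //.
  rewrite (_ : t - y - p.2 = (t - p.2) - y); last by ring.
  have := lerB_dist (t - p.2) y; rewrite (ger0_norm (ltW y0)); lra.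
have [r4 y2 rty] : [/\ 0 < r / 4, 2 * y <= r / 4 & 2 * (r / 4) <= t - y] by split; lra.
move=> /(_ r4 y2 rty fl') /ler_normlW.
have p1 := fvar_parallelogram H_gt0 qform_ge0 l0 t1 t2.
have p2 := fvar_parallelogram H_gt0 qform_ge0 l0 t1 t0.
rewrite (_ : t - y - t = - y) ?normrN in p2; last by ring.
rewrite (_ : t + y - t = y) in p1; last by ring.
rewrite (ger0_norm (ltW y0)) in p1 p2.
have yE : y `^ (2 * H) = k `^ (2 * H) * r `^ (2 * H) by rewrite powRM ?ltW.
set q := _ `^ (2 * H - 2) in q16 *; move: p1 p2; rewrite yE.
set a := k `^ (2 * H) in k2E *; set b := r `^ (2 * H).
have a0 : 0 <= a by exact: powR_ge0.
have b0' : 0 <= b by exact: powR_ge0.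
have -> : (1 + 2 * m%:R) * (K * y ^+ 2 * (b / r ^+ 2 * q)) =
    ((1 + 2 * m%:R) * K / M) * (a * b / 64) * q.
  by rewrite exprMn k2E; field; rewrite !lt0r_neq0.
have -> : a / 8 * b = a * b / 8 by ring.
have ab0 : 0 <= a * b by rewrite mulr_ge0.
move: (a * b) ab0 => ab ab0 p1 p2.
have : (1 + 2 * m%:R) * K / M * (ab / 64) * q <= 1 * (ab / 64) * 16.
  rewrite ler_pM ?powR_ge0 ?mulr_ge0 ?invr_ge0//; first exact: ltW.
  rewrite ler_wpM2r ?divr_ge0// ler_pdivrMr// mul1r lerDr//.
rewrite -!/(fvar _ _ _); lra.
Qed.

End variance_differences.

(** * Iterated differences of Gaussian characteristic functions *)

Section characteristic_decay.
Context (R : realType).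

(** Take [n]-th powers in [x / n <= expR (x / n)]. *)
Lemma expRN_le_pow (n : nat) (x : R) : (0 < n)%N -> 0 < x ->
  expR (- x) <= (n%:R / x) ^+ n.
Proof.
move=> n0 x0; have n0' : 0 < n%:R :> R by rewrite ltr0n.
rewrite expRN -[leRHS]invrK -exprVn invf_div.
rewrite lef_pV2 ?posrE ?expR_gt0 ?exprn_gt0 ?divr_gt0//.
have -> : expR x = expR (x / n%:R) ^+ n.
  by rewrite -expRM_natl mulrC divfK ?lt0r_neq0.
rewrite lerXn2r ?nnegrE ?expR_ge0 ?divr_ge0 ?(ltW x0)//.
by rewrite (le_trans _ (expR_ge1Dx _))// lerDr.
Qed.

Context (H : R).
Hypotheses (H_gt0 : 0 < H) (H_lt1 : H < 1).
Hypothesis qform_ge0 :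
  forall l, (forall p, p \in l -> 0 <= p.2) -> 0 <= qform H l.

Lemma iter_dif_fvar_uniform N : exists2 K : R, 1 <= K &
  forall n m l t h r, (2 <= n <= N)%N ->
  0 < r -> N%:R * `|h| <= r -> 2 * r <= t -> far m (2 * r) t l ->
  `|iter n (@dif R) (fun i => fvar H l (t + i%:R * h)) 0%N| <=
    (1 + 2 * m%:R) * (K * `|h| ^+ n * r `^ (2 * H - n%:R)).
Proof.
elim: N => [|N [K K1 HK]].
  by exists 1 => // n m l t h r /andP[n2 n0]; have := leq_trans n2 n0.
have [n2|n2] := leqP 2 N.+1; last first.
  by exists 1 => // n m l t h r /andP[n2' n0]; have := leq_ltn_trans n0 n2; rewrite ltnNge n2'.
have [K' K'0 HK'] := iter_dif_fvar_le H_gt0 H_lt1 n2.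
exists (K + K'); first by rewrite (le_trans K1)// lerDl.
move=> n m l t h r /andP[n2' nN] r0 hr rt fl.
have mono x : (1 + 2 * m%:R) * (x * `|h| ^+ n * r `^ (2 * H - n%:R)) =
    x * ((1 + 2 * m%:R) * (`|h| ^+ n * r `^ (2 * H - n%:R))) by ring.
have p0 : 0 <= (1 + 2 * m%:R) * (`|h| ^+ n * r `^ (2 * H - n%:R)).
  by rewrite mulr_ge0 ?mulr_ge0 ?exprn_ge0 ?powR_ge0 ?addr_ge0 ?mulr_ge0.
move: nN; rewrite leq_eqVlt => /predU1P[nE|nN].
  rewrite {1}nE (le_trans (HK' _ _ _ _ _ r0 hr rt fl))//.
  by rewrite -nE !mono ler_wpM2r// lerDr (le_trans _ K1).
rewrite (@le_trans _ _ ((1 + 2 * m%:R) * (K * `|h| ^+ n * r `^ (2 * H - n%:R))))//.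
  rewrite HK// ?n2'//.
  by rewrite (le_trans _ hr)// ler_wpM2r// ler_nat.
by rewrite !mono ler_wpM2r// lerDl.
Qed.

(** Let [e = (h / r)^(H / 4)] and let [V] be the variance. If [th^2 V(t) >= 1 / e], all the
    exponentials are already smaller than a multiple of [e^N]. Otherwise the exponent, measured from
    its value at [t], has differences of order [n >= 1] bounded by [(A e)^n], and [smooth_expR]
    applies. The hypothesis on [th] reads [th^2 r^(2H) <= e^(-4)]: a loss absorbed by the
    differences of order at least 2, each of which gains [h / r <= e^4]. *)
Lemma iter_dif_charf_le N m : (0 < N)%N -> exists C e0 : R, 0 < e0 /\
  forall l t h r th, 0 < h -> 0 < r -> 2 * r <= t -> far m (2 * r) t l ->
    h / r <= e0 -> th ^+ 2 * r `^ (2 * H) <= (h / r) `^ (- H) ->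
  `|iter N (@dif R) (fun i => expR (- (th ^+ 2 * fvar H l (t + i%:R * h) / 2))) 0%N|
     <= C * ((h / r) `^ (H / 4)) ^+ N.
Proof.
move=> N0; have [K K1 HK] := iter_dif_fvar_uniform N.
have n1 : 1 <= N%:R :> R by rewrite ler1n.
set n := N%:R in n1 *.
pose M := (1 + 2 * m%:R) * K.
have M1 : 1 <= M by rewrite mulr_ege1// lerDl mulr_ge0.
pose A := 2 * M + (2 * n ^+ 2 + 4).
pose C1 := 2 ^+ N * (expR (n ^+ 2) * (4 * n) ^+ N).
pose C2 := expC R N * A ^+ N.
(* The threshold forces [n A e <= 1], so that in the second case the exponent varies by at most 1
   over the [N] steps. *)
exists (C1 + C2), ((n * A)^-1 `^ (4 / H)).
have A4 : 4 <= A by rewrite /A; nra.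
have A0 : 0 < A by lra.
have nA1 : 1 <= n * A by rewrite mulr_ege1//; lra.
have nA0 : 0 < (n * A)^-1 by rewrite invr_gt0; lra.
split; first by rewrite powR_gt0.
move=> l t h r th h0 r0 rt fl.
set e := (h / r) `^ (H / 4).
have hr0 : 0 < h / r by rewrite divr_gt0.
have e0 : 0 < e by rewrite powR_gt0.
move=> hre th_le.
have eA : e <= (n * A)^-1.
  rewrite -[leRHS]powRr1 ?(ltW nA0)//.
  have -> : 1 = 4 / H * (H / 4) by field; rewrite lt0r_neq0.
  rewrite powRrM ge0_ler_powR ?nnegrE ?powR_ge0 ?(ltW hr0)//.
  by rewrite divr_ge0// ltW.
have nAe : n * A * e <= 1 by rewrite mulrC -ler_pdivlMr ?div1r//; lra.
have e1 : e <= 1 by rewrite (le_trans eA)// invf_le1//; lra.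
have e4 : e ^+ 4 = (h / r) `^ H.
  by rewrite -powR_mulrn ?(ltW e0)// -powRrM; congr powR; field.
have hr1 : h / r <= 1.
  rewrite (le_trans hre)// -[leRHS](powRr0 (n * A)^-1) ger_powR//.
    by rewrite nA0 invf_le1//; lra.
  by rewrite divr_ge0// ltW.
have hre4 : h / r <= e ^+ 4.
  by rewrite e4 -[leLHS]powRr1 ?(ltW hr0)// ger_powR ?hr0 ?hr1// ltW.
have eN4 : (h / r) `^ (- H) = (e ^+ 4)^-1 by rewrite e4 powRN.
rewrite eN4 in th_le.
have eX k : (0 < k)%N -> e ^+ k <= e.
  by move=> k0; rewrite -[leRHS]expr1 ler_wiXn2l// ltW.
have nhr : n * h <= r / 2.
  have hre1 : h / r <= e by rewrite (le_trans hre4)// eX.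
  have -> : n * h = n * (h / r) * r by rewrite -mulrA divfK ?lt0r_neq0.
  rewrite mulrC ler_wpM2l ?(ltW r0)// -[leRHS]div1r ler_pdivlMr//.
  move: (h / r) hr0 hre1 => x x0 xe; rewrite (le_trans _ nAe)// mulrAC.
  have n0 : 0 <= n by lra.
  by rewrite -!mulrA ler_wpM2l// ler_pM// ?(ltW x0)//; lra.
(* [th^2 h^(2H)] is [th^2 r^(2H)] times [(h / r)^(2H)], hence at most [e^(-4) e^8]. *)
have h2H : th ^+ 2 * h `^ (2 * H) <= e ^+ 4.
  have -> : h `^ (2 * H) = r `^ (2 * H) * (e ^+ 4 * e ^+ 4).
    rewrite e4 -powRD; last by rewrite (lt0r_neq0 hr0) implybT.
    rewrite -[in LHS](divfK (lt0r_neq0 r0) h) powRM ?(ltW r0) ?(ltW hr0)//.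
    by rewrite mulrC; congr (_ * powR _ _); ring.
  rewrite mulrA mulrA -[leRHS]mul1r ler_wpM2r ?exprn_ge0 ?(ltW e0)//.
  by rewrite -ler_pdivlMr ?exprn_gt0// div1r.
pose V i := fvar H l (t + i%:R * h).
have [sl lP] := fl.
have l0 p : p \in l -> 0 <= p.2 by move=> /lP[].
have ih0 (i : nat) : 0 <= i%:R * h by rewrite mulr_ge0// ltW.
have t0 (i : nat) : 0 <= t + i%:R * h by rewrite addr_ge0//; lra.
have V0 i : 0 <= V i by exact: fvar_ge0.
have D2H (i : nat) : (i <= N)%N -> th ^+ 2 * (i%:R * h) `^ (2 * H) <= n ^+ 2.
  move=> iN; rewrite powRM ?(ltW h0)// mulrCA -[leRHS]mulr1.
  rewrite ler_pM ?powR_ge0 ?(mulr_ge0 (sqr_ge0 th) (powR_ge0 _ _))//; last first.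
    by rewrite (le_trans h2H)// (le_trans (eX _ _)).
  case: i iN => [|i] iN; first by rewrite powR0 ?sqr_ge0// mulf_neq0// lt0r_neq0.
  rewrite (@le_trans _ _ (i.+1%:R `^ 2%:R))//.
    by apply: ler_powR; rewrite ?ler1n//; move: H_lt1; lra.
  by rewrite powR_mulrn// lerXn2r ?nnegrE// ler_nat.
have lip i j x : (i <= N)%N -> (j <= N)%N -> 0 < x -> V j <=
    (1 + x) * V i + (1 + x^-1) * `|j%:R * h - i%:R * h| `^ (2 * H).
  move=> iN jN x0; have := fvar_lip H_gt0 qform_ge0 l0 (t0 i) (t0 j) x0.
  by rewrite opprD addrACA subrr add0r.
have th0 : 0 <= th ^+ 2 by exact: sqr_ge0.
have V0i i : (i <= N)%N -> th ^+ 2 * V 0%N <= 2 * (th ^+ 2 * V i) + 2 * n ^+ 2.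
  move=> iN; have := lip i 0%N 1 iN (leq0n _) ltr01.
  rewrite mul0r sub0r normrN (ger0_norm (ih0 i)) invr1.
  move: (D2H i iN); set D := powR _ _; nra.
have Vi0 i : (i <= N)%N -> th ^+ 2 * V i <= 2 * (th ^+ 2 * V 0%N) + 2 * n ^+ 2.
  move=> iN; have := lip 0%N i 1 (leq0n _) iN ltr01.
  rewrite mul0r subr0 (ger0_norm (ih0 i)) invr1.
  move: (D2H i iN); set D := powR _ _; nra.
have C1_ge0 : 0 <= C1 by rewrite !mulr_ge0 ?exprn_ge0 ?expR_ge0//; nra.
have C2_ge0 : 0 <= C2 by rewrite !mulr_ge0 ?exprn_ge0 ?expC_ge0 ?(ltW A0).
have eN0 : 0 <= e ^+ N by rewrite exprn_ge0// ltW.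
have [Vbig|Vsmall] := leP e^-1 (th ^+ 2 * V 0%N).
  apply: (@le_trans _ _ (C1 * e ^+ N)); last by rewrite ler_wpM2r// lerDl.
  rewrite (@sum_dw R R^o) (le_trans (ler_norm_sum _ _ _))//.
  apply: (@le_trans _ _ (\sum_(i < N.+1)
      `|dw R N i| * (expR (n ^+ 2) * (4 * n * e) ^+ N))); last first.
    rewrite -mulr_suml (@le_trans _ _ (2 ^+ N * (expR (n ^+ 2) * (4 * n * e) ^+ N)))//.
      rewrite ler_wpM2r ?sum_norm_dw// mulr_ge0 ?expR_ge0// exprn_ge0//.
      by rewrite !mulr_ge0// ?ltW.
    by rewrite /C1 [in leLHS]exprMn !mulrA.
  apply: ler_sum => i _; rewrite normrM ler_wpM2l// (ger0_norm (expR_ge0 _)).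
  rewrite -/(V i).
  have /V0i Hi : (i <= N)%N by rewrite -ltnS.
  have n20 : 0 <= n ^+ 2 by exact: sqr_ge0.
  rewrite (@le_trans _ _ (expR (n ^+ 2 + - (e^-1 / 4))))//.
    by rewrite ler_expR; lra.
  rewrite expRD ler_wpM2l ?expR_ge0// (le_trans (expRN_le_pow N0 _))//.
    by rewrite divr_gt0// invr_gt0.
  rewrite lerXn2r ?nnegrE ?mulr_ge0 ?invr_ge0 ?divr_ge0 ?invr_ge0 ?(ltW e0)//.
  by rewrite invf_div invrK mulrA (mulrC n).
apply: (@le_trans _ _ (C2 * e ^+ N)); last by rewrite ler_wpM2r// lerDr.
pose p i := - (th ^+ 2 * (V i - V 0%N) / 2).
pose k := A * e.
have k0 : 0 <= k by rewrite mulr_ge0// ltW.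
have nk1 : n * k <= 1 by rewrite /k mulrA.
have k1 : k <= 1 by rewrite (le_trans _ nk1)// ler_peMl.
(* The first difference escapes the power estimate, because [2 * H] may exceed 1. It comes from
   [fvar_lip] with parameter [e ^+ 2]: the variance term, where [th^2 V] is of order at most
   [1 / e], contributes a multiple of [e], and the increment at most [e^4 + e^2]. *)
have dp1 i : (i < N)%N -> `|dif p i| <= k.
  move=> iN; rewrite /dif /p.
  have e2 : 0 < e ^+ 2 by rewrite exprn_gt0.
  have d1 : `|i.+1%:R * h - i%:R * h| = h.
    by rewrite -mulrBl -natrB// subSnn mul1r gtr0_norm.
  have d2 : `|i%:R * h - i.+1%:R * h| = h by rewrite distrC.
  have L1 := lip _ _ _ (ltnW iN) iN e2; rewrite d1 in L1.
  have L2 := lip _ _ _ iN (ltnW iN) e2; rewrite d2 in L2.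
  have := Vi0 _ (ltnW iN); have := Vi0 _ iN.
  have := ler_wpM2l th0 L1; have := ler_wpM2l th0 L2.
  rewrite ![_ * (_ * V _ + _)]mulrDr ![th ^+ 2 * ((1 + _) * V _)]mulrCA.
  rewrite ![th ^+ 2 * ((1 + _) * powR _ _)]mulrCA.
  have : (1 + (e ^+ 2)^-1) * (th ^+ 2 * h `^ (2 * H)) <= e ^+ 4 + e ^+ 2.
    rewrite (@le_trans _ _ ((1 + (e ^+ 2)^-1) * e ^+ 4))//.
      by rewrite ler_wpM2l// addr_ge0// invr_ge0 ltW.
    rewrite mulrDl mul1r lerD2l (_ : e ^+ 4 = e ^+ 2 * e ^+ 2); last by ring.
    by rewrite mulrA mulVf ?mul1r// lt0r_neq0.
  have e4e : e ^+ 4 <= e by rewrite eX.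
  have e2e : e ^+ 2 <= e by rewrite eX.
  have ee : e ^+ 2 * e^-1 = e by rewrite expr2 mulfK// lt0r_neq0.
  have n20 : 0 <= n ^+ 2 by exact: sqr_ge0.
  have aux a : a <= 2 * (th ^+ 2 * V 0%N) + 2 * n ^+ 2 ->
      e ^+ 2 * a <= 2 * e + 2 * n ^+ 2 * e.
    move=> ha; rewrite (@le_trans _ _ (e ^+ 2 * (2 * e^-1 + 2 * n ^+ 2)))//.
      by rewrite ler_wpM2l ?(ltW e2)// (le_trans ha)//; lra.
    rewrite mulrDr mulrCA ee lerD2l mulrC ler_wpM2l//; lra.
  have kE : k = 2 * M * e + (2 * n ^+ 2 * e + 4 * e) by rewrite /k /A; ring.
  have Me0 : 0 <= M * e by rewrite mulr_ge0 ?(ltW e0)//; lra.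
  have ne0 : 0 <= n ^+ 2 * e by rewrite mulr_ge0 ?(ltW e0).
  move: (_ * (th ^+ 2 * powR _ _)) => D De L2' L1' /aux B2 /aux B1.
  rewrite kE mulrBr mulrBr ler_norml; apply/andP; split; lra.
have pk i : (i <= N)%N -> `|p i| <= i%:R * k.
  elim: i => [|i IH] iN.
    by rewrite /p subrr mulr0 mul0r oppr0 normr0 mul0r.
  have -> : p i.+1 = p i + dif p i by rewrite /dif addrC subrK.
  by rewrite (le_trans (ler_normD _ _))// -natr1 mulrDl mul1r lerD ?dp1// IH// ltnW.
have smooth_p : smooth k N 1 p.
  apply: smooth_iter => j i jiN; rewrite mul1r.
  case: j jiN => [|[|j]] jiN.
  - rewrite expr0 /= (le_trans (pk _ jiN))// (le_trans _ nk1)// ler_wpM2r//.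
    by rewrite ler_nat.
  - by rewrite expr1 dp1.
  have -> : p = fun i => - (th ^+ 2 / 2) * V i + th ^+ 2 * V 0%N / 2.
    by apply/funext => q; rewrite /p; field.
  rewrite iter_difD iter_dif_cst addr0 iter_difZ iter_dif_addn.
  rewrite (_ : (fun q => V (i + q)%N) = fun q => fvar H l (t + i%:R * h + q%:R * h)); last first.
    by apply/funext => q; rewrite /V natrD mulrDl addrA.
  have iN : (i <= N)%N by rewrite (leq_trans _ jiN)// leq_addl.
  have ihr : i%:R * h <= r / 2.
    by rewrite (le_trans _ nhr)// ler_wpM2r ?(ltW h0)// ler_nat.
  have jN : (1 < j.+2 <= N)%N by rewrite (leq_trans _ jiN)// leq_addr.
  have fl' : far m (2 * (r / 2)) (t + i%:R * h) l.
    split=> // q /lP[q1 q2 q3]; split=> //.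
    have := lerB_normD (t - q.2) (i%:R * h).
    by rewrite (ger0_norm (ih0 i)) addrAC; lra.
  have r20 : 0 < r / 2 by rewrite divr_gt0.
  have nhr' : n * `|h| <= r / 2 by rewrite gtr0_norm.
  have rt' : 2 * (r / 2) <= t + i%:R * h by have := ih0 i; lra.
  have := HK j.+2 m l _ h (r / 2) jN r20 nhr' rt' fl'.
  rewrite normrM normrN (ger0_norm (_ : 0 <= th ^+ 2 / 2)) ?divr_ge0// (gtr0_norm h0).
  set W := `|_| => HW.
  apply: (@le_trans _ _ (th ^+ 2 * W)).
    by rewrite ler_wpM2r ?normr_ge0//; lra.
  rewrite (le_trans (ler_wpM2l th0 HW))//.
  have -> : (r / 2) `^ (2 * H - j.+2%:R) =
      r `^ (2 * H) / r ^+ j.+2 * (2 `^ (- (2 * H)) * 2 ^+ j.+2).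
    rewrite powRM ?(ltW r0)// powRB ?(lt0r_neq0 r0) ?implybT//.
    rewrite powR_mulrn ?(ltW r0)//; congr (_ * _).
    have -> : 2^-1 = 2 `^ (-1) :> R by rewrite powR_inv1.
    rewrite -powRrM -powR_mulrn// -powRD; last by rewrite lt0r_neq0// implybT.
    by congr powR; ring.
  have b1 : 2 `^ (- (2 * H)) <= 1 :> R.
    by rewrite -[leRHS](powRr0 2); apply: ler_powR; rewrite ?ler1n// oppr_le0 mulr_ge0// ltW.
  have -> : th ^+ 2 * ((1 + 2 * m%:R) * (K * h ^+ j.+2 * (r `^ (2 * H) / r ^+ j.+2 *
      (2 `^ (- (2 * H)) * 2 ^+ j.+2)))) =
      M * 2 ^+ j.+2 * (2 `^ (- (2 * H)) * ((th ^+ 2 * r `^ (2 * H)) * (h / r) ^+ j.+2)).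
    by rewrite /M expr_div_n; ring.
  have Mj : M * 2 ^+ j.+2 <= A ^+ j.+2.
    apply: (@le_trans _ _ ((2 * M) ^+ j.+2)).
      rewrite exprMn [leLHS]mulrC ler_wpM2l ?exprn_ge0//.
      by rewrite -[leLHS]expr1; apply: ler_weXn2l.
    have MA : 2 * M <= A by rewrite lerDl addr_ge0// mulr_ge0// sqr_ge0.
    have M20 : 0 <= 2 * M by exact: mulr_ge0 (ler0n _ 2) (le_trans ler01 M1).
    by rewrite lerXn2r ?nnegrE ?(ltW A0).
  have hrj : 0 <= (h / r) ^+ j.+2 by rewrite exprn_ge0// ltW.
  have thr0 : 0 <= th ^+ 2 * r `^ (2 * H) by rewrite mulr_ge0 ?powR_ge0.
  have M2j : 0 <= M * 2 ^+ j.+2.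
    exact: mulr_ge0 (le_trans ler01 M1) (exprn_ge0 _ (ler0n _ 2)).
  have rest0 := mulr_ge0 thr0 hrj.
  have rest1 := mulr_ge0 (powR_ge0 2 (- (2 * H))) rest0.
  rewrite /k [leRHS]exprMn; apply: ler_pM => //.
  rewrite -[leRHS]mul1r; apply: ler_pM => //.
  apply: (@le_trans _ _ ((e ^+ 4)^-1 * (e ^+ 4) ^+ j.+2)).
    apply: ler_pM => //.
    by rewrite lerXn2r ?nnegrE ?exprn_ge0 ?(ltW e0) ?(ltW hr0).
  rewrite (exprS _ j.+1) mulrA mulVf ?mul1r ?lt0r_neq0 ?exprn_gt0// -exprM.
  by rewrite ler_wiXn2l ?(ltW e0)// mulnS (leq_add (_ : 2 <= 4)%N) ?leq_pmull.
rewrite (_ : (fun i => _) = fun i => expR (- (th ^+ 2 * V 0%N / 2)) *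
    ((expR (p i) - 1) + 1)); last first.
  by apply/funext => i; rewrite subrK -expRD -/(V i); congr expR; rewrite /p; field.
rewrite iter_difZ iter_difD -[N in iter N _ (fun=> 1)]prednK// iter_dif_cst addr0.
rewrite normrM (ger0_norm (expR_ge0 _)).
apply: (@le_trans _ _ (1 * (expC R N * 1 * k ^+ N))); last first.
  by rewrite mul1r mulr1 /k exprMn mulrA.
rewrite ler_pM ?expR_ge0//.
  by rewrite -expR0 ler_expR oppr_le0 divr_ge0// mulr_ge0.
apply: iter_dif_bound; apply: smooth_expR => //; first by rewrite ler01 lexx.
Qed.

End characteristic_decay.

(** * Gaussian characteristic functions *)

Section dominated.
Context d (T : measurableType d) (R : realType) (mu : {measure set T -> \bar R}).

Lemma dominated_cvg_Rintegral (D : set T) (f_ : nat -> T -> R) (f g : T -> R) :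
  measurable D -> (forall n, measurable_fun D (f_ n)) -> measurable_fun D f ->
  (forall x, D x -> f_ n x @[n --> \oo] --> f x) ->
  mu.-integrable D (EFin \o g) -> (forall n x, D x -> `|f_ n x| <= g x) ->
  \int[mu]_(x in D) f_ n x @[n --> \oo] --> \int[mu]_(x in D) f x.
Proof.
move=> mD mf_ mf cf ig fg.
have [|||||intf _ c] := @dominated_convergence _ _ _ mu D mD
    (fun n => EFin \o f_ n) (EFin \o f) (EFin \o g).
- by move=> n; exact/measurable_EFinP.
- exact/measurable_EFinP.
- by apply: aeW => x Dx; apply: cvg_EFin; [exact: nearW|exact: cf].
- exact: ig.
- by apply: aeW => x n Dx /=; rewrite lee_fin fg.
by apply: fine_cvg; rewrite fineK//; exact: integrable_fin_num.
Qed.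

Lemma integrable_le (D : set T) (f g : T -> R) : measurable D ->
  measurable_fun D f -> (forall x, D x -> `|f x| <= g x) ->
  mu.-integrable D (EFin \o g) -> mu.-integrable D (EFin \o f).
Proof.
move=> mD mf fg ig; apply: le_integrable ig => //; first exact/measurable_EFinP.
by move=> x Dx /=; rewrite lee_fin (le_trans (fg _ Dx))// ler_norm.
Qed.

End dominated.

Section normal_law.
Context (R : realType) (m s : R).
Hypothesis s_gt0 : 0 < s.
Notation N := (normal_prob m s).
Notation p := (normal_pdf m s).
Notation leb := (@lebesgue_measure R).

Let numu : N `<< leb. Proof. exact: normal_prob_dominates. Qed.

(** Identifying the Radon-Nikodym derivative with the explicit density turns integrals against the
    law into Lebesgue integrals, to which calculus applies. *)
Lemma normal_density_ae : ae_eq leb setT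
  (Radon_Nikodym_SigmaFinite.f N leb) (fun x => (p x)%:E).
Proof.
apply: integral_ae_eq => //.
- exact: Radon_Nikodym_SigmaFinite.f_integrable.
- by apply/measurable_EFinP; exact: measurable_normal_pdf.
- by move=> E _ mE; rewrite -Radon_Nikodym_SigmaFinite.f_integral.
Qed.

Lemma ge0_integral_normal (f : R -> R) : measurable_fun setT f ->
  (forall x, 0 <= f x) ->
  (\int[N]_x (f x)%:E = \int[leb]_x (f x * p x)%:E)%E.
Proof.
move=> mf f0.
have mfE : measurable_fun setT (EFin \o f) by exact/measurable_EFinP.
rewrite -(Radon_Nikodym_SigmaFinite.change_of_variables numu) //.
apply: ae_eq_integral => //.
- apply: emeasurable_funM => //.
  exact: measurable_int (Radon_Nikodym_SigmaFinite.f_integrable numu).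
- apply/measurable_EFinP/measurable_funM => //; exact: measurable_normal_pdf.
- have := normal_density_ae; apply: filterS => x /(_ I) -> _.
  by rewrite EFinM.
Qed.

Lemma integrable_normal (f : R -> R) : N.-integrable setT (EFin \o f) ->
  leb.-integrable setT (EFin \o (fun x => f x * p x)).
Proof.
move=> /integrableP[/measurable_EFinP mf intf]; apply/integrableP; split.
  by apply/measurable_EFinP/measurable_funM => //; exact: measurable_normal_pdf.
move: intf; rewrite /= ge0_integral_normal//; last exact: measurableT_comp.
apply: le_lt_trans; rewrite le_eqVlt; apply/orP; left; apply/eqP.
apply: eq_integral => x _ /=.
by rewrite normrM (ger0_norm (normal_pdf_ge0 _ _ _)).
Qed.

Lemma Rintegral_normal (f : R -> R) : N.-integrable setT (EFin \o f) ->
  \int[N]_x f x = \int[leb]_x (f x * p x).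
Proof.
move=> intf; rewrite /Rintegral; congr fine.
rewrite -(@Radon_Nikodym_change_of_variables _ _ _ N leb numu _ _ measurableT intf).
have mf := measurable_int _ intf.
apply: ae_eq_integral => //.
- by apply: emeasurable_funM => //; exact: measurable_int (Radon_Nikodym_integrable _).
- apply/measurable_EFinP/measurable_funM; last exact: measurable_normal_pdf.
  exact/measurable_EFinP.
- have := ae_eq_Radon_Nikodym_SigmaFinite numu measurableT.
  have := normal_density_ae; apply: filterS2 => x /(_ I) h1 /(_ I) h2 _.
  by rewrite /= -h2 h1 EFinM.
Qed.

Let s_neq0 : s != 0. Proof. exact: lt0r_neq0. Qed.

Lemma normal_pdf_expR x :
  p x = normal_peak s * expR (- ((x - m) ^+ 2 / (s ^+ 2 *+ 2))).
Proof. by rewrite normal_pdfE// /normal_fun mulNr. Qed.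

Lemma is_derive_normal_pdf x : is_derive x (1 : R) p (- ((x - m) / s ^+ 2) * p x).
Proof.
have D0 : is_derive x (1 : R) (fun y => y - m) 1 by exact: is_derive_shift.
have D1 := is_deriveZ (- (s ^+ 2 *+ 2)^-1) (is_deriveX 2 D0).
have D2 := is_deriveZ (normal_peak s) (is_derive1_comp (is_derive_expR _) D1).
move: D2; rewrite (_ : normal_peak s \*: _ = p); last first.
  apply/funext => y; rewrite normal_pdf_expR/=.
  by congr (_ * expR _); rewrite /GRing.scale/= mulNr mulrC.
move=> D2; apply: is_derive_eq.
rewrite normal_pdf_expR /GRing.scale/= /GRing.scale/= mulr1 expr1 mulNr.
have -> : expR (- ((s ^+ 2 *+ 2)^-1 * ((fun y => y - m) ^+ 2) x)) =
    expR (- ((x - m) ^+ 2 / (s ^+ 2 *+ 2))) by rewrite mulrC.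
by move: (expR _) => E; rewrite -mulr_natr; field.
Qed.

(** These are the boundary terms of Stein's identity. Once [|u n| >= 2 |m|], the density at [u n] is
    at most a multiple of [1 / (u n)^2], which beats the linear growth of [f]. *)
Lemma cvg_mul_normal_pdf (f : R -> R) (a b : R) (u : nat -> R) :
  (forall n, n.+1%:R <= `|u n|) -> (forall x, `|f x| <= a + b * `|x|) ->
  f (u n) * p (u n) @[n --> \oo] --> 0.
Proof.
move=> un fab; pose K := (`|a| + `|b|) * (normal_peak s * (8 * s ^+ 2)).
have K0 : 0 <= K.
  rewrite mulr_ge0 ?addr_ge0// mulr_ge0 ?normal_peak_ge0//.
  exact: mulr_ge0 (sqr_ge0 s).
apply: norm_cvg0; apply: (@squeeze_cvgr _ _ _ _ (cst 0) (fun n => K * harmonic n)).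
- near=> n; rewrite /= normr_ge0/=.
  have m2 : 2 * `|m| <= `|u n|.
    rewrite (le_trans _ (un n))// (@le_trans _ _ n%:R) ?ler_nat//.
    by near: n; exact: nbhs_infty_ger.
  have u1 : 1 <= `|u n| by rewrite (le_trans _ (un n))// ler1n.
  have u0 : 0 < `|u n| by rewrite (lt_le_trans _ u1).
  rewrite normrM (ger0_norm (normal_pdf_ge0 _ _ _)) normal_pdf_expR.
  have um : `|u n| / 2 <= `|u n - m| by have := lerB_dist (u n) m; lra.
  have y1 : `|u n| ^+ 2 / (8 * s ^+ 2) <= (u n - m) ^+ 2 / (s ^+ 2 *+ 2).
    rewrite -(real_normK (num_real (u n - m))) -(mulr_natr (s ^+ 2)).
    rewrite [leLHS](_ : _ = (`|u n| / 2) ^+ 2 / (s ^+ 2 * 2)); last by field.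
    rewrite ler_pM2r ?invr_gt0 ?mulr_gt0 ?exprn_gt0//.
    by rewrite lerXn2r ?nnegrE// divr_ge0.
  have y0 : 0 < `|u n| ^+ 2 / (8 * s ^+ 2).
    by rewrite divr_gt0 ?mulr_gt0 ?exprn_gt0.
  have e1 : expR (- ((u n - m) ^+ 2 / (s ^+ 2 *+ 2))) <= 8 * s ^+ 2 / `|u n| ^+ 2.
    rewrite (le_trans (_ : _ <= expR (- (`|u n| ^+ 2 / (8 * s ^+ 2)))))//.
      by rewrite ler_expR lerN2.
    by rewrite (le_trans (expRN_le_pow (ltn0Sn 0) y0))// expr1 div1r invf_div.
  have f1 : `|f (u n)| <= (`|a| + `|b|) * `|u n|.
    rewrite (le_trans (fab _))// mulrDl lerD// ?ler_wpM2r ?ler_norm//.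
    by rewrite (le_trans (ler_norm _))// ler_peMr.
  apply: (@le_trans _ _ (K * `|u n|^-1)).
    rewrite /K (_ : _ * `|u n|^-1 = ((`|a| + `|b|) * `|u n|) *
      (normal_peak s * (8 * s ^+ 2 / `|u n| ^+ 2))); last by field; rewrite lt0r_neq0.
    rewrite ler_pM ?mulr_ge0 ?normal_peak_ge0 ?expR_ge0//.
    by rewrite ler_wpM2l ?normal_peak_ge0.
  by rewrite ler_wpM2l// lef_pV2 ?posrE.
- exact: cvg_cst.
- by rewrite -(mulr0 K); apply: cvgMr; exact: cvg_harmonic.
Unshelve. all: end_near. Qed.

(* Stein's identity: [(f p)' = f' p - (x - m) f p / s^2] has integral 0. *)
Lemma normal_stein (f f' : R -> R) (a b c : R) : 0 <= b ->
  (forall x, is_derive x (1 : R) f (f' x)) -> continuous f' ->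
  (forall x, `|f x| <= a + b * `|x|) -> (forall x, `|f' x| <= c) ->
  N.-integrable setT (EFin \o (fun x => x ^+ 2)) ->
  \int[N]_x ((x - m) * f x) = s ^+ 2 * \int[N]_x f' x.
Proof.
move=> b0 Df cf' fab f'c ix2.
have cf : continuous f.
  by move=> x; apply/differentiable_continuous/derivable1_diffP; case: (Df x).
have mf : measurable_fun setT f by exact: continuous_measurable_fun.
have mf' : measurable_fun setT f' by exact: continuous_measurable_fun.
have if' : N.-integrable setT (EFin \o f').
  apply: (@integrable_le _ _ _ _ _ _ (cst c)) => //.
  exact: finite_measure_integrable_cst.
have ixf : N.-integrable setT (EFin \o (fun x => (x - m) * f x)).
  pose A : R := (1 + `|m|) * (`|a| + b).
  apply: (@integrable_le _ (measurableTypeR R) _ _ _ _ (fun x : R => A * (2 + 2 * x ^+ 2)) measurableT).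
  - by apply: measurable_funM => //; apply: measurable_funB.
  - move=> x _; rewrite normrM /A.
    have x2 : `|x| ^+ 2 = x ^+ 2 by rewrite real_normK// num_real.
    have h1 : `|x - m| <= (1 + `|m|) * (1 + `|x|).
      by rewrite (le_trans (ler_normB _ _))//; have := normr_ge0 m; have := normr_ge0 x; nra.
    have h2 : `|f x| <= (`|a| + b) * (1 + `|x|).
      by rewrite (le_trans (fab _))//; have := ler_norm a; have := normr_ge0 a; have := normr_ge0 x; nra.
    rewrite (le_trans (ler_pM _ _ h1 h2))//.
    rewrite mulrACA ler_wpM2l ?mulr_ge0 ?addr_ge0// -x2.
    have aux (y : R) : (1 + y) * (1 + y) <= 2 + 2 * y ^+ 2.
      rewrite -subr_ge0 (_ : _ - _ = (y - 1) ^+ 2) ?sqr_ge0//; ring.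
    exact: aux.
  rewrite /comp; under eq_fun do rewrite EFinM EFinD.
  apply: integrableZl => //; apply: integrableD => //.
    exact: finite_measure_integrable_cst.
  under eq_fun do rewrite EFinM.
  exact: integrableZl.
pose g x := f' x * p x - (s ^+ 2)^-1 * (((x - m) * f x) * p x).
have ig : leb.-integrable setT (EFin \o g).
  rewrite /comp; under eq_fun do rewrite EFinB.
  apply: integrableB => //; first exact: integrable_normal.
  under eq_fun do rewrite EFinM.
  by apply: integrableZl => //; exact: integrable_normal ixf.
suff g0 : \int[leb]_x g x = 0.
  move: g0; rewrite /g RintegralB//; last 2 first.
  - exact: integrable_normal.
  - rewrite /comp; under eq_fun do rewrite EFinM.
    by apply: integrableZl => //; exact: integrable_normal ixf.
  rewrite RintegralZl//; last exact: integrable_normal ixf.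
  rewrite -!Rintegral_normal// => /eqP; rewrite subr_eq0 => /eqP ->.
  by rewrite mulrA mulfV ?mul1r// expf_neq0.
have Dfp x : is_derive x (1 : R) (f * p) (g x).
  have := is_deriveM (Df x) (is_derive_normal_pdf x).
  by move=> D; apply: is_derive_eq; rewrite /GRing.scale/= /g; field.
have cp : continuous p by exact: continuous_normal_pdf.
have cg : continuous g.
  move=> x; apply: cvgB; apply: cvgM => //; [exact: cf'|exact: cp|exact: cvg_cst|].
  apply: cvgM; last exact: cp.
  by apply: cvgM; [apply: cvgB; [exact: cvg_id|exact: cvg_cst]|exact: cf].
have mg : measurable_fun setT g by exact: continuous_measurable_fun.
have cfp x : {for x, continuous (f * p)} by apply: cvgM; [exact: cf|exact: cp].
have E n : \int[leb]_(x in `[- n.+1%:R, n.+1%:R]) g x =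
    f n.+1%:R * p n.+1%:R - f (- n.+1%:R) * p (- n.+1%:R).
  have nn : - n.+1%:R < n.+1%:R :> R by rewrite gtrN.
  rewrite /Rintegral (@continuous_FTC2 _ g (f * p) _ _ nn)//.
  - by apply: continuous_subspaceT => x; exact: cg.
  - split.
    + by move=> x _; case: (Dfp x).
    + exact/cvg_at_right_filter/cfp.
    + exact/cvg_at_left_filter/cfp.
  - by move=> x _; rewrite derive1E; have [_ ->] := Dfp x.
have c1 : \int[leb]_(x in `[- n.+1%:R, n.+1%:R]) g x @[n --> \oo] --> (0 : R).
  rewrite (_ : (fun n => _) = fun n => f n.+1%:R * p n.+1%:R - f (- n.+1%:R) * p (- n.+1%:R)); last exact/funext.
  have h1 := @cvg_mul_normal_pdf f a b (fun n => n.+1%:R) _ fab.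
  have h2 := @cvg_mul_normal_pdf f a b (fun n => - n.+1%:R) _ fab.
  rewrite -(subr0 (0 : R)); apply: cvgB; [apply: h1|apply: h2] => n.
    by rewrite normr_nat.
  by rewrite normrN normr_nat.
have c2 : \int[leb]_(x in `[- n.+1%:R, n.+1%:R]) g x @[n --> \oo] -->
    \int[leb]_x g x.
  rewrite (_ : (fun n => _) = fun n => \int[leb]_x (g \_ `[- n.+1%:R, n.+1%:R]) x); last first.
    by apply/funext => n; rewrite Rintegral_mkcond.
  apply: (@dominated_cvg_Rintegral _ (measurableTypeR R) R leb setT _ g (fun x => `|g x|)) => //.
  - move=> n; apply/measurable_restrict => //; exact: measurable_funTS.
  - move=> x _; apply: cvg_near_cst; near=> n.
    rewrite patchE mem_set//= in_itv/= -ler_norml.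
    rewrite (@le_trans _ _ n%:R) ?ler_nat//.
    by near: n; exact: nbhs_infty_ger.
  - exact: integrable_abse ig.
  - by move=> n x _; rewrite patchE; case: ifP => //; rewrite normr0.
exact: cvg_unique c2 c1.
Unshelve. all: end_near. Qed.

End normal_law.

Section normal_characteristic.
Context (R : realType) (m s : R).
Hypothesis s_gt0 : 0 < s.
Notation N := (normal_prob m s).
Hypothesis ix2 : N.-integrable setT (EFin \o (fun x : R => x ^+ 2)).

Lemma integrable_normal_id : N.-integrable setT (EFin \o (fun x : R => x)).
Proof.
apply: (@integrable_le _ (measurableTypeR R) _ _ _ _ (fun x : R => 1 + x ^+ 2) measurableT).
- exact: measurable_id.
- have aux (y : R) : `|y| <= 1 + y ^+ 2.
    rewrite -(real_normK (num_real y)) -subr_ge0.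
    have := sqr_ge0 (`|y| - 1); have := normr_ge0 y; move: `|y| => z z0 z1; nra.
  by move=> x _; exact: aux.
- rewrite /comp; under eq_fun do rewrite EFinD.
  by apply: integrableD => //; exact: finite_measure_integrable_cst.
Qed.

(** Stein's identity with [f = 1]; the variance comes likewise from [f = id]. *)
Lemma normal_mean : \int[N]_x x = m.
Proof.
have := @normal_stein R m s s_gt0 (cst 1) (cst 0) 1 0 0 (lexx _) _ _ _ _ ix2.
rewrite /= Rintegral_cst// mul0r mulr0 => h; apply/eqP; rewrite -subr_eq0; apply/eqP.
rewrite -[RHS]h.
- under [RHS]eq_Rintegral do rewrite mulr1.
  rewrite RintegralB//; last exact: finite_measure_integrable_cst.
    by rewrite Rintegral_cst//= probability_setT mulr1.
  exact: integrable_normal_id.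
- by move=> x; exact: cvg_cst.
- by move=> x; rewrite normr1 mul0r addr0.
- by move=> x; rewrite normr0.
Qed.

Hypothesis m0 : m = 0.

Lemma normal_variance : \int[N]_x (x ^+ 2) = s ^+ 2.
Proof.
have := @normal_stein R m s s_gt0 id (cst 1) 0 1 1 ler01 _ _ _ _ ix2.
rewrite /= Rintegral_cst//= probability_setT !mulr1 => <-.
- by apply: eq_Rintegral => x _; rewrite m0 subr0 expr2.
- by move=> x; exact: cvg_cst.
- by move=> x; rewrite add0r mul1r.
- by move=> x; rewrite normr1.
Qed.

Let C (a t : R) := \int[N]_x cos (a + t * x).

Let is_derive_lin (a t x : R) : is_derive x (1 : R) (fun y => a + t * y) t.
Proof.
rewrite -[X in is_derive _ _ _ X]add0r; apply: is_deriveD.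
by rewrite -[X in is_derive _ _ _ X]mulr1; exact: (is_deriveZ t (is_derive_id _ _)).
Qed.

Let is_derive_lin' (a t x : R) : is_derive x (1 : R) (fun y => a + y * t) t.
Proof.
rewrite (_ : (fun y => _) = fun y => a + t * y); first exact: is_derive_lin.
by apply/funext => y; rewrite mulrC.
Qed.

Let mlin (a t : R) : measurable_fun setT (fun x : measurableTypeR R => a + t * x).
Proof. by apply: measurable_funD => //; apply: measurable_funM. Qed.

Let integrable_bounded (f : R -> R) c : measurable_fun setT f ->
  (forall x, `|f x| <= c) -> N.-integrable setT (EFin \o f).
Proof.
move=> mf fc; apply: (@integrable_le _ (measurableTypeR R) _ _ _ _ (cst c) measurableT) => //.
exact: finite_measure_integrable_cst.
Qed.

(** Differentiating under the integral sign, with dominating function [|x|], gives the mean of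
    [- x sin (a + t x)], which Stein's identity turns back into a mean of cosines. The phase [a]
    makes one formula serve for cosines and sines. *)
Lemma is_derive_normal_char (a t : R) :
  is_derive t (1 : R) (C a) (- (s ^+ 2 * t) * C a t).
Proof.
pose f (t x : R) := cos (a + t * x).
have Df u x : is_derive u (1 : R) (f ^~ x) (- (x * sin (a + u * x))).
  rewrite mulrC -mulNr.
  exact: (is_derive1_comp (is_derive_cos _) (is_derive_lin' a x u)).
have d1E u x : partial1of2 f u x = - (x * sin (a + u * x)).
  by rewrite partial1of2E; have [_ ->] := Df u x.
have int_f u : N.-integrable setT (EFin \o f u).
  apply: (integrable_bounded (c := 1)); last by move=> x; rewrite ler_norml cos_geN1 cos_le1.
  exact: measurableT_comp (continuous_measurable_fun (@continuous_cos R)) (mlin a u).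
have tI : t \in `]t - 1, t + 1[ by rewrite in_itv/= gtrBl ltrDl ltr01.
have iabs : N.-integrable setT (EFin \o (fun x : R => `|x|)).
  exact: integrable_abse integrable_normal_id.
have dom u x : `]t - 1, t + 1[%classic u -> setT x -> `|partial1of2 f u x| <= `|x|.
  move=> _ _; rewrite d1E normrN normrM ler_piMr//.
  by rewrite ler_norml sin_geN1 sin_le1.
have der u x : `]t - 1, t + 1[%classic u -> [set: R] x -> derivable (f ^~ x) u 1.
  by move=> _ _; case: (Df u x).
have E := @differentiation_under_integral R _ (measurableTypeR R) N f setT measurableT
  t (t - 1) (t + 1) tI (fun u _ => int_f u) der (fun x => `|x|) (fun x => normr_ge0 x)
  iabs dom.
have D := @derivable_under_integral R _ (measurableTypeR R) N f setT measurableT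
  t (t - 1) (t + 1) tI (fun u _ => int_f u) der (fun x => `|x|) (fun x => normr_ge0 x)
  iabs dom.
apply: DeriveDef => //.
rewrite -derive1E E.
under eq_Rintegral do rewrite d1E -mulN1r.
rewrite RintegralZl//; last first.
  apply: (@integrable_le _ (measurableTypeR R) _ _ _ _ (fun x : R => `|x|) measurableT) => //.
    apply: measurable_funM => //.
    exact: measurableT_comp (continuous_measurable_fun (@continuous_sin R)) (mlin a t).
  move=> x _; rewrite normrM ler_piMr//.
  by rewrite ler_norml sin_geN1 sin_le1.
rewrite mulN1r mulNr; congr (- _).
have P1 x : is_derive x (1 : R) (fun x => sin (a + t * x)) (t * cos (a + t * x)).
  by rewrite mulrC; exact: (is_derive1_comp (is_derive_sin _) (is_derive_lin a t x)).
have P2 : continuous (fun x => t * cos (a + t * x)).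
  move=> x; apply: cvgM; first exact: cvg_cst.
  apply: (@continuous_comp _ _ _ (fun x => a + t * x) cos); last exact: continuous_cos.
  by apply: cvgD; [exact: cvg_cst|apply: cvgM; [exact: cvg_cst|exact: cvg_id]].
have P3 x : `|sin (a + t * x)| <= 1 + 0 * `|x|.
  by rewrite mul0r addr0 ler_norml sin_geN1 sin_le1.
have P4 x : `|t * cos (a + t * x)| <= `|t|.
  by rewrite normrM ler_piMr// ler_norml cos_geN1 cos_le1.
rewrite (_ : \int[N]_x (x * _) = \int[N]_x ((x - m) * sin (a + t * x))); last first.
  by apply: eq_Rintegral => x _; rewrite m0 subr0.
rewrite (normal_stein s_gt0 (lexx _) P1 P2 P3 P4 ix2).
by rewrite (RintegralZl t measurableT (int_f t)) mulrA.
Qed.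

(** By the differential equation above, [C a t * expR (s^2 t^2 / 2)] does not depend on [t]; compare
    [t = 0] and [t = 1]. *)
Lemma normal_char (a : R) : \int[N]_x cos (a + x) = cos a * expR (- (s ^+ 2 / 2)).
Proof.
pose G t := C a t * expR (s ^+ 2 / 2 * t ^+ 2).
have DG t : is_derive t (1 : R) G 0.
  have D1 := is_deriveZ (s ^+ 2 / 2) (is_deriveX 2 (is_derive_id t (1 : R))).
  have D2 := is_derive1_comp (is_derive_expR _) D1.
  have D3 := is_deriveM (is_derive_normal_char a t) D2.
  move: D3; set h := (X in is_derive _ _ X _); rewrite (_ : h = G)//.
  move=> D3; apply: is_derive_eq; rewrite /GRing.scale/= /GRing.scale/=.
  by move: (expR _) (C a t) => e c; rewrite expr1; field.
have := is_derive_0_is_cst 1 0 DG.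
rewrite /G expr1n mulr1 expr0n mulr0 expR0 mulr1.
have -> : C a 0 = cos a.
  rewrite /C; under eq_Rintegral do rewrite mul0r addr0.
  by rewrite Rintegral_cst//= probability_setT mulr1.
have -> : C a 1 = \int[N]_x cos (a + x).
  by apply: eq_Rintegral => x _; rewrite mul1r.
by move=> <-; rewrite expRN mulfK// lt0r_neq0// expR_gt0.
Qed.

End normal_characteristic.

Section probability_Rintegral.
Context d (T : measurableType d) (R : realType) (P : probability T R).

Lemma integrable_bounded (f : T -> R) (c : R) : measurable_fun setT f ->
  (forall w, `|f w| <= c) -> P.-integrable setT (EFin \o f).
Proof.
move=> mf fc; apply: (@integrable_le _ _ _ _ _ _ (cst c)) => //.
exact: finite_measure_integrable_cst.
Qed.

Lemma Rintegral_sum_seq (I : eqType) (s : seq I) (F : I -> T -> R) :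
  (forall i, i \in s -> P.-integrable setT (EFin \o F i)) ->
  P.-integrable setT (EFin \o (fun w => \sum_(i <- s) F i w)) /\
  \int[P]_w (\sum_(i <- s) F i w) = \sum_(i <- s) \int[P]_w F i w.
Proof.
elim: s => [_|i s IH iF].
  split.
      apply: (eq_integrable measurableT _ _ _ (integrable0 P setT)).
    by move=> w _ /=; rewrite big_nil.
  rewrite big_nil; under eq_Rintegral do rewrite big_nil.
  by rewrite Rintegral_cst// mul0r.
have [|is_ es] := IH; first by move=> j js; apply: iF; rewrite inE js orbT.
have ii : P.-integrable setT (EFin \o F i) by apply: iF; rewrite mem_head.
split.
  apply: (eq_integrable measurableT _ _ _ (integrableD measurableT ii is_)).
  by move=> w _ /=; rewrite big_cons EFinD.
rewrite big_cons -es -RintegralD//.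
by apply: eq_Rintegral => w _; rewrite big_cons.
Qed.

Lemma le_Rintegral_bounded (f : T -> R) (c : R) : measurable_fun setT f ->
  (forall w, `|f w| <= c) -> `|\int[P]_w f w| <= c.
Proof.
move=> mf fc; have If := integrable_bounded mf fc.
rewrite (le_trans (le_normr_Rintegral _ If))//.
rewrite (@le_trans _ _ (\int[P]_w c))//; last first.
  by rewrite Rintegral_cst//= probability_setT mulr1.
apply: le_Rintegral => //; last exact: finite_measure_integrable_cst.
exact: integrable_abse If.
Qed.

Lemma Rintegral_law d' (T' : measurableType d') (L : probability T' R)
    (Z : T -> T') (f : T' -> R) :
  measurable_fun setT Z -> (forall A, measurable A -> P (Z @^-1` A) = L A) ->
  measurable_fun setT f -> P.-integrable setT (EFin \o (fun w => f (Z w))) ->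
  L.-integrable setT (EFin \o f) /\ \int[P]_w f (Z w) = \int[L]_x f x.
Proof.
move=> mZ lawZ mf ifZ.
pose X : {RV P >-> T'} := mfun_Sub (mem_set mZ).
have E (g : T' -> \bar R) :
    (\int[distribution P X]_x g x = \int[L]_x g x)%E.
  by apply: eq_measure_integral => A mA _; exact: lawZ.
have mfE : measurable_fun setT (EFin \o f) by exact/measurable_EFinP.
split; last by rewrite /Rintegral -E integral_distribution.
apply/integrableP; split => //.
rewrite -E ge0_integral_distribution//; last exact: measurableT_comp.
by case/integrableP : ifZ.
Qed.

(** Square integrability is transported from [Z] to its law, where it is what [normal_mean] and
    [normal_variance] require; these identify [m] with 0 and [s^2] with [v]. In the Dirac case [m]
    and [v] are both 0. *)
Lemma gaussian_rv_cos (Z : T -> R) (v a : R) : gaussian_rv P Z ->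
  P.-integrable setT (EFin \o (fun w => Z w ^+ 2)) ->
  \int[P]_w Z w = 0 -> \int[P]_w (Z w ^+ 2) = v ->
  \int[P]_w cos (a + Z w) = cos a * expR (- (v / 2)).
Proof.
move=> [mZ lawZ] iZ2 EZ EZ2.
have iZ : P.-integrable setT (EFin \o Z).
  apply: (@integrable_le _ _ _ _ _ _ (fun w => 1 + Z w ^+ 2)) => //.
    move=> w _; move: (Z w) => y; rewrite -(real_normK (num_real y)) -subr_ge0.
    have := sqr_ge0 (`|y| - 1); have := normr_ge0 y; move: `|y| => z z0 z1; nra.
  have i1 : P.-integrable setT (EFin \o cst (1 : R)).
    exact: finite_measure_integrable_cst.
  by apply: (eq_integrable measurableT _ _ _ (integrableD measurableT i1 iZ2)).
have mcos : measurable_fun setT (fun x : R => cos (a + x)).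
  apply: continuous_measurable_fun => x.
  apply: (@continuous_comp _ _ _ (fun x => a + x) cos); last exact: continuous_cos.
  by apply: cvgD; [exact: cvg_cst|exact: cvg_id].
have icos : P.-integrable setT (EFin \o (fun w => cos (a + Z w))).
  apply: (integrable_bounded (c := 1)); first exact: measurableT_comp mcos mZ.
  by move=> w; rewrite ler_norml cos_geN1 cos_le1.
have msq : measurable_fun setT (fun x : R => x ^+ 2).
  by apply: measurable_funX.
case: lawZ => [[m lawZ]|[m [s [s0 lawZ]]]].
  have D f (mf : measurable_fun setT f)
      (If : P.-integrable setT (EFin \o (fun w => f (Z w)))) :
      \int[P]_w f (Z w) = f m.
    have [_ ->] := @Rintegral_law _ _ (dirac m) Z f mZ lawZ mf If.
    by rewrite /Rintegral integral_dirac ?diracT ?mul1e//; exact/measurable_EFinP.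
  have m0 : m = 0 by rewrite -EZ (D id).
  by rewrite (D (fun x => cos (a + x)))// -EZ2 (D (fun x => x ^+ 2))// m0 addr0 expr2
    !mul0r oppr0 expR0 mulr1.
have D f (mf : measurable_fun setT f)
    (If : P.-integrable setT (EFin \o (fun w => f (Z w)))) :=
    @Rintegral_law _ (measurableTypeR R) (normal_prob m s) Z f mZ lawZ mf If.
have [ix2 e2] := D _ msq iZ2.
have [_ e1] := D id (@measurable_id _ _ _) iZ.
have m0 : m = 0 by rewrite -(normal_mean s0 ix2) -e1.
have [_ ->] := D _ mcos icos.
by rewrite (normal_char s0 ix2 m0) -EZ2 e2 (normal_variance s0 ix2 m0).
Qed.

End probability_Rintegral.

(** * Linear combinations of values of the process *)

Section fbm_moments.
Context d (T : measurableType d) (R : realType) (P : probability T R).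
Context (H : R) (B : R -> T -> R).
Hypothesis fbm_B : fractional_brownian_motion P H B.

Definition lincomb (l : seq (R * R)) (w : T) : R := \sum_(p <- l) p.1 * B p.2 w.

Let Dt (t : R) : 0 <= t -> `[0, +oo[%classic t.
Proof. by move=> t0; rewrite /= in_itv/= t0. Qed.

Lemma fbm_measurable t : 0 <= t -> measurable_fun setT (B t).
Proof. by case: fbm_B => -[mB _] _ _ /Dt /mB. Qed.

(** The covariance formula is an equality of extended reals with a finite right-hand side, and the
    integrand is nonnegative. *)
Lemma fbm_square_integrable t : 0 <= t ->
  P.-integrable setT (EFin \o (fun w => B t w ^+ 2)).
Proof.
move=> t0; have mBt := fbm_measurable t0; apply/integrableP; split.
  by apply/measurable_EFinP; apply: measurable_funX.
have [_ _ /(_ t t t0 t0)] := fbm_B; rewrite unlock => E.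
rewrite (eq_integral (fun w => ((B t \* B t) w)%:E)); first by rewrite E ltry.
by move=> w _ /=; rewrite ger0_norm ?sqr_ge0// expr2.
Qed.

Lemma fbm_mul_integrable s t : 0 <= s -> 0 <= t ->
  P.-integrable setT (EFin \o (fun w => B s w * B t w)).
Proof.
move=> s0 t0; have mBt := fbm_measurable t0; have mBs := fbm_measurable s0.
apply: (@integrable_le _ _ _ _ _ _ (fun w => B s w ^+ 2 + B t w ^+ 2)) => //.
- exact: measurable_funM.
- move=> w _; move: (B s w) (B t w) => x y.
  have := sqr_ge0 (x - y); have := sqr_ge0 (x + y).
  by rewrite ler_norml => h1 h2; apply/andP; split; nra.
- exact: (eq_integrable measurableT _ _ _ (integrableD measurableT
    (fbm_square_integrable s0) (fbm_square_integrable t0))).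
Qed.

Lemma fbm_cov s t : 0 <= s -> 0 <= t -> \int[P]_w (B s w * B t w) = fcov H s t.
Proof.
by move=> s0 t0; have [_ _ /(_ s t s0 t0)] := fbm_B; rewrite unlock /Rintegral => ->.
Qed.

Lemma fbm_integrable t : 0 <= t -> P.-integrable setT (EFin \o B t).
Proof.
move=> t0; have mBt := fbm_measurable t0.
apply: (@integrable_le _ _ _ _ _ _ (fun w => 1 + B t w ^+ 2)) => //.
  move=> w _; move: (B t w) => y; rewrite -(real_normK (num_real y)) -subr_ge0.
  have := sqr_ge0 (`|y| - 1); have := normr_ge0 y; move: `|y| => z z0 z1; nra.
have i1 : P.-integrable setT (EFin \o cst (1 : R)).
  exact: finite_measure_integrable_cst.
by apply: (eq_integrable measurableT _ _ _ (integrableD measurableT i1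
  (fbm_square_integrable t0))).
Qed.

Lemma fbm_mean t : 0 <= t -> \int[P]_w B t w = 0.
Proof. by move=> t0; have [_ /(_ t t0) + _] := fbm_B; rewrite unlock /Rintegral => ->. Qed.

Implicit Types l : seq (R * R).
Let nneg l := forall p : R * R, p \in l -> 0 <= p.2.

Lemma lincomb_measurable l : nneg l -> measurable_fun setT (lincomb l).
Proof.
elim: l => [|p l IH] l0.
  by rewrite (_ : lincomb _ = cst 0)//; apply/funext => w; rewrite /lincomb big_nil.
rewrite (_ : lincomb _ = fun w => p.1 * B p.2 w + lincomb l w); last first.
  by apply/funext => w; rewrite /lincomb big_cons.
apply: measurable_funD; last by apply: IH => q ql; apply: l0; rewrite inE ql orbT.
by apply: measurable_funM => //; apply: fbm_measurable; apply: l0; rewrite mem_head.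
Qed.

Lemma lincomb_mean l : nneg l -> \int[P]_w lincomb l w = 0.
Proof.
move=> l0; have [|_ ->] := @Rintegral_sum_seq _ _ _ P _ l (fun p w => p.1 * B p.2 w).
  move=> p /l0 p0; under [X in _ _ X]eq_fun do rewrite /= EFinM.
  by apply: integrableZl => //; exact: fbm_integrable.
rewrite big_seq big1// => p /l0 p0.
by rewrite RintegralZl// ?fbm_mean ?mulr0//; exact: fbm_integrable.
Qed.

Lemma lincomb_mul l l' : nneg l -> nneg l' ->
  P.-integrable setT (EFin \o (fun w => lincomb l w * lincomb l' w)) /\
  \int[P]_w (lincomb l w * lincomb l' w) = bform H l l'.
Proof.
move=> l0 l'0.
pose F p (q : R * R) w := p.1 * q.1 * (B p.2 w * B q.2 w).
have iF p q : p \in l -> q \in l' -> P.-integrable setT (EFin \o F p q) /\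
    \int[P]_w F p q w = p.1 * q.1 * fcov H p.2 q.2.
  move=> /l0 p0 /l'0 q0; split.
    rewrite /F; under [X in _ _ X]eq_fun do rewrite /= EFinM.
    by apply: integrableZl => //; exact: fbm_mul_integrable.
  by rewrite RintegralZl ?fbm_cov//; exact: fbm_mul_integrable.
have iG p : p \in l -> P.-integrable setT (EFin \o (fun w => \sum_(q <- l') F p q w)) /\
    \int[P]_w (\sum_(q <- l') F p q w) = \sum_(q <- l') p.1 * q.1 * fcov H p.2 q.2.
  move=> pl; have [|i ->] := @Rintegral_sum_seq _ _ _ P _ l' (F p).
    by move=> q ql; have [] := iF p q pl ql.
  by split => //; rewrite big_seq [RHS]big_seq; apply: eq_bigr => q ql; case: (iF p q pl ql).
have [|i e] := @Rintegral_sum_seq _ _ _ P _ l (fun p w => \sum_(q <- l') F p q w).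
  by move=> p /iG [].
have E w : lincomb l w * lincomb l' w = \sum_(p <- l) \sum_(q <- l') F p q w.
  rewrite /lincomb mulr_suml; apply: eq_bigr => p _; rewrite mulr_sumr.
  by apply: eq_bigr => q _; rewrite /F mulrACA.
split; first by apply: (eq_integrable measurableT _ _ _ i) => w _ /=; rewrite E.
under eq_Rintegral do rewrite E.
by rewrite e /bform big_seq [RHS]big_seq; apply: eq_bigr => p /iG [].
Qed.

(** Positivity of the covariance kernel is not obtained by analysis: the quadratic form is the
    second moment of a combination of values of the given process. This discharges the hypothesis
    [qform_ge0] made in the study of the variance. *)
Lemma fbm_qform_ge0 l : nneg l -> 0 <= qform H l.
Proof.
move=> l0; rewrite /qform; have [_ <-] := lincomb_mul l0 l0.
by apply: Rintegral_ge0 => w _; rewrite -expr2 sqr_ge0.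
Qed.

Lemma fbm_cos a l : nneg l ->
  \int[P]_w cos (a + lincomb l w) = cos a * expR (- (qform H l / 2)).
Proof.
move=> l0; apply: gaussian_rv_cos; last 3 first.
- by have [i _] := lincomb_mul l0 l0; apply: (eq_integrable measurableT _ _ _ i).
- exact: lincomb_mean.
- by rewrite /qform; have [_ <-] := lincomb_mul l0 l0; apply: eq_Rintegral => w _; rewrite expr2.
have [[_ gB] _ _] := fbm_B.
have := gB (size l) (fun i => (nth (0, 0) l i).2) (fun i => (nth (0, 0) l i).1).
rewrite (_ : (fun w => _) = lincomb l).
  by apply => i; apply: Dt; apply: l0; exact: mem_nth.
by apply/funext => w; rewrite /lincomb (big_nth (0, 0)) big_mkord.
Qed.

End fbm_moments.

(** * Moments of oscillating sums *)

Section moment_recursion.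
Context d (T : measurableType d) (R : realType) (P : probability T R).

Lemma exprD_le (n : nat) (x y : R) : 0 <= x -> 0 <= y ->
  (x + y) ^+ n <= 2 ^+ n * (x ^+ n + y ^+ n).
Proof.
wlog xy : x y / x <= y.
  move=> W x0 y0; have [/W|/ltW /W] := leP x y; first exact.
  by move=> h; rewrite addrC [x ^+ n + _]addrC; exact: h.
move=> x0 y0; rewrite (@le_trans _ _ ((2 * y) ^+ n))//.
  by rewrite lerXn2r ?nnegrE ?addr_ge0 ?mulr_ge0// mulr2n mulrDl mul1r lerD2r.
by rewrite exprMn ler_wpM2l ?exprn_ge0// lerDr exprn_ge0.
Qed.

(** Factor out [a - b]; the other factor has [2 q + 1] terms, each at most [(|a| + r)^(2q)]. The
    bound involves [a] alone and through an even power, so that its mean is the preceding even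
    moment. *)
Lemma subX_le (q : nat) (a b r : R) : `|a - b| <= r ->
  `|a ^+ (2 * q).+1 - b ^+ (2 * q).+1| <=
  ((2 * q).+1%:R * 2 ^+ (2 * q)) * r * (a ^+ (2 * q) + r ^+ (2 * q)).
Proof.
move=> abr; have r0 : 0 <= r by rewrite (le_trans _ abr).
have br : `|b| <= `|a| + r.
  by have := lerB_dist b a; rewrite distrC; lra.
rewrite subrXX normrM.
rewrite [leRHS](_ : _ = r * ((2 * q).+1%:R * (2 ^+ (2 * q) *
  (a ^+ (2 * q) + r ^+ (2 * q))))); last by ring.
rewrite ler_pM//.
rewrite (le_trans (ler_norm_sum _ _ _))//.
rewrite (@le_trans _ _ (\sum_(i < (2 * q).+1) (`|a| + r) ^+ (2 * q)))//.
  apply: ler_sum => i _; rewrite normrM !normrX.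
  have -> : (`|a| + r) ^+ (2 * q) = (`|a| + r) ^+ (2 * q - i) * (`|a| + r) ^+ i.
    by rewrite -exprD subnK// -ltnS.
  by rewrite ler_pM ?exprn_ge0// lerXn2r ?nnegrE ?addr_ge0// lerDl.
rewrite sumr_const card_ord -[leLHS]mulr_natl ler_wpM2l//.
rewrite (le_trans (exprD_le _ _ _))// ler_wpM2l ?exprn_ge0//.
by rewrite lerD2r -normrX ger0_norm// exprn_even_ge0// oddM.
Qed.

Context (K : nat) (x : 'I_K -> T -> R) (nr : rel 'I_K) (r eta : R) (M : nat).
Hypothesis mx : forall k, measurable_fun setT (x k).
Hypothesis x1 : forall k w, `|x k w| <= 1.
Hypothesis nr_le : forall k, #|[pred j | nr k j]|%:R <= r.
Hypothesis r_ge0 : 0 <= r.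
Hypothesis r_leK : r <= K%:R.
Hypothesis eta_ge0 : 0 <= eta.
Hypothesis far_le : forall k (s : seq 'I_K), (size s <= M)%N ->
  all (fun j => ~~ nr k j) s ->
  `|\int[P]_w (x k w * \prod_(j <- s) x j w)| <= eta.

Let S w := \sum_k x k w.
Let Sfar k w := \sum_(j | ~~ nr k j) x j w.

Let mS : measurable_fun setT S.
Proof. exact: measurable_sum. Qed.

Let mSfar k : measurable_fun setT (Sfar k).
Proof.
rewrite (_ : Sfar k = fun w => \sum_(j <- [seq j <- enum 'I_K | ~~ nr k j]) x j w).
  exact: measurable_sum.
by apply/funext => w; rewrite big_filter big_enum_cond.
Qed.

Let S_le w : `|S w| <= K%:R.
Proof.
rewrite (le_trans (ler_norm_sum _ _ _))// (@le_trans _ _ (\sum_(k < K) 1))//.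
  exact: ler_sum.
by rewrite sumr_const card_ord.
Qed.

Let Sfar_le k w : `|Sfar k w| <= K%:R.
Proof.
rewrite (le_trans (ler_norm_sum _ _ _))// (@le_trans _ _ (\sum_(j < K | ~~ nr k j) 1))//.
  exact: ler_sum.
by rewrite sumr_const ler_nat -[leqRHS](card_ord K) max_card.
Qed.

Let S_near k w : `|S w - Sfar k w| <= r.
Proof.
rewrite /S (bigID (nr k))/= addrK (le_trans (ler_norm_sum _ _ _))//.
rewrite (@le_trans _ _ (\sum_(j < K | nr k j) 1))//; first exact: ler_sum.
by rewrite sumr_const (le_trans _ (nr_le k)).
Qed.

Let mprod (s : seq 'I_K) : measurable_fun setT (fun w => \prod_(j <- s) x j w).
Proof. exact: measurable_prod. Qed.

Let prod_le (s : seq 'I_K) w : `|\prod_(j <- s) x j w| <= 1.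
Proof.
elim: s => [|j s IH]; first by rewrite big_nil normr1.
by rewrite big_cons normrM mulr_ile1.
Qed.

(** The factors [Sfar k] are expanded one at a time and their terms added to [s]. These terms are
    far from [k], possibly close or equal to one another, and this is all that [far_le] asks; there
    are at most [K^n] products. *)
Lemma far_moment_le n k (s : seq 'I_K) : (size s + n <= M)%N ->
  all (fun j => ~~ nr k j) s ->
  `|\int[P]_w (x k w * \prod_(j <- s) x j w * Sfar k w ^+ n)| <= K%:R ^+ n * eta.
Proof.
elim: n s => [|n IH] s sM fs.
  by under eq_Rintegral do rewrite expr0 mulr1; rewrite mul1r far_le// -(addn0 (size s)).
pose E := [seq j <- enum 'I_K | ~~ nr k j].
pose F j w := x k w * \prod_(i <- j :: s) x i w * Sfar k w ^+ n.
have [|iF eF] := @Rintegral_sum_seq _ _ _ P _ E F.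
  move=> j _; apply: (@integrable_bounded _ _ _ P _ (K%:R ^+ n)).
    apply: measurable_funM; last exact: measurable_funX.
    by apply: measurable_funM.
  move=> w; rewrite /F !normrM -[leRHS]mul1r ler_pM//.
    by rewrite mulr_ile1.
  by rewrite normrX lerXn2r ?nnegrE.
rewrite (_ : \int[P]_w _ = \int[P]_w \sum_(j <- E) F j w); last first.
  apply: eq_Rintegral => w _; rewrite exprS.
  have SfE : Sfar k w = \sum_(j <- E) x j w by rewrite /E big_filter big_enum_cond.
  rewrite mulrA {1}SfE mulr_sumr mulr_suml; apply: eq_bigr => j _.
  by rewrite /F big_cons; ring.
rewrite eF (le_trans (ler_norm_sum _ _ _))//.
rewrite (@le_trans _ _ (\sum_(j <- E) K%:R ^+ n * eta))//.
  rewrite big_seq [leRHS]big_seq; apply: ler_sum => j.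
  rewrite mem_filter => /andP[fj _]; apply: IH; last by rewrite /= fj.
  by rewrite /= addSnnS.
rewrite big_const_seq count_predT iter_addr addr0 -[leLHS]mulr_natl exprS -mulrA.
rewrite ler_wpM2r ?mulr_ge0 ?exprn_ge0// ler_nat.
by rewrite size_filter (leq_trans (count_size _ _))// size_enum_ord.
Qed.

Fixpoint momentC (q : nat) : R :=
  if q is p.+1 then (2 * p).+1%:R * 2 ^+ (2 * p) * (momentC p + 1) + 1 else 1.

Lemma momentC_ge0 q : 0 <= momentC q.
Proof. by elim: q => //= q IH; rewrite addr_ge0// !mulr_ge0 ?exprn_ge0 ?addr_ge0. Qed.

(* In [S^(2q+2) = sum_k x_k S^(2q+1)], replace [S] by its part far from [k]:
   the error is controlled by the moment of order [2q]. *)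
Lemma moment_le q : (2 * q <= M.+1)%N ->
  \int[P]_w (S w ^+ (2 * q)) <= momentC q * ((K%:R * r) ^+ q + K%:R ^+ (2 * q) * eta).
Proof.
have r0 := r_ge0.
elim: q => [|q IH] qM.
  rewrite muln0 !expr0 mul1r.
  under eq_Rintegral do rewrite expr0.
  by rewrite Rintegral_cst//= probability_setT !mul1r lerDl.
have {}IH := IH (leq_trans (leq_mul (leqnn 2) (leqnSn q)) qM).
have q1M : ((2 * q).+1 <= M)%N by rewrite -ltnS (leq_trans _ qM)// mulnS.
pose c : R := (2 * q).+1%:R * 2 ^+ (2 * q).
have c0 : 0 <= c by rewrite mulr_ge0 ?exprn_ge0.
have KX n (f : T -> R) w : `|f w| <= K%:R -> `|f w ^+ n| <= K%:R ^+ n.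
  by move=> fK; rewrite normrX lerXn2r ?nnegrE.
have iS n : P.-integrable setT (EFin \o (fun w => S w ^+ n)).
  apply: (@integrable_bounded _ _ _ P _ (K%:R ^+ n)); first exact: measurable_funX.
  by move=> w; exact: KX.
have S2 w : S w ^+ (2 * q.+1) = \sum_k x k w * S w ^+ (2 * q).+1.
  by rewrite -mulr_suml -exprS mulnS.
have ixS k : P.-integrable setT (EFin \o (fun w => x k w * S w ^+ (2 * q).+1)).
  apply: (@integrable_bounded _ _ _ P _ (K%:R ^+ (2 * q).+1)).
    by apply: measurable_funM => //; exact: measurable_funX.
  by move=> w; rewrite normrM -[leRHS]mul1r ler_pM//; exact: KX.
have ixSf k : P.-integrable setT (EFin \o (fun w => x k w * Sfar k w ^+ (2 * q).+1)).
  apply: (@integrable_bounded _ _ _ P _ (K%:R ^+ (2 * q).+1)).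
    by apply: measurable_funM => //; exact: measurable_funX.
  by move=> w; rewrite normrM -[leRHS]mul1r ler_pM//; exact: KX.
have irest : P.-integrable setT
    (EFin \o (fun w => c * r * (S w ^+ (2 * q) + r ^+ (2 * q)))).
  have i1 := integrableD measurableT (iS (2 * q)%N)
    (finite_measure_integrable_cst P (r ^+ (2 * q)) measurableT).
  exact: (eq_integrable measurableT _ _ _ (integrableZl measurableT (c * r) i1)).
have -> : \int[P]_w (S w ^+ (2 * q.+1)) = \sum_(k < K) \int[P]_w (x k w * S w ^+ (2 * q).+1).
  have [|_ e] := @Rintegral_sum_seq _ _ _ P _ (index_enum 'I_K)
    (fun k w => x k w * S w ^+ (2 * q).+1); first by move=> k _; exact: ixS.
  by rewrite -e; apply: eq_Rintegral => w _; rewrite S2.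
set I := \int[P]_w (S w ^+ (2 * q)) in IH *.
have I0 : 0 <= I by apply: Rintegral_ge0 => w _; rewrite exprn_even_ge0// oddM.
pose X := c * r * (I + r ^+ (2 * q)) + K%:R ^+ (2 * q).+1 * eta.
apply: (@le_trans _ _ (\sum_(k < K) X)).
  apply: ler_sum => k _.
  apply: (@le_trans _ _ (\int[P]_w (x k w * Sfar k w ^+ (2 * q).+1 +
      c * r * (S w ^+ (2 * q) + r ^+ (2 * q))))).
    apply: le_Rintegral => //.
      exact: (eq_integrable measurableT _ _ _ (integrableD measurableT (ixSf k) irest)).
    move=> w _; rewrite -lerBlDl -mulrBr (le_trans (ler_norm _))// normrM.
    apply: (le_trans _ (@subX_le q _ _ _ (S_near k w))).
    by rewrite ler_piMl.
  rewrite RintegralD// addrC lerD//.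
    rewrite RintegralZl//; last first.
      exact: (eq_integrable measurableT _ _ _ (integrableD measurableT (iS (2 * q)%N)
        (finite_measure_integrable_cst P (r ^+ (2 * q)) measurableT))).
    rewrite RintegralD//; last exact: finite_measure_integrable_cst.
    by rewrite Rintegral_cst//= probability_setT mulr1.
  rewrite (le_trans (ler_norm _))//.
  have := @far_moment_le (2 * q).+1 k [::] q1M isT.
  by under eq_Rintegral do rewrite big_nil mulr1.
rewrite sumr_const card_ord -[leLHS]mulr_natl /X /=.
have rk := r_leK; set k := K%:R in rk IH *; have k0 : 0 <= k by rewrite ler0n.
(* Here [r] is a number of near indices, at most [K], and not a distance. *)
have r2k : r ^+ (2 * q) <= (k * r) ^+ q.
  by rewrite mulnC exprM exprAC expr2 lerXn2r ?nnegrE ?mulr_ge0// ler_wpM2r.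
have kr2 : k * r <= k ^+ 2 by rewrite expr2 ler_wpM2l.
have kr0 : 0 <= k * r by rewrite mulr_ge0.
have Cq := momentC_ge0 q.
have kq0 : 0 <= k ^+ (2 * q) * eta by rewrite mulr_ge0 ?exprn_ge0.
have krq0 : 0 <= (k * r) ^+ q by rewrite exprn_ge0.
have e : k * k ^+ (2 * q).+1 = k ^+ (2 * q.+1) by rewrite -exprS mulnS.
rewrite [leLHS](_ : _ = c * (k * r * (I + r ^+ (2 * q))) + k ^+ (2 * q.+1) * eta); last first.
  by rewrite -e; ring.
rewrite -/c mulrDl mul1r -[c * (_ + 1) * _]mulrA.
apply: lerD; last by rewrite lerDr exprn_ge0.
rewrite ler_wpM2l//.
apply: (@le_trans _ _ ((k * r) * ((momentC q + 1) * ((k * r) ^+ q + k ^+ (2 * q) * eta)))).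
  by rewrite ler_wpM2l// mulrDl mul1r lerD// (le_trans r2k)// lerDl.
rewrite mulrCA ler_wpM2l ?addr_ge0// mulrDr -exprS lerD2l mulrA ler_wpM2r//.
by rewrite mulnS exprD ler_wpM2r// exprn_ge0.
Qed.

End moment_recursion.

(** * Means of products of oscillating terms *)

Section oscillating_moments.
Context d (T : measurableType d) (R : realType) (P : probability T R).
Context (H : R) (B : R -> T -> R).
Hypothesis fbm_B : fractional_brownian_motion P H B.
Context (N : nat) (th h eta : R) (M : nat).
Hypothesis h_ge0 : 0 <= h.

Let v (i : nat) : R := (2 ^+ N)^-1 * dw R N i.

Let sum_v : \sum_(i < N.+1) `|v i| <= 1.
Proof.
rewrite /v; under eq_bigr do rewrite normrM.
rewrite -mulr_sumr ger0_norm ?invr_ge0 ?exprn_ge0//.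
by rewrite mulrC ler_pdivrMr ?exprn_gt0// mul1r sum_norm_dw.
Qed.

(** The deterministic part of the phase is frozen at [a]: moving by [i] half-periods would only
    multiply the term by [(-1)^i], and it is this sign that turns an average of shifted terms into a
    difference. *)
Definition osc (a t : R) (w : T) : R :=
  \sum_(i < N.+1) v i * cos (a + th * B (t + i%:R * h) w).

Lemma osc_le1 a t w : `|osc a t w| <= 1.
Proof.
rewrite (le_trans (ler_norm_sum _ _ _))// (le_trans _ sum_v)//.
by apply: ler_sum => i _; rewrite normrM ler_piMr// ler_norml cos_geN1 cos_le1.
Qed.

Let measurable_cos (f : T -> R) : measurable_fun setT f ->
  measurable_fun setT (fun w => cos (f w)).
Proof.
move=> mf; apply: measurableT_comp mf.
exact: continuous_measurable_fun (@continuous_cos R).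
Qed.

Let mB a t : 0 <= t -> measurable_fun setT (fun w => cos (a + th * B t w)).
Proof.
move=> t0; apply: measurable_cos; apply: measurable_funD => //.
by apply: measurable_funM => //; exact: fbm_measurable fbm_B _ t0.
Qed.

Let tih0 t (i : nat) : 0 <= t -> 0 <= t + i%:R * h.
Proof. by move=> t0; rewrite addr_ge0// mulr_ge0. Qed.

Lemma measurable_osc a t : 0 <= t -> measurable_fun setT (osc a t).
Proof.
move=> t0; apply: measurable_sum => i; apply: measurable_funM => //.
exact: mB (tih0 _ t0).
Qed.

(** Generalises [osc] by adding a combination [l] of other values to the phase. Multiplying by a
    cosine stays within this family and lengthens [l] by one, which is what the induction on the far
    factors uses. *)
Let chr a t (l : seq (R * R)) w :=
  \sum_(i < N.+1) v i * cos (a + lincomb B (scale th ((1, t + i%:R * h) :: l)) w).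

Let lin_scale l w : lincomb B (scale th l) w = th * lincomb B l w.
Proof.
by rewrite /lincomb /scale big_map mulr_sumr; apply: eq_bigr => p _; rewrite mulrA.
Qed.

Let chr_nil a t w : chr a t [::] w = osc a t w.
Proof.
by apply: eq_bigr => i _; rewrite lin_scale /lincomb big_seq1 mul1r.
Qed.

Let scale_nneg l : (forall p, p \in l -> 0 <= p.2) ->
  forall p, p \in scale th l -> 0 <= p.2.
Proof. by move=> l0 p /mapP[q /l0 q0 ->]. Qed.

Variable r t : R.
Hypothesis t_ge0 : 0 <= t.
Hypothesis decay : forall l, far M r t l ->
  `|iter N (@dif R) (fun i => expR (- (th ^+ 2 * fvar H l (t + i%:R * h) / 2))) 0%N|
    <= eta.

Let cons_nneg l i : far M r t l -> forall p, p \in (1, t + i%:R * h) :: l -> 0 <= p.2.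
Proof.
move=> [_ lP] p; rewrite inE => /predU1P[->|/lP[]//].
exact: tih0.
Qed.

Let mchr a l : far M r t l -> measurable_fun setT (chr a t l).
Proof.
move=> fl; apply: measurable_sum => i; apply: measurable_funM => //.
apply: measurable_cos; apply: measurable_funD => //.
by apply: (lincomb_measurable fbm_B); apply: scale_nneg; exact: cons_nneg.
Qed.

Let chr_le1 a l w : `|chr a t l w| <= 1.
Proof.
rewrite (le_trans (ler_norm_sum _ _ _))// (le_trans _ sum_v)//.
by apply: ler_sum => i _; rewrite normrM ler_piMr// ler_norml cos_geN1 cos_le1.
Qed.

(** In the mean, each cosine becomes [cos a] times the characteristic function
    [expR (- th^2 V / 2)]; the weights then form exactly the iterated difference bounded by
    [decay]. *)
Let chr_mean a l : far M r t l -> `|\int[P]_w chr a t l w| <= eta.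
Proof.
move=> fl; have [|_ ->] := @Rintegral_sum_seq _ _ _ P _ (index_enum 'I_N.+1)
  (fun i w => v i * cos (a + lincomb B (scale th ((1, t + i%:R * h) :: l)) w)).
  move=> i _; apply: (@integrable_bounded _ _ _ P _ `|v i|).
    apply: measurable_funM => //; apply: measurable_cos; apply: measurable_funD => //.
    by apply: (lincomb_measurable fbm_B); apply: scale_nneg; exact: cons_nneg.
  by move=> w; rewrite normrM ler_piMr// ler_norml cos_geN1 cos_le1.
rewrite (eq_bigr (fun i : 'I_N.+1 => (cos a / 2 ^+ N) *
    (dw R N i * expR (- (th ^+ 2 * fvar H l (t + i%:R * h) / 2))))).
  rewrite -mulr_sumr -(@sum_dw R R^o N (fun i => expR (- (th ^+ 2 * fvar H l (t + i%:R * h) / 2)))).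
  rewrite normrM; apply: le_trans (decay fl); rewrite ler_piMl//.
  rewrite normrM mulr_ile1//; first by rewrite ler_norml cos_geN1 cos_le1.
  by rewrite ger0_norm ?invr_ge0 ?exprn_ge0// invf_le1 ?exprn_gt0// exprn_ege1// ler1n.
move=> i _; rewrite RintegralZl//; last first.
  apply: (@integrable_bounded _ _ _ P _ 1).
    apply: measurable_cos; apply: measurable_funD => //.
    by apply: (lincomb_measurable fbm_B); apply: scale_nneg; exact: cons_nneg.
  by move=> w; rewrite ler_norml cos_geN1 cos_le1.
rewrite (fbm_cos fbm_B); last by apply: scale_nneg; exact: cons_nneg.
have -> : qform H (scale th ((1, t + i%:R * h) :: l)) =
    th ^+ 2 * fvar H l (t + i%:R * h).
  by rewrite /fvar /qform bform_scalel bform_scaler mulrA -expr2.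
by rewrite /v; ring.
Qed.

Let chr_mul a l b u w : chr a t l w * cos (b + th * B u w) =
  2^-1 * (chr (a + b) t ((1, u) :: l) w + chr (a - b) t ((-1, u) :: l) w).
Proof.
rewrite /chr mulr_suml -big_split mulr_sumr/=; apply: eq_bigr => i _.
rewrite /lincomb !big_cons -!/(lincomb B (scale th l) w)/=.
set x := (X in cos (a + X)); set y := th * B u w.
rewrite (_ : a + b + _ = (a + x) + (b + y)); last by rewrite /x /y; ring.
rewrite (_ : a - b + _ = (a + x) - (b + y)); last by rewrite /x /y; ring.
by rewrite (cosD (a + x)) (cosB (a + x)); field.
Qed.

Let chr_mul_mean a l (rs : seq (R * R)) : far M r t l ->
  (size l + size rs <= M)%N -> (forall p, p \in rs -> 0 <= p.2 /\ r <= `|t - p.2|) ->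
  `|\int[P]_w (chr a t l w * \prod_(p <- rs) cos (p.1 + th * B p.2 w))| <= eta.
Proof.
elim: rs a l => [|p rs IH] a l fl szM rsP.
  by under eq_Rintegral do rewrite big_nil mulr1; exact: chr_mean.
have [p0 pr] := rsP p (mem_head _ _).
have {}rsP q : q \in rs -> 0 <= q.2 /\ r <= `|t - q.2|.
  by move=> qrs; apply: rsP; rewrite inE qrs orbT.
have fl' c : `|c| = 1 -> far M r t ((c, p.2) :: l).
  case: fl => _ lP c1; split; first by rewrite (leq_trans _ szM)//= addnS ltnS leq_addr.
  by move=> q; rewrite inE => /predU1P[->|/lP//]; split; rewrite ?c1.
have f1 := fl' 1 (normr1 _); have fN1 : far M r t ((-1, p.2) :: l) by apply: fl'; rewrite normrN1.
have szM' c : (size ((c, p.2) :: l) + size rs <= M)%N by rewrite /= addSnnS.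
have mrs : measurable_fun setT (fun w => \prod_(p <- rs) cos (p.1 + th * B p.2 w)).
  by apply: measurable_prod => q /rsP[q0 _]; exact: mB.
have prs w : `|\prod_(p <- rs) cos (p.1 + th * B p.2 w)| <= 1.
  elim: (rs) => [|q s IHs]; first by rewrite big_nil normr1.
  by rewrite big_cons normrM mulr_ile1// ler_norml cos_geN1 cos_le1.
have ichr b l' : far M r t l' -> P.-integrable setT (EFin \o (fun w => chr b t l' w *
    \prod_(p <- rs) cos (p.1 + th * B p.2 w))).
  move=> fl2; apply: (@integrable_bounded _ _ _ P _ 1).
    by apply: measurable_funM => //; exact: mchr.
  by move=> w; rewrite normrM mulr_ile1.
have -> : \int[P]_w (chr a t l w * \prod_(p <- p :: rs) cos (p.1 + th * B p.2 w)) =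
    2^-1 * (\int[P]_w (chr (a + p.1) t ((1, p.2) :: l) w *
       \prod_(p <- rs) cos (p.1 + th * B p.2 w)) +
     \int[P]_w (chr (a - p.1) t ((-1, p.2) :: l) w *
       \prod_(p <- rs) cos (p.1 + th * B p.2 w))).
  rewrite -RintegralD ?ichr// -RintegralZl//; last first.
    exact: (eq_integrable measurableT _ _ _ (integrableD measurableT (ichr _ _ f1) (ichr _ _ fN1))).
  by apply: eq_Rintegral => w _; rewrite big_cons mulrA chr_mul -mulrDl mulrA.
have := IH (a + p.1) _ f1 (szM' 1) rsP; have := IH (a - p.1) _ fN1 (szM' (-1)) rsP.
rewrite !ler_norml => /andP[h1 h2] /andP[h3 h4]; apply/andP; split; lra.
Qed.

(** Each far [osc] is expanded into cosines, with weights of total mass at most 1. Its times extend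
    up to [N * h] beyond [p.2], whence the larger distance required of [s]. *)
Lemma osc_mul_mean a (rs s : seq (R * R)) : (size s + size rs <= M)%N ->
  (forall p, p \in rs -> 0 <= p.2 /\ r <= `|t - p.2|) ->
  (forall p, p \in s -> 0 <= p.2 /\ r + N%:R * h <= `|t - p.2|) ->
  `|\int[P]_w (osc a t w * \prod_(p <- rs) cos (p.1 + th * B p.2 w) *
      \prod_(p <- s) osc p.1 p.2 w)| <= eta.
Proof.
elim: s rs => [|p s IH] rs szM rsP sP.
  under eq_Rintegral do rewrite big_nil mulr1 -chr_nil.
  by apply: chr_mul_mean => //; split=> //; exact: (leq_trans _ szM).
have [p0 pr] := sP p (mem_head _ _).
have {}sP q : q \in s -> 0 <= q.2 /\ r + N%:R * h <= `|t - q.2|.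
  by move=> qs; apply: sP; rewrite inE qs orbT.
pose F (i : 'I_N.+1) w := v i * (osc a t w *
  \prod_(p <- (p.1, p.2 + i%:R * h) :: rs) cos (p.1 + th * B p.2 w) *
  \prod_(p <- s) osc p.1 p.2 w).
have rs'P (i : 'I_N.+1) q : q \in (p.1, p.2 + i%:R * h) :: rs ->
    0 <= q.2 /\ r <= `|t - q.2|.
  rewrite inE => /predU1P[->/=|/rsP//]; split; first exact: tih0.
  have ihN : i%:R * h <= N%:R * h by rewrite ler_wpM2r// ler_nat -ltnS.
  have := lerB_dist (t - p.2) (i%:R * h).
  rewrite (@ger0_norm _ (i%:R * h)) ?mulr_ge0// opprD addrA => h1.
  by rewrite (le_trans _ h1)// lerBrDr (le_trans _ pr)// lerD2l.
have mF (i : 'I_N.+1) : measurable_fun setT (F i).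
  apply: measurable_funM => //; apply: measurable_funM; last first.
    by apply: measurable_prod => q /sP[q0 _]; exact: measurable_osc.
  apply: measurable_funM; first exact: measurable_osc.
  by apply: measurable_prod => q /rs'P[q0 _]; exact: mB.
have prs rs' w : `|\prod_(p <- rs') cos (p.1 + th * B p.2 w)| <= 1.
  elim: (rs') => [|q s' IHs]; first by rewrite big_nil normr1.
  by rewrite big_cons normrM mulr_ile1// ler_norml cos_geN1 cos_le1.
have ps w : `|\prod_(p <- s) osc p.1 p.2 w| <= 1.
  elim: (s) => [|q s' IHs]; first by rewrite big_nil normr1.
  by rewrite big_cons normrM mulr_ile1// osc_le1.
have G1 (i : 'I_N.+1) w : `|osc a t w *
  (\prod_(p <- (p.1, p.2 + i%:R * h) :: rs) cos (p.1 + th * B p.2 w)) *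
  \prod_(p <- s) osc p.1 p.2 w| <= 1.
  by rewrite !normrM !mulr_ile1 ?mulr_ge0 ?osc_le1.
have [|_ e] := @Rintegral_sum_seq _ _ _ P _ (index_enum 'I_N.+1) F.
  move=> i _; apply: (@integrable_bounded _ _ _ P _ `|v i|) => // w.
  by rewrite normrM ler_piMr.
rewrite (_ : \int[P]_w _ = \int[P]_w (\sum_i F i w)); last first.
  apply: eq_Rintegral => w _; rewrite big_cons.
  have -> : osc p.1 p.2 w = \sum_(i < N.+1) v i * cos (p.1 + th * B (p.2 + i%:R * h) w) by [].
  rewrite mulrCA mulrA mulr_suml mulr_suml.
  by apply: eq_bigr => i _; rewrite /F big_cons /=; ring.
rewrite e (le_trans (ler_norm_sum _ _ _))//.
rewrite (@le_trans _ _ (\sum_(i < N.+1) `|v i| * eta))//; last first.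
  rewrite -mulr_suml ler_piMl//.
  rewrite (le_trans (normr_ge0 _) (@chr_mean 0 [::] _))//.
apply: ler_sum => i _; rewrite /F RintegralZl//; last first.
  apply: (@integrable_bounded _ _ _ P _ 1) => //.
  apply: measurable_funM; last first.
    by apply: measurable_prod => q /sP[q0 _]; exact: measurable_osc.
  apply: measurable_funM; first exact: measurable_osc.
  by apply: measurable_prod => q /rs'P[q0 _]; exact: mB.
by rewrite normrM ler_wpM2l// IH//; [rewrite /= addnS -addSn|exact: rs'P].
Qed.

End oscillating_moments.

Section oscillating_moment_bound.
Context d (T : measurableType d) (R : realType) (P : probability T R).
Context (H : R) (B : R -> T -> R).
Hypothesis fbm_B : fractional_brownian_motion P H B.

Lemma osc_moment_le (N M K q : nat) (th h eta r rho : R) (ph tt : 'I_K -> R) :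
  0 <= h -> (forall k, 0 <= tt k) ->
  (forall k l, far M r (tt k) l ->
    `|iter N (@dif R) (fun i => expR (- (th ^+ 2 * fvar H l (tt k + i%:R * h) / 2))) 0%N|
    <= eta) ->
  (forall k, #|[pred j | `|tt k - tt j| < r + N%:R * h]|%:R <= rho) ->
  0 <= rho <= K%:R -> 0 <= eta -> (2 * q <= M.+1)%N ->
  \int[P]_w ((\sum_(k < K) osc B N th h (ph k) (tt k) w) ^+ (2 * q)) <=
  momentC R q * ((K%:R * rho) ^+ q + K%:R ^+ (2 * q) * eta).
Proof.
move=> h0 tt0 decay near /andP[rho0 rhoK] eta0 qM.
apply: (@moment_le _ _ _ P K (fun k => osc B N th h (ph k) (tt k))
  (fun k j => `|tt k - tt j| < r + N%:R * h) rho eta M) => //.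
- by move=> k; exact: measurable_osc fbm_B _ _ _ h0 _ _ (tt0 k).
- by move=> k w; exact: osc_le1.
- move=> k s sM fs.
  have := @osc_mul_mean _ _ _ P H B fbm_B N th h eta M h0 r (tt k) (tt0 k) (decay k)
    (ph k) [::] [seq (ph j, tt j) | j <- s].
  rewrite size_map addn0 => /(_ sM).
  under eq_Rintegral do rewrite big_nil mulr1 big_map.
  apply => // p /mapP[j js -> /=]; split => //.
  by move/allP : fs => /(_ j js); rewrite -leNgt.
Qed.

Lemma cos_shift_pi (a : R) (i : nat) (e : R) : `|e| = 1 ->
  cos (a + i%:R * (e * pi)) = (-1) ^+ i * cos a.
Proof.
move=> e1; elim: i a => [|i IH] a; first by rewrite mul0r addr0 mul1r.
have -> : a + i.+1%:R * (e * pi) = a + e * pi + i%:R * (e * pi).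
  by rewrite -natr1; ring.
rewrite IH exprS mulN1r mulNr -mulrN; congr (_ * _).
have [e0|e0] := leP 0 e.
  by move: e1; rewrite ger0_norm// => ->; rewrite mul1r cosDpi.
move: e1; rewrite ltr0_norm// => /eqP; rewrite eqr_oppLR => /eqP ->.
by rewrite mulN1r -[in RHS](subrK pi a) cosDpi opprK.
Qed.

Lemma sum_shift_le (f : nat -> R) (K m : nat) : (forall k, `|f k| <= 1) ->
  `|\sum_(k < K) f (k + m)%N - \sum_(k < K) f k| <= 2 * m%:R.
Proof.
move=> f1.
have E : \sum_(k < K) f (k + m)%N + \sum_(k < m) f k =
    \sum_(k < K) f k + \sum_(k < m) f (K + k)%N.
  elim: K => [|K IH]; first by rewrite !big_ord0.
  have : \sum_(k < m) f (K + k)%N + f (K + m)%N = f K + \sum_(k < m) f (K.+1 + k)%N.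
    rewrite -(big_ord_recr _ (fun k => f (K + k)%N)) big_ord_recl/= addn0.
    by congr (_ + _); apply: eq_bigr => k _; rewrite /bump add1n addnS.
  rewrite !big_ord_recr/=; move: IH; lra.
rewrite (_ : _ - _ = \sum_(k < m) f (K + k)%N - \sum_(k < m) f k); last first.
  by apply/eqP; rewrite subr_eq addrAC eq_sym subr_eq eq_sym E addrC.
rewrite (le_trans (ler_normB _ _))// mulr2n mulrDl mul1r lerD//.
- rewrite (le_trans (ler_norm_sum _ _ _))// (@le_trans _ _ (\sum_(k < m) 1))//.
    exact: ler_sum.
  by rewrite sumr_const card_ord.
- rewrite (le_trans (ler_norm_sum _ _ _))// (@le_trans _ _ (\sum_(k < m) 1))//.
    exact: ler_sum.
  by rewrite sumr_const card_ord.
Qed.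

(* Replacing each term by its N-fold half-difference with step the half-period
   only changes the sum by boundary terms. *)
Lemma sum_osc_le (N K n : nat) (a c th h e t0 : R) (tt : nat -> R) (w : T) :
  `|e| = 1 -> c * h = e * pi \/ N = 0%N -> (0 < n)%N ->
  (forall k, tt k = t0 + k%:R * (h / n%:R)) ->
  `|\sum_(k < K) cos (a + c * tt k + th * B (tt k) w)| <=
  `|\sum_(k < K) osc B N th h (a + c * tt k) (tt k) w| + 2 * N%:R * n%:R.
Proof.
move=> e1 ch n0 ttE.
pose f k := cos (a + c * tt k + th * B (tt k) w).
have f1 k : `|f k| <= 1 by rewrite ler_norml cos_geN1 cos_le1.
have n0' : n%:R != 0 :> R by rewrite pnatr_eq0 -lt0n.
have ttD k i : tt k + i%:R * h = tt (k + i * n)%N.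
  by rewrite !ttE natrD natrM; field.
have E : \sum_(k < K) osc B N th h (a + c * tt k) (tt k) w =
    \sum_(i < N.+1) (2 ^+ N)^-1 * dw R N i * ((-1) ^+ i * \sum_(k < K) f (k + i * n)%N).
  rewrite /osc exchange_big/=; apply: eq_bigr => i _; rewrite !mulr_sumr.
  apply: eq_bigr => k _; rewrite ttD; congr (_ * _).
  case: ch => [ch|N0]; last first.
    have -> : i = 0%N :> nat by move: (ltn_ord i); rewrite {2}N0 ltnS leqn0 => /eqP.
    by rewrite mul1r mul0n addn0.
  rewrite /f [c * tt (k + i * n)%N](_ : _ = c * tt k + i%:R * (e * pi)); last first.
    by rewrite -ttD mulrDr mulrCA ch.
  rewrite [a + (_ + _) + _](_ : _ = a + c * tt k + th * B (tt (k + i * n)%N) w +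
    i%:R * (e * pi)); last by ring.
  rewrite cos_shift_pi//.
  by rewrite mulrA -expr2 sqrr_sign mul1r.
have sg : \sum_(i < N.+1) (2 ^+ N)^-1 * dw R N i * ((-1) ^+ i * \sum_(k < K) f k) =
    (-1) ^+ N * \sum_(k < K) f k.
  rewrite (eq_bigr (fun i : 'I_N.+1 => (2 ^+ N)^-1 * (\sum_(k < K) f k) *
    (dw R N i * (-1) ^+ i))); last by move=> i _; ring.
  rewrite -mulr_sumr sum_dw_sign -mulN1r exprMn.
  by field; rewrite expf_neq0.
rewrite -/(f _) -lerBlDl.
have -> : `|\sum_(k < K) cos (a + c * tt k + th * B (tt k) w)| = `|(-1) ^+ N * \sum_(k < K) f k|.
  by rewrite normrM normrX normrN1 expr1n mul1r.
rewrite -sg E (le_trans (lerB_dist _ _))// -sumrB.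
rewrite (le_trans (ler_norm_sum _ _ _))//.
rewrite (@le_trans _ _ (\sum_(i < N.+1) (2 ^+ N)^-1 * `|dw R N i| * (2 * N%:R * n%:R)))//.
  apply: ler_sum => i _; rewrite -mulrBr -mulrBr !normrM normrX normrN1 expr1n mul1r.
  rewrite ger0_norm ?invr_ge0 ?exprn_ge0// ler_wpM2l ?mulr_ge0 ?invr_ge0 ?exprn_ge0//.
  rewrite distrC (le_trans (sum_shift_le _ _ f1))// -mulrA ler_wpM2l// natrM.
  by rewrite ler_wpM2r// ler_nat -ltnS.
rewrite -mulr_suml -mulr_sumr ler_piMl ?mulr_ge0// mulrC.
by rewrite ler_pdivrMr ?exprn_gt0// mul1r sum_norm_dw.
Qed.

End oscillating_moment_bound.

(** * Decay at a frequency of size X *)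

Section grid_decay.
Context (R : realType).

Lemma powR_small (s e : R) : 0 < s -> 0 < e ->
  exists2 X0, 1 <= X0 & forall X, X0 <= X -> X `^ (- s) <= e.
Proof.
move=> s0 e0; have p0 : 0 < e `^ (- s^-1) by rewrite powR_gt0.
exists (1 + e `^ (- s^-1)) => [|X hX]; first by rewrite lerDl ltW.
rewrite (@le_trans _ _ ((e `^ (- s^-1)) `^ (- s)))//.
  by apply: ler_powR_npos => //; [rewrite oppr_le0 ltW|rewrite (le_trans _ hX)// lerDr].
by rewrite -powRrM mulrNN mulVf ?gt_eqF// powRr1// ltW.
Qed.

Lemma powR_exprn (X a : R) (n : nat) : (X `^ a) ^+ n = X `^ (a * n%:R).
Proof. by rewrite powRrM powR_mulrn// powR_ge0. Qed.

Context (H : R) (H_gt0 : 0 < H) (H_lt1 : H < 1).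
Hypothesis qform_ge0 : forall l : seq (R * R),
  (forall p, p \in l -> 0 <= p.2) -> 0 <= qform H l.

(* If [th ^+ 2 * r `^ (2 * H)] is large no difference is needed ([N' = 0]);
   if it is small then [X] comes from [c], so [(2 * X)^-1] is a half-period. *)
Lemma grid_decay (m q : nat) (dl : R) : 0 < dl < 1 ->
  exists (N : nat) (C X0 : R), 1 <= X0 /\ 0 <= C /\ forall X c th : R, X0 <= X ->
  `|c| = 2 * pi * X \/ `|th| = 2 * pi * X ->
  exists (N' : nat) (e : R), (N' <= N)%N /\ `|e| = 1 /\
  (c * (2 * X)^-1 = e * pi \/ N' = 0%N) /\
  forall t l, 2^-1 <= t -> far m (2 * X `^ (dl - 1)) t l ->
    `|iter N' (@dif R) (fun i => expR (- (th ^+ 2 *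
        fvar H l (t + i%:R * (2 * X)^-1) / 2))) 0%N| <= C * (X `^ (dl - 1)) ^+ q.
Proof.
move=> /andP[dl0 dl1].
(* Since [h / r] is about [X^(- dl)], the gain [(h / r)^(H N / 4)] is below [r^q] once
   [dl H N / 4 >= q]. *)
pose N := (Num.truncn (4 * q%:R / (dl * H))).+1.
have dlH0 : 0 < dl * H by rewrite mulr_gt0.
have N0 : (0 < N)%N by [].
have qN : q%:R <= dl * H / 4 * N%:R.
  have : 4 * q%:R / (dl * H) < N%:R by rewrite truncnS_gt.
  rewrite ltr_pdivrMr// => h; rewrite mulrAC ler_pdivlMr// mulrC.
  by rewrite (le_trans (ltW h))// mulrC.
have [C [e0 [e0_gt0 HC]]] := iter_dif_charf_le H_gt0 H_lt1 qform_ge0 m N0.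
have [c0 c0_gt0 Hc] := fvar_lower_bound H_gt0 H_lt1 qform_ge0 m.
have [X1 X1_ge1 HX1] := powR_small dl0 e0_gt0.
have [X2 X2_ge1 HX2] : exists2 X0 : R, 1 <= X0 &
    forall X, X0 <= X -> X `^ (- (1 - dl)) <= 4^-1.
  by apply: powR_small; rewrite ?subr_gt0// invr_gt0.
pose D := (N%:R / (c0 / 2)) ^+ N.
have D0 : 0 <= D by rewrite exprn_ge0// divr_ge0// ltW// divr_gt0.
exists N, (`|C| + D), (X1 + X2); split; first by rewrite (le_trans X1_ge1)// lerDl (le_trans _ X2_ge1).
split; first by rewrite addr_ge0.
move=> X c th hX cth.
have hX1 : X1 <= X by rewrite (le_trans _ hX)// lerDl (le_trans _ X2_ge1).
have hX2 : X2 <= X by rewrite (le_trans _ hX)// lerDr (le_trans _ X1_ge1).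
have X_ge1 : 1 <= X by exact: le_trans X1_ge1 hX1.
have X_gt0 : 0 < X by exact: lt_le_trans X_ge1.
have Xn0 : X != 0 by rewrite gt_eqF.
set h := (2 * X)^-1; set r := X `^ (dl - 1).
have r_gt0 : 0 < r by exact: powR_gt0.
have h_gt0 : 0 < h by rewrite invr_gt0 mulr_gt0.
have r4 : 4 * r <= 1.
  by have := HX2 _ hX2; rewrite opprB -/r => h4; rewrite mulrC -ler_pdivlMr// mul1r.
have hr : h / r = X `^ (- dl) / 2.
  have -> : X `^ (- dl) = r^-1 * X^-1.
    rewrite -powRN opprB -[X in _ * X^-1](@powRr1 _ X) ?ltW// -powRN -powRD ?Xn0 ?implybT//.
    by congr (_ `^ _); ring.
  by rewrite /h invfM; ring.
have hr0 : 0 < h / r by rewrite divr_gt0.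
have hr_le : h / r <= X `^ (- dl).
  by rewrite hr ler_pdivrMr// ler_peMr ?powR_ge0// ler1n.
have hr1 : h / r <= 1.
  by rewrite (le_trans hr_le)// -(powRr0 X) ler_powR// oppr_le0 ltW.
have hre : h / r <= e0 by rewrite (le_trans hr_le)// HX1.
have small : (h / r) `^ (H / 4) ^+ N <= r ^+ q.
  rewrite powR_exprn (@le_trans _ _ ((X `^ (- dl)) `^ (H / 4 * N%:R)))//.
    have HN0 : 0 <= H / 4 * N%:R by rewrite mulr_ge0// divr_ge0// ltW.
    by rewrite ge0_ler_powR// ?nnegrE ?powR_ge0// ltW.
  rewrite -powRrM /r powR_exprn ler_powR//.
  have -> : - dl * (H / 4 * N%:R) = - (dl * H / 4 * N%:R) by ring.
  have q0 : 0 <= q%:R :> R by [].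
  have q1 : 0 <= dl * q%:R by rewrite mulr_ge0// ltW.
  by rewrite mulrBl mul1r lerNl opprB (le_trans _ qN)// lerBlDr lerDl.
have rt t : 2^-1 <= t -> 2 * r <= t by move=> ht; apply: le_trans ht; lra.
have rq0 : 0 <= r ^+ q by rewrite exprn_ge0// ltW.
have [B|A] := leP (th ^+ 2 * r `^ (2 * H)) ((h / r) `^ (- H)).
  (* If [|th|] were [2 pi X], then [th^2 r^(2H)] would be of order at least [X^(2 dl H)], above
     [(h / r)^(- H)], which is of order [X^(dl H)]. Hence the large frequency is [c], and [e] is its
     sign. *)
  have thX : `|th| != 2 * pi * X.
    apply/eqP => thX; move: B; apply/negP; rewrite -ltNge.
    rewrite -(real_normK (num_real th)) thX.
    rewrite (@le_lt_trans _ _ (2 * X ^+ 2 * r `^ (2 * H)))//.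
      rewrite hr powRM ?powR_ge0 ?invr_ge0// -powRrM mulrNN.
      rewrite -(powR_inv1 (ler0n R 2)) -powRrM mulrNN mul1r.
      rewrite [leLHS]mulrC -mulrA ler_pM ?powR_ge0//.
        by rewrite ler1_powR ?ler1n// ltW.
      rewrite -(powR_mulrn 2 (ltW X_gt0)) /r -powRrM -powRD ?Xn0 ?implybT// ler_powR//.
      have h1 : 0 <= dl * H by rewrite ltW.
      have -> : 2%:R + (dl - 1) * (2 * H) = dl * H + (dl * H + 2 * (1 - H)) by ring.
      by rewrite lerDl addr_ge0// mulr_ge0// subr_ge0 ltW.
    rewrite ltr_pM2r ?powR_gt0// !exprMn ltr_pM2r ?exprn_gt0//.
    have := pi_ge2 R; nra.
  have cX : `|c| = 2 * pi * X by case: cth => // e; rewrite e eqxx in thX.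
  exists N, (c / `|c|); rewrite leqnn normrM normfV normr_id.
  have c_n0 : `|c| != 0 by rewrite cX gt_eqF// !mulr_gt0// pi_gt0.
  rewrite mulfV//; split => //; split => //; split.
    left; rewrite cX /h; have := pi_gt0 R; move: (pi : R) => p p0; field.
    by rewrite Xn0 gt_eqF.
  move=> t l ht fl; rewrite (le_trans (HC _ _ _ _ _ h_gt0 r_gt0 (rt _ ht) fl hre B))//.
  rewrite (@le_trans _ _ (`|C| * r ^+ q))//; last by rewrite ler_wpM2r// lerDl.
  rewrite (@le_trans _ _ (`|C| * (h / r) `^ (H / 4) ^+ N))//; last by rewrite ler_wpM2l.
  by rewrite ler_wpM2r ?exprn_ge0 ?powR_ge0// ler_norm.
exists 0%N, 1; rewrite normr1; do 3!split=> //; first by right.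
move=> t l ht fl; rewrite [X in `|X|]/= mul0r addr0 ger0_norm ?expR_ge0//.
rewrite (@le_trans _ _ (D * r ^+ q))//; last by rewrite ler_wpM2r// lerDr.
have r2 : 0 < 2 * r by rewrite mulr_gt0.
(* Local nondeterminism makes the exponent at least a multiple of [(h / r)^(- H)], a positive power
   of [X]; its exponential is below any power of [r], up to a constant. *)
have fv := Hc l t _ r2 (rt _ ht) fl.
have rH : r `^ (2 * H) <= (2 * r) `^ (2 * H).
  rewrite ge0_ler_powR ?nnegrE ?mulr_ge0// ?ltW//.
  by rewrite ltr_pMl// ltr1n.
have x0 : 0 < (h / r) `^ (- H) * (c0 / 2) by rewrite mulr_gt0 ?powR_gt0// divr_gt0.
rewrite (@le_trans _ _ (expR (- ((h / r) `^ (- H) * (c0 / 2)))))//.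
  rewrite ler_expR lerN2.
  rewrite (@le_trans _ _ (th ^+ 2 * r `^ (2 * H) * (c0 / 2)))//.
    by rewrite ler_wpM2r ?ltW// divr_gt0.
  rewrite mulrA ler_pM2r ?invr_gt0// -mulrA ler_wpM2l ?sqr_ge0// mulrC.
  by rewrite (le_trans _ fv)// ler_wpM2l// ltW.
rewrite (le_trans (expRN_le_pow N0 x0))// invfM [_^-1 * _]mulrC mulrA exprMn ler_wpM2l//.
rewrite (le_trans _ small)// lerXn2r ?nnegrE ?powR_ge0 ?invr_ge0 ?powR_ge0//.
rewrite powRN invrK.
have H3 : 0 < 3 * H / 4 by rewrite divr_gt0// mulr_gt0.
have {1}-> : H = H / 4 + 3 * H / 4 by field.
rewrite powRD ?(gt_eqF hr0) ?implybT//.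
rewrite ler_piMr ?powR_ge0// [leRHS](_ : 1 = 1 `^ (3 * H / 4)); last by rewrite powR1.
by rewrite ge0_ler_powR ?nnegrE// ltW.
Qed.

End grid_decay.

Section grid_moment.
Context d (T : measurableType d) (R : realType) (P : probability T R).
Context (H : R) (B : R -> T -> R).
Hypothesis H_gt0 : 0 < H.
Hypothesis H_lt1 : H < 1.
Hypothesis fbm_B : fractional_brownian_motion P H B.

Lemma card_near_grid (K n : nat) (h s t0 : R) (tt : nat -> R) (k : nat) :
  0 < h -> (0 < n)%N -> 0 <= s -> (forall k, tt k = t0 + k%:R * (h / n%:R)) ->
  #|[pred j : 'I_K | `|tt k - tt j| < s]|%:R <= 2 * (s * n%:R / h) + 1.
Proof.
move=> h0 n0 s0 ttE; set m := Num.truncn (s * n%:R / h).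
have n0' : 0 < n%:R :> R by rewrite ltr0n.
have hm : m%:R <= s * n%:R / h by rewrite truncn_le// divr_ge0 ?mulr_ge0// ltW.
rewrite (@le_trans _ _ (2 * m%:R + 1))//; last by rewrite lerD2r ler_wpM2l.
rewrite -natrM natr1 ler_nat cardE -(size_map val) -(size_iota (k - m) (2 * m).+1).
apply: uniq_leq_size; first by rewrite map_inj_uniq ?enum_uniq//; exact: val_inj.
move=> _ /mapP[j + ->]; rewrite mem_enum inE !ttE mem_iota.
rewrite opprD addrACA subrr add0r -mulrBl normrM (@ger0_norm _ (h / _)) ?divr_ge0// ?ltW//.
rewrite -ltr_pdivlMr ?divr_gt0// invf_div mulrA => hj.
have hj' : `|k%:R - j%:R| < m.+1%:R :> R by rewrite (lt_trans hj)// truncnS_gt.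
move: hj'; rewrite ltr_norml -natr1 => /andP[h1 h2].
have h3 : (j%:R : R) < (k + m.+1)%:R by rewrite natrD -natr1; lra.
have h4 : (k%:R : R) < (j + m.+1)%:R by rewrite natrD -natr1; lra.
move: h3 h4; rewrite !ltr_nat [X in (_ <= X < _)%N](_ : _ = nat_of_ord j)//.
by move: (nat_of_ord j) => i; clear; lia.
Qed.

(** The mesh is the half-period [h = 1 / (2X)] divided by [n], so that a shift by [h] moves the
    index by [n], and about [n X] points fill [[1/2, 1]]. Both the proportion of near indices and
    the boundary terms divided by [K] are at most multiples of [r = X^(dl - 1)]. The constant is
    independent of [n], which will tend to infinity. *)
Lemma grid_moment_le (q : nat) (dl : R) : 0 < dl < 1 ->
  exists C X0 : R, 1 <= X0 /\ forall (X c th a : R) (n K : nat) (tt : nat -> R), X0 <= X ->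
  `|c| = 2 * pi * X \/ `|th| = 2 * pi * X -> (1 < n)%N ->
  (forall k, tt k = 2^-1 + k%:R * ((2 * X)^-1 / n%:R)) ->
  K = Num.truncn (n%:R * X) ->
  \int[P]_w ((K%:R^-1 * \sum_(k < K) cos (a + c * tt k + th * B (tt k) w)) ^+ (2 * q))
    <= C * (X `^ (dl - 1)) ^+ q.
Proof.
move=> dl01; have /andP[dl0 dl1] := dl01.
have [N [C [X1 [X1_ge1 [C0 HC]]]]] :=
  grid_decay H_gt0 H_lt1 (fbm_qform_ge0 fbm_B) (2 * q) q dl01.
(* The bound [rho] on the number of near grid points is [8 r n X + 2 N n + 1], at most
   [(9 + 2 N) n X r] because [X r >= 1]; then [K >= n X / 2] doubles the constant. *)
pose D : R := 18 + 4 * N%:R.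
have D0 : 0 < D by rewrite ltr_wpDr// mulr_ge0.
have [X2 X2_ge1 HX2] : exists2 X0 : R, 1 <= X0 &
    forall X, X0 <= X -> X `^ (- (1 - dl)) <= D^-1.
  by apply: powR_small; rewrite ?subr_gt0// invr_gt0.
exists (2 ^+ (2 * q) * (momentC R q * (D ^+ q + C) + (4 * N%:R) ^+ (2 * q))), (X1 + X2).
split; first by rewrite (le_trans X1_ge1)// lerDl (le_trans _ X2_ge1).
move=> X c th a n K tt hX cth n1 ttE KE.
have hX1 : X1 <= X by rewrite (le_trans _ hX)// lerDl (le_trans _ X2_ge1).
have hX2 : X2 <= X by rewrite (le_trans _ hX)// lerDr (le_trans _ X1_ge1).
have X_ge1 : 1 <= X by exact: le_trans X1_ge1 hX1.
have X_gt0 : 0 < X by exact: lt_le_trans X_ge1.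
have := HX2 _ hX2; rewrite opprB.
have [N' [e [N'N [e1 [ce decay]]]]] := HC _ _ _ hX1 cth.
move: decay; set r := X `^ (dl - 1) => decay rD.
have r0 : 0 < r by exact: powR_gt0.
have Xr : 1 <= X * r.
  rewrite /r (mulr_powRB1 (ltW X_gt0) dl0).
  by rewrite -(powRr0 X); apply: ler_powR => //; exact: ltW.
have n0 : (0 < n)%N := ltnW n1.
have nX : 2 <= n%:R * X.
  by rewrite -[2]mulr1 ler_pM// ler_nat.
have KnX : n%:R * X / 2 <= K%:R.
  have := truncnS_gt (n%:R * X); rewrite -natr1 -KE; lra.
have KnX' : K%:R <= n%:R * X by rewrite KE truncn_le// mulr_ge0// ltW.
have K0 : 0 < K%:R :> R by rewrite (lt_le_trans _ KnX)// divr_gt0// mulr_gt0// ltr0n.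
set h := (2 * X)^-1 in ttE ce decay.
have h0 : 0 < h by rewrite invr_gt0 mulr_gt0.
have tt_ge k : 2^-1 <= tt k.
  by rewrite ttE lerDl mulr_ge0// divr_ge0// ltW.
pose rho := 2 * ((2 * r + N%:R * h) * n%:R / h) + 1.
have rhoE : rho = 8 * r * (n%:R * X) + 2 * N%:R * n%:R + 1.
  by rewrite /rho /h; field; rewrite gt_eqF.
have rho0 : 0 <= rho.
  by rewrite rhoE !addr_ge0// !mulr_ge0// ltW.
have rhoK : rho <= K%:R * (D * r).
  have n00 : 0 <= n%:R :> R by [].
  have h1 : 1 <= n%:R * X * r.
    rewrite -mulrA -[leLHS]mulr1 ler_pM// ler1n//.
  have h2 : n%:R <= n%:R * X * r by rewrite -mulrA ler_peMr.
  have h3 : N%:R * n%:R <= N%:R * (n%:R * X * r) by rewrite ler_wpM2l.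
  have h4 : n%:R * X / 2 * (D * r) <= K%:R * (D * r).
    by rewrite ler_wpM2r// mulr_ge0// ltW.
  apply: le_trans h4; rewrite rhoE /D.
  set u := n%:R * X * r in h1 h2 h3; set v := N%:R * n%:R in h3.
  set s := N%:R * u in h3.
  have -> : n%:R * X / 2 * ((18 + 4 * N%:R) * r) = 9 * u + 2 * s by rewrite /s /u; field.
  have -> : 8 * r * (n%:R * X) = 8 * u by rewrite /u; ring.
  rewrite -[2 * _ * _]mulrA -/v; move: h1 h3; clear; lra.
have rhoK1 : rho <= K%:R.
  by rewrite (le_trans rhoK)// ler_piMr ?ler0n// mulrC -ler_pdivlMr// mul1r.
pose S' w := \sum_(k < K) osc B N' th h (a + c * tt k) (tt k) w.
have tt0 k : 0 <= tt k by apply: le_trans (tt_ge k).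
have eta0 : 0 <= C * r ^+ q by rewrite mulr_ge0// exprn_ge0// ltW.
have ES : \int[P]_w (S' w ^+ (2 * q)) <=
    momentC R q * ((K%:R * rho) ^+ q + K%:R ^+ (2 * q) * (C * r ^+ q)).
  apply: (@osc_moment_le _ _ _ P H B fbm_B N' (2 * q) K q th h (C * r ^+ q) (2 * r) rho
    (fun k => a + c * tt k) (fun k => tt k)) => //.
  - exact: ltW.
  - by move=> k l fl; apply: decay.
  - move=> k; have s0 : 0 <= 2 * r + N'%:R * h by rewrite addr_ge0// mulr_ge0// ltW.
    apply: (le_trans (card_near_grid K k h0 n0 s0 ttE)).
    have hi : 0 <= h^-1 by rewrite invr_ge0 ltW.
    rewrite /rho lerD2r; apply: ler_wpM2l => //; apply: ler_wpM2r => //.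
    apply: ler_wpM2r => //; rewrite lerD2l; apply: ler_wpM2r; first exact: ltW.
    by rewrite ler_nat.
  - by rewrite rho0.
pose b : R := 2 * N%:R * n%:R.
have b0 : 0 <= b by rewrite !mulr_ge0.
pose S w := \sum_(k < K) cos (a + c * tt k + th * B (tt k) w).
have SS' w : `|S w| <= `|S' w| + b.
  apply: (le_trans (sum_osc_le B K a th w e1 ce n0 ttE)).
  by rewrite lerD2l ler_wpM2r// ler_wpM2l// ler_nat.
have mS : measurable_fun setT S.
  apply: measurable_sum => k; apply: measurableT_comp.
    exact: continuous_measurable_fun (@continuous_cos R).
  by apply: measurable_funD => //; apply: measurable_funM => //; exact: fbm_measurable fbm_B _ (tt0 k).
have mS' : measurable_fun setT S'.
  by apply: measurable_sum => k; apply: measurable_osc fbm_B _ _ _ _ _ _ (tt0 k); exact: ltW.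
have S_le w : `|S w| <= K%:R.
  rewrite (le_trans (ler_norm_sum _ _ _))// (@le_trans _ _ (\sum_(k < K) 1))//.
    by apply: ler_sum => k _; rewrite ler_norml cos_geN1 cos_le1.
  by rewrite sumr_const card_ord.
have S'_le w : `|S' w| <= K%:R.
  rewrite (le_trans (ler_norm_sum _ _ _))// (@le_trans _ _ (\sum_(k < K) 1))//.
    by apply: ler_sum => k _; exact: osc_le1.
  by rewrite sumr_const card_ord.
set u := K%:R^-1; have u0 : 0 <= u by rewrite invr_ge0.
have iS' : P.-integrable setT (EFin \o (fun w => S' w ^+ (2 * q))).
  apply: (@integrable_bounded _ _ _ P _ (K%:R ^+ (2 * q))); first exact: measurable_funX.
  by move=> w; rewrite normrX lerXn2r ?nnegrE.
have iSb : P.-integrable setT (EFin \o (fun w => S' w ^+ (2 * q) + b ^+ (2 * q))).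
  exact: (eq_integrable measurableT _ _ _ (integrableD measurableT iS'
    (finite_measure_integrable_cst P (b ^+ (2 * q)) measurableT))).
have iU : P.-integrable setT (EFin \o (fun w => u ^+ (2 * q) * 2 ^+ (2 * q) *
    (S' w ^+ (2 * q) + b ^+ (2 * q)))).
  exact: (eq_integrable measurableT _ _ _ (integrableZl measurableT _ iSb)).
have even2 (x : R) : x ^+ (2 * q) = `|x| ^+ (2 * q) by rewrite !exprM real_normK ?num_real.
apply: (@le_trans _ _ (\int[P]_w (u ^+ (2 * q) * 2 ^+ (2 * q) *
    (S' w ^+ (2 * q) + b ^+ (2 * q))))).
  apply: le_Rintegral => //.
    apply: (@integrable_bounded _ _ _ P _ (u ^+ (2 * q) * K%:R ^+ (2 * q))).
      by apply: measurable_funX; exact: measurable_funM.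
    move=> w; rewrite normrX normrM ger0_norm// exprMn ler_wpM2l ?exprn_ge0//.
    by rewrite lerXn2r ?nnegrE// -/(S w).
  move=> w _; rewrite -/(S w); rewrite exprMn -mulrA ler_wpM2l ?exprn_ge0//.
  rewrite [S w ^+ _]even2 [S' w ^+ _]even2 (@le_trans _ _ ((`|S' w| + b) ^+ (2 * q)))//.
    by rewrite lerXn2r ?nnegrE ?addr_ge0.
  by rewrite exprD_le.
rewrite RintegralZl// RintegralD//; last exact: finite_measure_integrable_cst.
rewrite Rintegral_cst//= probability_setT mulr1.
have uK : u * K%:R = 1 by rewrite mulVf// gt_eqF.
have r1 : r <= 1 by rewrite -(powRr0 X); apply: ler_powR => //; rewrite subr_le0; exact: ltW.
have ub : u * b <= 4 * N%:R * r.
  rewrite mulrC ler_pdivrMr//.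
  have h1 : n%:R <= 2 * K%:R * r.
    have h2 : n%:R * X / 2 * r <= K%:R * r by rewrite ler_wpM2r// ltW.
    have h3 : n%:R <= n%:R * (X * r) by rewrite ler_peMr.
    by rewrite mulrA in h3; clear -h2 h3; lra.
  rewrite /b (_ : 4 * _ * r * _ = 2 * N%:R * (2 * K%:R * r)); last by ring.
  by rewrite ler_wpM2l// mulr_ge0.
have urho : u * rho <= D * r by rewrite mulrC ler_pdivrMr// mulrC.
have e1' : u ^+ (2 * q) * (K%:R * rho) ^+ q <= D ^+ q * r ^+ q.
  rewrite exprM -!exprMn (_ : u ^+ 2 * _ = (u * K%:R) * (u * rho)); last by ring.
  rewrite uK mul1r; apply: lerXn2r => //; rewrite nnegrE; first exact: mulr_ge0.
  by rewrite mulr_ge0// ltW.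
have e2 : u ^+ (2 * q) * (K%:R ^+ (2 * q) * (C * r ^+ q)) = C * r ^+ q.
  by rewrite [LHS]mulrA -exprMn uK expr1n mul1r.
have e3 : u ^+ (2 * q) * b ^+ (2 * q) <= (4 * N%:R) ^+ (2 * q) * r ^+ q.
  rewrite -exprMn (@le_trans _ _ ((4 * N%:R * r) ^+ (2 * q)))//.
    by rewrite lerXn2r ?nnegrE ?mulr_ge0// ltW.
  rewrite exprMn ler_wpM2l ?exprn_ge0 ?mulr_ge0//.
  by rewrite mulnC exprM expr2 ler_piMr ?exprn_ge0 ?exprn_ile1// ltW.
rewrite [leRHS](_ : _ = 2 ^+ (2 * q) * (momentC R q * (D ^+ q * r ^+ q + C * r ^+ q) +
  (4 * N%:R) ^+ (2 * q) * r ^+ q)); last by ring.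
rewrite [leLHS]mulrAC [leLHS]mulrC ler_wpM2l ?exprn_ge0// mulrDr lerD//.
rewrite (@le_trans _ _ (u ^+ (2 * q) * (momentC R q * ((K%:R * rho) ^+ q + K%:R ^+ (2 * q) * (C * r ^+ q)))))//.
  by rewrite ler_wpM2l ?exprn_ge0.
by rewrite mulrCA ler_wpM2l ?momentC_ge0// mulrDr e2 lerD2r.
Qed.

End grid_moment.

(** * Moments of the Fourier transform *)

Section uniform_mean.
Context (R : realType).

Lemma unif_cont_segment (f : R -> R) (a b e : R) : continuous f -> 0 < e ->
  exists2 dl, 0 < dl & forall x y, a <= x <= b -> `|x - y| < dl -> `|f x - f y| < e.
Proof.
move=> cf e0.
have /compact_near_coveringP cab := @segment_compact R a b.
have := cab R (0^'+) (fun dl x => forall y, `|x - y| < dl -> `|f x - f y| < e) _.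
move=> /(_ _)[x _|dl [dl0 dlP]]; last first.
- exists (dl / 2); first by rewrite divr_gt0.
  move=> x y xab xy; apply: (dlP (dl / 2)) => //=.
  + by rewrite sub0r normrN gtr0_norm ?divr_gt0// gtr_pMr// invf_lt1// ltr1n.
  + by rewrite divr_gt0.
- have /cvgrPdist_lt /(_ (e / 2)) := cf x.
  rewrite divr_gt0// => /(_ isT) [r /= r0 rP].
  exists (ball x (r / 2), [set dl | dl < r / 2]) => /=.
    split; first by apply: nbhsx_ballx; rewrite divr_gt0.
    by apply: nbhs_right_lt; rewrite divr_gt0.
  move=> [x' dl] /= [xx' dlr] y x'y.
  have h1 := rP x'; have h2 := rP y.
  rewrite (le_lt_trans (ler_distD (f x) _ _))// (splitr e) ltrD//.
    rewrite distrC; apply: h1; rewrite /= (lt_trans xx')// gtr_pMr// invf_lt1//.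
    by rewrite ltr1n.
  apply: h2; rewrite /= (le_lt_trans (ler_distD x' _ _))// (splitr r) ltrD//.
  exact: lt_trans dlr.
Qed.

Lemma half_lt1 : (2^-1 : R) < 1.
Proof. by rewrite invf_lt1// ltr1n. Qed.

Definition unif := uniform_prob half_lt1.

Lemma integral_unif (g : R -> R) : continuous g -> (forall x, `|g x| <= 1) ->
  \int[unif]_x g x = 2 * \int[lebesgue_measure]_(x in `[2^-1, 1]) g x.
Proof.
move=> cg g1.
have mg := continuous_measurable_fun cg.
have mg1 : measurable_fun setT (fun x => g x + 1 : measurableTypeR R).
  by apply: measurable_funD.
have ig : unif.-integrable setT (EFin \o g).
  by apply: (@integrable_bounded _ (measurableTypeR R) R unif g 1).
have cI (h : R -> R) : continuous h ->
    lebesgue_measure.-integrable `[2^-1, 1] (EFin \o h).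
  move=> ch; apply: continuous_compact_integrable; first exact: segment_compact.
  exact: continuous_subspaceT.
(* The integral formula for the uniform law concerns nonnegative functions, and [g + 1] is one. *)
have E : \int[unif]_x (g x + 1) = 2 * \int[lebesgue_measure]_(x in `[2^-1, 1]) (g x + 1).
  rewrite /Rintegral integral_uniform//; last 2 first.
  - by apply/measurable_EFinP.
  - move=> x; rewrite lee_fin -lerBlDr sub0r.
    by have := g1 x; rewrite ler_norml => /andP[].
  have -> : (1 - 2^-1)^-1 = 2 :> R by field.
  rewrite fineM//; apply: integrable_fin_num => //=.
  by apply: cI => x; apply: cvgD; [exact: cg|exact: cvg_cst].
have e2 : \int[unif]_x (g x + 1) = \int[unif]_x g x + 1.
  rewrite (@RintegralD _ (measurableTypeR R))//; last exact: finite_measure_integrable_cst.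
  by rewrite Rintegral_cst//= probability_setT mulr1.
have e3 : \int[lebesgue_measure]_(x in `[2^-1, 1]) (g x + 1) =
    \int[lebesgue_measure]_(x in `[2^-1, 1]) g x + 2^-1.
  rewrite (@RintegralD _ (measurableTypeR R))//; last 2 first.
  - exact: cI.
  - by apply: cI => x; exact: cvg_cst.
  rewrite Rintegral_cst//= lebesgue_measure_itv/= lte_fin half_lt1/= mul1r.
  by congr (_ + _); field.
by apply: (addIr 1); rewrite -e2 E e3 mulrDr mulfV.
Qed.

(** On each cell, the mean value theorem for the primitive [G] yields a point where [g] is within
    [e] of its value at the left endpoint. *)
Lemma riemann_sum (g : R -> R) : continuous g -> (forall x, `|g x| <= 1) ->
  (fun K : nat => K.+1%:R^-1 * \sum_(k < K.+1) g (2^-1 + k%:R / (2 * K.+1%:R))) @ \oo -->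
  \int[unif]_x g x.
Proof.
move=> cg g1; rewrite integral_unif//.
pose G x := \int[lebesgue_measure]_(t in `[0, x]) g t.
have dG (x : R) : 0 < x -> is_derive x (1 : R) G (g x).
  move=> x0; have xS : x < x + 1 by rewrite ltrDl.
  have ii : lebesgue_measure.-integrable `[0, x + 1] (EFin \o g).
    apply: continuous_compact_integrable; first exact: segment_compact.
    exact: continuous_subspaceT.
  have [dG eG] := @continuous_FTC1_closed R g 0 x (x + 1) xS ii x0 (cg x).
  by apply: (DeriveDef dG); rewrite -derive1E; exact: eG.
have cG (x : R) : 0 < x -> {for x, continuous G}.
  move=> /dG dGx; apply: differentiable_continuous; apply/derivable1_diffP.
  exact: ex_derive.
have GE : \int[lebesgue_measure]_(x in `[2^-1, 1]) g x = G 1 - G 2^-1.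
  rewrite /G (@Rintegral_itvB R g (BLeft 0) (BRight 1) 2^-1)//; first last.
  - by rewrite bnd_simp ltW// half_lt1.
  - by rewrite bnd_simp.
  - apply: continuous_compact_integrable; first exact: segment_compact.
    exact: continuous_subspaceT.
  rewrite Rintegral_itv_obnd_cbnd//.
  have iI : lebesgue_measure.-integrable `[2^-1, 1] (EFin \o g).
    apply: continuous_compact_integrable; first exact: segment_compact.
    exact: continuous_subspaceT.
  by apply: integrableS iI => //; apply: subset_itvr; rewrite bnd_simp.
rewrite GE; apply/cvgrPdist_le => e e0.
have [dl dl0 dlP] := unif_cont_segment 0 1 cg e0.
near=> K.
have K0 : 0 < K.+1%:R :> R by [].
pose t (k : nat) : R := 2^-1 + k%:R / (2 * K.+1%:R).
have tS k : t k.+1 - t k = (2 * K.+1%:R)^-1.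
  by rewrite /t -natr1; field.
have t0 k : 0 < t k by rewrite ltr_pwDl// divr_ge0.
have mv k : (k < K.+1)%N -> exists2 c, `|g c - g (t k)| <= e &
    G (t k.+1) - G (t k) = (2 * K.+1%:R)^-1 * g c.
  move=> kK; have lt : t k < t k.+1 by rewrite -subr_gt0 tS invr_gt0 mulr_gt0.
  have [||c /[!in_itv]/= /andP[c1 c2] ->] := @MVT R G g (t k) (t k.+1) lt.
  - by move=> x; rewrite in_itv/= => /andP[/(lt_trans (t0 k)) /dG].
  - apply: continuous_in_subspaceT => x; rewrite inE/= in_itv/= => /andP[h _].
    by apply: cG; exact: lt_le_trans h.
  exists c; last by rewrite tS mulrC.
  rewrite distrC ltW//; apply: dlP.
    rewrite ltW//= /t -lerBrDl.
    have -> : 1 - 2^-1 = 2^-1 :> R by field.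
    by rewrite ler_pdivrMr ?mulr_gt0// mulKf// ler_nat ltnW.
  rewrite distrC gtr0_norm ?subr_gt0// (@lt_le_trans _ _ (t k.+1 - t k)) ?ltrD2r//.
  rewrite tS invf_ple ?posrE ?mulr_gt0// (@le_trans _ _ K.+1%:R)//; last first.
    by rewrite ler_peMl// ler1n.
  near: K; exists (Num.truncn dl^-1) => // n /= hn.
  by rewrite (le_trans (ltW (truncnS_gt _)))// ler_nat ltnS.
have tel : G 1 - G 2^-1 = \sum_(k < K.+1) (G (t k.+1) - G (t k)).
  rewrite -(big_mkord predT (fun k => G (t k.+1) - G (t k))) telescope_sumr//.
  by rewrite /t mul0r addr0; congr (G _ - _); field.
rewrite tel !mulr_sumr -sumrB.
rewrite (le_trans (ler_norm_sum _ _ _))// (@le_trans _ _ (\sum_(k < K.+1) K.+1%:R^-1 * e))//.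
  apply: ler_sum => k _; have [c ce ->] := mv k (ltn_ord k).
  rewrite (_ : 2 * _ - _ = K.+1%:R^-1 * (g c - g (t k))); last by rewrite /t; field.
  by rewrite normrM ger0_norm ?invr_ge0// ler_wpM2l// invr_ge0.
by rewrite sumr_const card_ord -mulrnAl -[_ *+ K.+1]mulr_natl mulfV ?mul1r.
Unshelve. all: by end_near.
Qed.

End uniform_mean.

Section mean_moment.
Context d (T : measurableType d) (R : realType) (P : probability T R).

Lemma continuous_max0 (f : R -> R) : {within `[0, +oo[, continuous f} ->
  continuous (fun t : R => f (Num.max t 0)).
Proof.
move=> /continuous_within_itvcyP[cf f0] t.
have [t0|t0|->] := ltgtP t 0; apply/cvgrPdist_lt => e e0.
- near=> s; rewrite !max_r ?subrr ?normr0//; last exact: ltW.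
  by near: s; exact: (lt_le_nbhsl t0).
- rewrite (max_l (ltW t0)).
  have tin : t \in `]0, +oo[ by rewrite in_itv/= t0.
  have /cvgrPdist_lt /(_ e e0) h := cf t tin.
  near=> s; rewrite max_l; first by near: s.
  by near: s; exact: (lt_le_nbhsr t0).
- move/cvgrPdist_lt : f0 => /(_ e e0) [r /= r0 rP].
  rewrite maxxx; exists r => //= s sr.
  have [s0|s0] := leP s 0; first by rewrite subrr normr0.
  exact: rP.
Unshelve. all: by end_near.
Qed.

(* Freezing the time outside [[0, 1]] makes every path bounded, and puts the
   image of the whole real line on the graph over [[0, 1]]. *)
Definition clamp (t : R) : R := Num.max (Num.min t 1) 0.

Lemma clamp01 t : 0 <= clamp t <= 1.
Proof. by rewrite /clamp le_max lexx orbT ge_max ge_min lexx orbT ler01. Qed.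

Lemma clamp_id t : 0 <= t <= 1 -> clamp t = t.
Proof. by move=> /andP[t0 t1]; rewrite /clamp (min_l t1) max_l. Qed.

Lemma continuous_clamp (f : R -> R) : {within `[0, +oo[, continuous f} ->
  continuous (fun t => f (clamp t)).
Proof.
move=> /continuous_max0 cf t.
apply: (@continuous_comp _ _ _ (fun t : R => Num.min t 1) (fun t => f (Num.max t 0))).
  by apply: continuous_min; [exact: cvg_id|exact: cvg_cst].
exact: cf.
Qed.

Context (H : R) (B : R -> T -> R).
Hypothesis H_gt0 : 0 < H.
Hypothesis H_lt1 : H < 1.
Hypothesis fbm_B : fractional_brownian_motion P H B.
Hypothesis cont_B : forall w, {within `[0, +oo[, continuous (fun t => B t w)}.

Definition phase (c th a : R) (w : T) (t : R) :=
  cos (a + c * clamp t + th * B (clamp t) w).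

Lemma continuous_phase c th a w : continuous (phase c th a w).
Proof.
move=> t; apply: (@continuous_comp _ _ _ (fun t => a + c * clamp t + th * B (clamp t) w) cos);
  last exact: continuous_cos.
apply: cvgD; last first.
  by apply: cvgM; [exact: cvg_cst|exact: (continuous_clamp (@cont_B w))].
by apply: cvgD; [exact: cvg_cst|apply: cvgM; [exact: cvg_cst|apply: (@continuous_clamp id); apply: continuous_subspaceT => x; exact: cvg_id]].
Qed.

Lemma phase_le1 c th a w t : `|phase c th a w t| <= 1.
Proof. by rewrite ler_norml cos_geN1 cos_le1. Qed.

Definition mean_phase (c th a : R) (w : T) : R := \int[@unif R]_t phase c th a w t.

Let riem c th a (K : nat) w : R :=
  K.+1%:R^-1 * \sum_(k < K.+1) phase c th a w (2^-1 + k%:R / (2 * K.+1%:R)).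

Let riem_cvg c th a w : riem c th a ^~ w @ \oo --> mean_phase c th a w.
Proof. exact: riemann_sum (@continuous_phase c th a w) (phase_le1 c th a w). Qed.

Let measurable_riem c th a K : measurable_fun setT (riem c th a K).
Proof.
apply: measurable_funM => //; apply: measurable_sum => k; apply: measurableT_comp.
  exact: continuous_measurable_fun (@continuous_cos R).
apply: measurable_funD => //; apply: measurable_funM => //.
by apply: (fbm_measurable fbm_B); case/andP : (clamp01 (2^-1 + k%:R / (2 * K.+1%:R))).
Qed.

Lemma measurable_mean_phase c th a : measurable_fun setT (mean_phase c th a).
Proof.
apply: (measurable_fun_cvg (measurable_riem c th a)) => w _; exact: riem_cvg.
Qed.

Let riem_le1 c th a K w : `|riem c th a K w| <= 1.
Proof.
rewrite normrM ger0_norm ?invr_ge0// mulrC ler_pdivrMr// mul1r.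
rewrite (le_trans (ler_norm_sum _ _ _))// (@le_trans _ _ (\sum_(k < K.+1) 1))//.
  by apply: ler_sum => k _; exact: phase_le1.
by rewrite sumr_const card_ord.
Qed.

(** For a rational [X = p / m], taking [n] a multiple of [m] makes [n X] an integer, and the grid is
    exactly a Riemann grid of [[1/2, 1]]. The moment bound, uniform in [n], passes to the limit by
    dominated convergence. *)
Lemma mean_phase_moment_le (q : nat) (dl : R) : 0 < dl < 1 ->
  exists C X0 : R, 1 <= X0 /\ forall (p m : nat) (c th a : R), (0 < m)%N ->
  X0 <= p%:R / m%:R ->
  `|c| = 2 * pi * (p%:R / m%:R) \/ `|th| = 2 * pi * (p%:R / m%:R) ->
  \int[P]_w (mean_phase c th a w ^+ (2 * q)) <= C * ((p%:R / m%:R) `^ (dl - 1)) ^+ q.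
Proof.
move=> dl01.
have [C [X0 [X0_ge1 HC]]] := grid_moment_le H_gt0 H_lt1 fbm_B q dl01.
exists C, X0; split => // p m c th a m0 hX cth; set X := p%:R / m%:R in hX cth *.
have m0' : 0 < m%:R :> R by rewrite ltr0n.
have X_gt0 : 0 < X by rewrite (lt_le_trans _ hX)// (lt_le_trans _ X0_ge1).
have p0 : (0 < p)%N.
  by move: X_gt0; rewrite /X pmulr_lgt0 ?invr_gt0// ltr0n.
have p0' : 0 < p%:R :> R by rewrite ltr0n.
(* [riem] indexes its sums by the number of points minus 1; here that number is [n X] with
   [n = i.+2 * m], and [i.+2] ensures [1 < n]. *)
pose K i := (i.+2 * p).-1.
have KE i : (K i).+1 = (i.+2 * p)%N by rewrite prednK// muln_gt0.
have cK w : (fun i => riem c th a (K i) w ^+ (2 * q)) @ \oo -->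
    mean_phase c th a w ^+ (2 * q).
  apply: (@continuous_cvg _ _ _ (nbhs \oo) _ (fun i => riem c th a (K i) w)
    (fun x => x ^+ (2 * q))); first exact: exprn_continuous.
  apply: (cvg_comp K (riem c th a ^~ w)); last exact: riem_cvg.
  apply/cvgnyPge => A; near=> i.
  rewrite -ltnS KE (@leq_trans i.+2)//; last by rewrite leq_pmulr.
  by rewrite !ltnS leqW//; near: i; exact: nbhs_infty_ge.
have cI : \int[P]_w riem c th a (K i) w ^+ (2 * q) @[i --> \oo] -->
    \int[P]_w mean_phase c th a w ^+ (2 * q).
  apply: (@dominated_cvg_Rintegral _ _ _ P setT _ _ (cst 1)) => //.
  - by move=> i; apply: measurable_funX.
  - by apply: measurable_funX; exact: measurable_mean_phase.
  - exact: finite_measure_integrable_cst.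
  - by move=> i w _; rewrite normrX exprn_ile1.
rewrite -(cvg_lim _ cI)//; apply: limr_le; first by apply/cvg_ex; eexists; exact: cI.
near=> i.
rewrite (_ : \int[P]_w _ = \int[P]_w (((K i).+1%:R^-1 * \sum_(k < (K i).+1)
    cos (a + c * (2^-1 + k%:R / (2 * (K i).+1%:R)) +
    th * B (2^-1 + k%:R / (2 * (K i).+1%:R)) w)) ^+ (2 * q))); last first.
  apply: eq_Rintegral => w _; congr (_ ^+ _); congr (_ * _).
  apply: eq_bigr => k _.
  rewrite /phase clamp_id// addr_ge0 ?divr_ge0//= -lerBrDl.
  have -> : 1 - 2^-1 = 2^-1 :> R by field.
  by rewrite ler_pdivrMr ?mulr_gt0// mulKf// ler_nat ltnW.
have := HC X c th a (i.+2 * m)%N (K i).+1 (fun k => 2^-1 + k%:R / (2 * (K i).+1%:R)) hX cth _ _ _.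
apply.
- by rewrite (@leq_trans i.+2)// leq_pmulr.
- move=> k; rewrite KE /X !natrM; congr (_ + _ * _); field.
  by rewrite !gt_eqF.
- rewrite KE natrM /X -mulrA [m%:R * _]mulrC divfK ?gt_eqF// -natrM.
  by rewrite natrK.
Unshelve. all: by end_near.
Qed.

End mean_moment.

(** * Almost sure decay *)

Section almost_sure_bound.
Context d (T : measurableType d) (R : realType) (P : probability T R).

(** The means are dominated by a telescoping series, so the sum of the [Y i] has finite mean and is
    almost everywhere finite; it bounds each of its terms. *)
Lemma ae_bounded_series (Y : nat -> T -> R) (C : R) :
  (forall i, measurable_fun setT (Y i)) -> (forall i w, 0 <= Y i w) ->
  (forall i, P.-integrable setT (EFin \o Y i)) ->
  (forall i, \int[P]_w Y i w <= C / (i.+1%:R * i.+2%:R)) ->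
  {ae P, forall w, exists M, forall i, Y i w <= M}.
Proof.
move=> mY Y0 iY YC.
pose S w := (\sum_(0 <= i <oo) (Y i w)%:E)%E.
have mE i : measurable_fun setT (fun w => (Y i w)%:E) by exact/measurable_EFinP.
have ES : (\int[P]_w S w = \sum_(0 <= i <oo) \int[P]_w (Y i w)%:E)%E.
  by apply: integral_nneseries => // i w _; rewrite lee_fin.
have S0 w : (0 <= S w)%E by apply: nneseries_ge0 => i _ _; rewrite lee_fin.
have C0 : 0 <= C.
  have := YC 0%N; have h : 0 <= \int[P]_w Y 0%N w by apply: Rintegral_ge0.
  by move=> /(le_trans h); rewrite pmulr_lge0// invr_gt0 mulr_gt0.
have SC : (\int[P]_w S w <= C%:E)%E.
  rewrite ES; apply: lime_le.
    by apply: is_cvg_nneseries => n _ _; apply: integral_ge0 => w _; rewrite lee_fin.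
  apply: nearW => n.
  rewrite (@le_trans _ _ (\sum_(0 <= i < n) (C / i.+1%:R - C / i.+2%:R)%:E)%E)//.
    apply: lee_sum => i _.
    rewrite -(fineK (integrable_fin_num _ (iY i)))// lee_fin (le_trans (YC i))//.
    rewrite le_eqVlt; apply/orP; left; apply/eqP; rewrite -natr1; field.
    by rewrite natr1 -natrD !pnatr_eq0.
  rewrite sumEFin lee_fin.
  rewrite (eq_bigr (fun i : nat => - (C / i.+2%:R) - - (C / i.+1%:R))); last by move=> i _; ring.
  rewrite telescope_sumr// divr1 opprK addrC lerBlDr lerDl.
  by rewrite divr_ge0.
have iS : P.-integrable setT S.
  apply/integrableP; split.
    by apply: ge0_emeasurable_sum => // i w _ _; rewrite lee_fin.
  under eq_integral => w _ do rewrite gee0_abs//.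
  exact: le_lt_trans SC (ltry _).
have := integrable_ae measurableT iS; apply: filterS => w /(_ I) Sfin.
exists (fine (S w)) => i; rewrite -lee_fin fineK//.
apply: le_trans (nneseries_lim_ge i.+1 _); last by move=> n _ _; rewrite lee_fin.
rewrite big_nat_recr//= leeDr// sume_ge0// => k _; rewrite lee_fin//.
Qed.

Lemma cos_lip (x y : R) : `|cos x - cos y| <= `|x - y|.
Proof.
wlog yx : x y / y <= x.
  move=> W; have [/W//|/ltW/W] := leP y x.
  by rewrite distrC [leRHS]distrC.
have [|z _ ->] := @MVT_segment R cos (fun x => - sin x) y x yx.
  by apply: continuous_subspaceT => z; exact: continuous_cos.
by rewrite normrM normrN ler_piMl// ler_norml sin_geN1 sin_le1.
Qed.

Context (H : R) (B : R -> T -> R).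
Hypothesis H_gt0 : 0 < H.
Hypothesis H_lt1 : H < 1.
Hypothesis fbm_B : fractional_brownian_motion P H B.
Hypothesis cont_B : forall w, {within `[0, +oo[, continuous (fun t => B t w)}.

Lemma mean_phase_lip c c' th th' a w b : (forall t, `|B (clamp t) w| <= b) ->
  `|mean_phase B c th a w - mean_phase B c' th' a w| <= `|c - c'| + `|th - th'| * b.
Proof.
move=> Bb.
have mp c1 th1 : measurable_fun setT (phase B c1 th1 a w).
  exact: continuous_measurable_fun (@continuous_phase _ _ _ _ cont_B c1 th1 a w).
have ip c1 th1 : (@unif R).-integrable setT (EFin \o phase B c1 th1 a w).
  apply: (@integrable_bounded _ (measurableTypeR R) R _ _ 1) => [|t].
    exact: mp.
  exact: phase_le1.
rewrite /mean_phase -(@RintegralB _ (measurableTypeR R))//.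
apply: (@le_Rintegral_bounded _ (measurableTypeR R)); first exact: (measurable_funB (mp c th) (mp c' th')).
move=> t; rewrite (le_trans (cos_lip _ _))//.
have -> : a + c * clamp t + th * B (clamp t) w - (a + c' * clamp t + th' * B (clamp t) w)
  = (c - c') * clamp t + (th - th') * B (clamp t) w by ring.
rewrite (le_trans (ler_normD _ _))// !normrM lerD ?ler_wpM2l//.
have /andP[s0 s1] := clamp01 t; by rewrite ler_piMr// ger0_norm.
Qed.

Lemma mean_phase_le1 c th a w : `|mean_phase B c th a w| <= 1.
Proof.
apply: (@le_Rintegral_bounded _ (measurableTypeR R)) => [|t]; last exact: phase_le1.
exact: (continuous_measurable_fun (@continuous_phase _ _ _ _ cont_B c th a w)).
Qed.

Lemma path_bounded w : exists b : R, forall t, `|B (clamp t) w| <= b.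
Proof.
have cB := continuous_clamp (@cont_B w).
have [||c _ hc] := @EVT_max R (fun t => `|B (clamp t) w|) 0 1; first exact: ler01.
  by apply: continuous_subspaceT => t; apply: cvg_norm; exact: cB.
exists `|B (clamp c) w| => t; have := hc (clamp t) _.
by rewrite (clamp_id (clamp01 t)); apply; rewrite in_itv/= clamp01.
Qed.

End almost_sure_bound.

Section lattice_points.
Context (R : realType).

Definition lattice (M : nat) (i : 'I_(2 * M).+1) : int := (i%:Z - M%:Z)%R.

Lemma lattice_surj M (j : int) : (`|j| <= M)%N -> exists i : 'I_(2 * M).+1, lattice i = j.
Proof.
move=> jM.
have h : (`|(j + M%:Z)%R| < (2 * M).+1)%N by lia.
exists (Ordinal h); rewrite /lattice /=; lia.
Qed.

Lemma floor_dist (x : R) : `|x - (Num.floor x)%:~R| <= 1.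
Proof.
have := floor_le_tmp x; have := lt_succ_floor x.
rewrite intrD => h1 h2; rewrite ger0_norm ?subr_ge0// lerBlDl ltW//.
Qed.

(** The numerators are the integer parts of [n x1] and [n x2]: at most [n (n + 1) + 1] in absolute
    value and, for the larger coordinate, at least [n^2 - 1]. *)
Lemma lattice_approx (x1 x2 : R) (n : nat) : (0 < n)%N ->
  n%:R <= Num.max `|x1| `|x2| -> Num.max `|x1| `|x2| <= n.+1%:R ->
  exists i1 i2 : 'I_(2 * (n * n.+2)).+1,
  [/\ (n * n.-1 <= maxn `|lattice i1| `|lattice i2|)%N,
   `|x1 - (lattice i1)%:~R / n%:R| <= n%:R^-1 & `|x2 - (lattice i2)%:~R / n%:R| <= n%:R^-1].
Proof.
move=> n0 nX Xn; have n0' : 0 < n%:R :> R by rewrite ltr0n.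
have ub (x : R) : `|x| <= Num.max `|x1| `|x2| -> (`|Num.floor (n%:R * x)| <= n * n.+2)%N.
  move=> hx; rewrite -(ler_nat R) natr_absz intr_norm.
  have := lerB_dist (Num.floor (n%:R * x))%:~R (n%:R * x); rewrite distrC.
  move=> /le_trans /(_ (floor_dist _)); rewrite lerBlDr => /le_trans; apply.
  rewrite normrM ger0_norm// natrM.
  have h : n%:R * `|x| <= n%:R * n.+1%:R by rewrite ler_wpM2l// (le_trans hx).
  rewrite (@le_trans _ _ (n%:R + n%:R * n.+1%:R))// ?lerD ?ler1n//.
  by rewrite -[n.+2%:R]natr1 mulrDr mulr1 addrC.
have lb (x : R) : `|x| = Num.max `|x1| `|x2| -> (n * n.-1 <= `|Num.floor (n%:R * x)|)%N.
  move=> hx; rewrite -(ler_nat R) natr_absz intr_norm.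
  have := lerB_dist (n%:R * x) (Num.floor (n%:R * x))%:~R.
  move=> /le_trans /(_ (floor_dist _)); rewrite lerBlDr -lerBlDl; apply: le_trans.
  rewrite normrM ger0_norm// hx natrM.
  have -> : n.-1%:R = n%:R - 1 :> R by rewrite -[in RHS](prednK n0) -natr1 addrK.
  rewrite mulrBr mulr1 lerB ?ler_wpM2l// ler1n//.
have dist (x : R) : `|x - (Num.floor (n%:R * x))%:~R / n%:R| <= n%:R^-1.
  have -> : x - (Num.floor (n%:R * x))%:~R / n%:R =
      (n%:R * x - (Num.floor (n%:R * x))%:~R) / n%:R by field; rewrite gt_eqF.
  have hn : 0 <= n%:R^-1 :> R by rewrite invr_ge0.
  by rewrite normrM (ger0_norm hn) ler_piMl// floor_dist.
have m1 : `|x1| <= Num.max `|x1| `|x2| by rewrite le_max lexx.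
have m2 : `|x2| <= Num.max `|x1| `|x2| by rewrite le_max lexx orbT.
have [i1 e1] := lattice_surj (ub x1 m1).
have [i2 e2] := lattice_surj (ub x2 m2).
exists i1, i2; rewrite e1 e2; split => //.
rewrite leq_max; have [h|h] := leP `|x1| `|x2|.
  by rewrite (lb x2) ?orbT// max_r.
by rewrite (lb x1)// max_l// ltW.
Qed.

End lattice_points.

Section fourier_decay.
Context d (T : measurableType d) (R : realType) (P : probability T R).
Context (H : R) (B : R -> T -> R).
Hypothesis H_gt0 : 0 < H.
Hypothesis H_lt1 : H < 1.
Hypothesis fbm_B : fractional_brownian_motion P H B.
Hypothesis cont_B : forall w, {within `[0, +oo[, continuous (fun t => B t w)}.
Let pi2 : R := 2 * pi.

Lemma mean_phase_moment_int (q : nat) (dl : R) : 0 < dl < 1 ->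
  exists C X0 : R, 1 <= X0 /\ forall (j k : int) (n : nat) (a : R), (0 < n)%N ->
  X0 <= (maxn `|j| `|k|)%:R / n%:R ->
  \int[P]_w (mean_phase B (pi2 * (j%:~R / n%:R)) (pi2 * (k%:~R / n%:R)) a w ^+ (2 * q)) <=
  C * (((maxn `|j| `|k|)%:R / n%:R) `^ (dl - 1)) ^+ q.
Proof.
move=> dl01; have [C [X0 [X0_ge1 HC]]] :=
  mean_phase_moment_le H_gt0 H_lt1 fbm_B cont_B q dl01.
exists C, X0; split => // j k n a n0 hX; apply: HC => //.
have E (i : int) : `|pi2 * (i%:~R / n%:R)| = pi2 * (`|i|%N%:R / n%:R).
  have p0 : 0 <= pi2 by rewrite mulr_ge0// pi_ge0.
  rewrite normrM (ger0_norm p0) normrM normfV (ger0_norm (ler0n _ n)).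
  by rewrite natr_absz intr_norm.
rewrite !E; have [h|h] := leqP `|j| `|k|; [right|left] => //.
Qed.

Let even_ge0 (x : R) q : 0 <= x ^+ (2 * q).
Proof. by rewrite exprM exprn_ge0// sqr_ge0. Qed.

(** Replaced by 0 near the origin, outside the range of the moment bound, so that sums run over a
    full square of lattice points. *)
Let node (q n : nat) (a : R) (i j : 'I_(2 * (n * n.+2)).+1) (w : T) : R :=
  if (n * n.-1 <= maxn `|lattice i| `|lattice j|)%N then
    mean_phase B (pi2 * ((lattice i)%:~R / n%:R)) (pi2 * ((lattice j)%:~R / n%:R)) a w
      ^+ (2 * q)
  else 0.

Let mnode q n a i j : measurable_fun setT (@node q n a i j).
Proof.
rewrite /node; case: (n * n.-1 <= _)%N; last exact: measurable_cst.
by apply: measurable_funX; exact: (measurable_mean_phase fbm_B cont_B).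
Qed.

Let node_le1 q n a i j w : 0 <= @node q n a i j w <= 1.
Proof.
rewrite /node; case: ifP => _; last by rewrite lexx ler01.
rewrite even_ge0/= -[leLHS]ger0_norm ?even_ge0// normrX exprn_ile1//.
exact: mean_phase_le1.
Qed.

Let inode q n a i j : P.-integrable setT (EFin \o @node q n a i j).
Proof.
apply: (@integrable_bounded _ _ _ P _ 1) => [|w]; first exact: mnode.
by have /andP[h0 h1] := node_le1 q a i j w; rewrite ger0_norm.
Qed.

(** A bound uniform in [n] says that the mean phase is [O(n^(- be / 2))] at all nodes kept on the
    lattice of mesh [1 / n]. *)
Let grid_sum (be : R) (q n : nat) (a : R) (w : T) : R :=
  (n%:R `^ be) ^+ q * \sum_(i < (2 * (n * n.+2)).+1) \sum_j node q a i j w.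

Let mg be q n a : measurable_fun setT (grid_sum be q n a).
Proof. by apply: measurable_funM => //; do 2!apply: measurable_sum => ?; exact: (mnode q a). Qed.

Let g0 be q n a w : 0 <= grid_sum be q n a w.
Proof.
rewrite mulr_ge0 ?exprn_ge0 ?powR_ge0//; by apply: sumr_ge0 => i _; apply: sumr_ge0 => j _; have /andP[] := node_le1 q a i j w.
Qed.

Let igrid be q n a : P.-integrable setT (EFin \o grid_sum be q n a).
Proof.
apply: (@integrable_bounded _ _ _ P _
  ((n%:R `^ be) ^+ q * \sum_(i < (2 * (n * n.+2)).+1) \sum_(j < (2 * (n * n.+2)).+1) 1)).
  exact: mg.
move=> w; rewrite ger0_norm// ler_wpM2l ?exprn_ge0 ?powR_ge0//.
by apply: ler_sum => i _; apply: ler_sum => j _; have /andP[] := node_le1 q a i j w.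
Qed.

Let Rintegral_grid be q n a : \int[P]_w grid_sum be q n a w =
  (n%:R `^ be) ^+ q * \sum_(i < (2 * (n * n.+2)).+1) \sum_j \int[P]_w node q a i j w.
Proof.
have h i := @Rintegral_sum_seq _ _ _ P _ (index_enum 'I_(2 * (n * n.+2)).+1)
  (fun j => node q a i j) (fun j _ => inode q a i j).
have [i1 e1] := @Rintegral_sum_seq _ _ _ P _ (index_enum 'I_(2 * (n * n.+2)).+1)
  (fun i w => \sum_j node q a i j w) (fun i _ => (h i).1).
rewrite /grid_sum RintegralZl// e1; congr (_ * _); apply: eq_bigr => i _.
exact: (h i).2.
Qed.

Let grid_moment_sum (be a : R) : 0 < be < 1 -> exists (q n0 : nat) (C : R),
  [/\ (0 < q)%N, (1 < n0)%N & forall i, \int[P]_w grid_sum be q (i + n0) a w <=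
     C / (i.+1%:R * i.+2%:R)].
Proof.
(* With this [dl], [be + dl - 1 = - dl]: a weighted node has mean [O(n^(- dl q))]. There are at most
   [(7 n^2)^2] nodes, so [dl q >= 6] leaves [n^(-2)]. *)
move=> /andP[be0 be1]; pose dl := (1 - be) / 2.
have dl0 : 0 < dl by rewrite divr_gt0// subr_gt0.
have dl1 : dl < 1 by rewrite ltr_pdivrMr// mul1r; move: be0; lra.
pose q := (Num.truncn (6 / dl)).+1.
have q6 : 6 <= dl * q%:R.
  by have := truncnS_gt (6 / dl); rewrite ltr_pdivrMr// mulrC => /ltW.
have [|C [X0 [X0_ge1 HC]]] := @mean_phase_moment_int q dl; first by rewrite dl0.
pose n0 := (Num.truncn X0).+2.
exists q, n0, (49 * 2 ^+ q * `|C|); split => // i.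
set n := (i + n0)%N.
have n1 : X0 <= n.-1%:R.
  by rewrite (le_trans (ltW (truncnS_gt X0)))// ler_nat /n /n0 addnS leq_addl.
have n2 : (1 < n)%N by rewrite /n /n0 !addnS.
have nn0 : (0 < n)%N by exact: ltnW.
have n0' : 0 < n%:R :> R by rewrite ltr0n.
have r2 : 0 <= 2 * n%:R `^ (dl - 1) by rewrite mulr_ge0 ?powR_ge0.
have node_int (u v : 'I_(2 * (n * n.+2)).+1) : \int[P]_w node q a u v w <= `|C| * (2 * n%:R `^ (dl - 1)) ^+ q.
  have h0 : 0 <= `|C| * (2 * n%:R `^ (dl - 1)) ^+ q by rewrite mulr_ge0 ?exprn_ge0.
  have [h|h] := boolP (n * n.-1 <= maxn `|lattice u| `|lattice v|)%N; last first.
    by rewrite /node (negbTE h) Rintegral_cst// mul0r.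
  rewrite /node h.
  have hX : n.-1%:R <= (maxn `|lattice u| `|lattice v|)%:R / n%:R :> R.
    by rewrite ler_pdivlMr// mulrC -natrM ler_nat.
  rewrite (le_trans (HC _ _ _ _ nn0 (le_trans n1 hX)))//.
  rewrite (@le_trans _ _ (`|C| * (((maxn `|lattice u| `|lattice v|)%:R / n%:R) `^ (dl - 1)) ^+ q))//.
    by rewrite ler_wpM2r ?exprn_ge0 ?powR_ge0// ler_norm.
  rewrite ler_wpM2l// lerXn2r ?nnegrE ?powR_ge0//.
  have hn : n%:R / 2 <= (maxn `|lattice u| `|lattice v|)%:R / n%:R :> R.
    rewrite (le_trans _ hX)// ler_pdivrMr// -natrM ler_nat; move: (n) n2 => k; clear; lia.
  have dlN : dl - 1 <= 0 by rewrite subr_le0 ltW.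
  rewrite (le_trans (ler_powR_npos dlN _ hn)) ?divr_gt0//.
  rewrite powRM ?invr_ge0// mulrC ler_wpM2r ?powR_ge0//.
  rewrite -powR_inv1// -powRrM mulN1r opprB ler1_powR ?ler1n//.
  by rewrite lerBlDr lerDl ltW.
set N := (2 * (n * n.+2)).+1.
have hN : (N <= 7 * n ^ 2)%N by rewrite /N; clear -nn0; nia.
rewrite Rintegral_grid (@le_trans _ _ ((n%:R `^ be) ^+ q * ((7 * n ^ 2)%:R ^+ 2 *
    (`|C| * (2 * n%:R `^ (dl - 1)) ^+ q))))//.
  rewrite ler_wpM2l ?exprn_ge0 ?powR_ge0//.
  rewrite (@le_trans _ _ (\sum_(u < N) \sum_(v < N) `|C| * (2 * n%:R `^ (dl - 1)) ^+ q))//.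
    by apply: ler_sum => u _; apply: ler_sum => v _; exact: node_int.
  rewrite !sumr_const card_ord -mulrnA -[leLHS]mulr_natl.
  rewrite ler_wpM2r ?mulr_ge0 ?exprn_ge0// -natrX ler_nat.
  by rewrite expnS expn1 leq_mul.
have -> : (n%:R `^ be) ^+ q * ((7 * n ^ 2)%:R ^+ 2 *
    (`|C| * (2 * n%:R `^ (dl - 1)) ^+ q)) = 49 * 2 ^+ q * `|C| *
    (n%:R ^+ 4 * ((n%:R `^ be) ^+ q * (n%:R `^ (dl - 1)) ^+ q)) :> R.
  by rewrite exprMn natrM natrX; ring.
rewrite ler_wpM2l ?mulr_ge0 ?exprn_ge0//.
have -> : (n%:R `^ be) ^+ q * (n%:R `^ (dl - 1)) ^+ q = n%:R `^ (- (dl * q%:R)) :> R.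
  rewrite !powR_exprn -powRD; last by rewrite (gt_eqF n0') implybT.
  congr (_ `^ _).
  by rewrite /dl; field.
rewrite (@le_trans _ _ (n%:R ^+ 4 * n%:R `^ (- 6)))//.
  rewrite ler_wpM2l ?exprn_ge0// ler_powR ?lerN2//; by rewrite ler1n.
rewrite powR_invn//.
rewrite (_ : n%:R ^+ 4 * _ = (n%:R ^+ 2)^-1); last by field; rewrite gt_eqF.
rewrite lef_pV2 ?posrE ?mulr_gt0 ?exprn_gt0// -natrX -natrM ler_nat.
by rewrite /n /n0; clear; nia.
Qed.

Lemma ae_mean_phase_decay (be a : R) : 0 < be < 1 ->
  {ae P, forall w, exists C, forall x1 x2 : R, 1 <= Num.max `|x1| `|x2| ->
    `|mean_phase B (pi2 * x1) (pi2 * x2) a w| <= C * (Num.max `|x1| `|x2|) `^ (- (be / 2))}.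
Proof.
move=> be01; have [q [n0 [C [q0 n01 HC]]]] := grid_moment_sum a be01.
have /andP[be0 be1] := be01.
have := ae_bounded_series (fun i => mg be q (i + n0) a) (fun i w => g0 be q (i + n0) a w)
  (fun i => igrid be q (i + n0) a) HC.
apply: filterS => w [M HM]; have [b Bb] := path_bounded cont_B w.
have b0 : 0 <= b by exact: le_trans (Bb 0).
have pi20 : 0 <= pi2 by rewrite mulr_ge0// pi_ge0.
have M0 : 0 <= M by exact: le_trans (g0 be q (0 + n0) a w) (HM 0%N).
pose D := M + 1 + pi2 * (1 + b).
have D0 : 0 <= D by rewrite !addr_ge0// mulr_ge0// addr_ge0.
exists (n0%:R `^ (be / 2) + D * 2) => x1 x2; set X := Num.max _ _ => X1.
have X0 : 0 < X by exact: lt_le_trans X1.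
have Xb : 0 <= X `^ (- (be / 2)) by exact: powR_ge0.
have be2 : 0 < be / 2 by rewrite divr_gt0.
have be21 : be / 2 <= 1 by rewrite ler_pdivrMr// mul1r (le_trans (ltW be1))// ler1n.
have beN : - (be / 2) <= 0 by rewrite oppr_le0 ltW.
(* Frequencies below the first grid are covered by the trivial bound 1. *)
have [Xn0|n0X] := ltP X n0%:R.
  rewrite (le_trans (mean_phase_le1 cont_B _ _ _ _))// mulrDl.
  apply: (@le_trans _ _ (n0%:R `^ (be / 2) * X `^ (- (be / 2)))); last first.
    by rewrite lerDl mulr_ge0// mulr_ge0.
  rewrite powRN ler_pdivlMr ?powR_gt0// mul1r.
  by rewrite ge0_ler_powR ?nnegrE// ltW.
pose n := Num.truncn X.
have nX : n%:R <= X by rewrite truncn_le// ltW.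
have Xn : X <= n.+1%:R by rewrite ltW// truncnS_gt.
have n0n : (n0 <= n)%N by rewrite -ltnS -(ltr_nat R) (le_lt_trans n0X (truncnS_gt X)).
have n_gt0 : (0 < n)%N by rewrite (leq_trans _ n0n)// ltnW.
have n0' : 0 < n%:R :> R by rewrite ltr0n.
have nb : n%:R `^ (- (be / 2)) <= 2 * X `^ (- (be / 2)).
  have hX : X / 2 <= n%:R.
    by rewrite ler_pdivrMr// (le_trans Xn)// -natrM ler_nat; clear -n_gt0; lia.
  rewrite (le_trans (ler_powR_npos beN _ hX)) ?divr_gt0//.
  rewrite powRM ?invr_ge0 ?(ltW X0)// mulrC ler_wpM2r//.
  have -> (e : R) : 2^-1 `^ (- e) = 2 `^ e :> R.
    by rewrite -powR_inv1// -powRrM mulN1r opprK.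
  by rewrite ler1_powR ?ler1n.
have [i [j [pij di dj]]] := lattice_approx n_gt0 nX Xn.
set y1 := (lattice i)%:~R / n%:R in di; set y2 := (lattice j)%:~R / n%:R in dj.
have Fn : `|mean_phase B (pi2 * y1) (pi2 * y2) a w| <= (M + 1) * n%:R `^ (- (be / 2)).
  have nbe : 0 < n%:R `^ be by exact: powR_gt0.
  have h : (n%:R `^ be) ^+ q * mean_phase B (pi2 * y1) (pi2 * y2) a w ^+ (2 * q) <= M.
    have := HM (n - n0)%N; rewrite subnK//; apply: le_trans.
    rewrite ler_wpM2l ?exprn_ge0 ?powR_ge0// (bigD1 i)//= (bigD1 j)//=.
    rewrite -[leLHS]addr0 -[leLHS]addr0 lerD ?lerD//.
    - by rewrite /node pij.
    - by apply: sumr_ge0 => v _; case/andP : (node_le1 q a i v w).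
    - by apply: sumr_ge0 => u _; apply: sumr_ge0 => v _; case/andP : (node_le1 q a u v w).
  (* No root is extracted: if the bound failed, the weighted power would be at least
     [(M + 1)^(2q) >= M + 1 > M]. *)
  rewrite leNgt; apply/negP => hlt; move: h; apply/negP; rewrite -ltNge.
  rewrite (@lt_le_trans _ _ (M + 1)) ?ltrDl//.
  rewrite (@le_trans _ _ ((M + 1) ^+ (2 * q)))//.
    by rewrite -[leLHS]expr1 ler_weXn2l ?lerDr// muln_gt0.
  have M10 : 0 <= M + 1 by rewrite addr_ge0.
  rewrite !exprM -exprMn; apply: lerXn2r; rewrite ?nnegrE ?sqr_ge0//.
    by rewrite mulr_ge0 ?powR_ge0// sqr_ge0.
  rewrite -[X in _ <= _ * X]real_normK ?num_real//.
  have -> : (M + 1) ^+ 2 = n%:R `^ be * ((M + 1) * n%:R `^ (- (be / 2))) ^+ 2.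
    rewrite exprMn powR_exprn mulrCA -powRD; last by rewrite (gt_eqF n0') implybT.
    by rewrite (_ : be + _ = 0) ?powRr0 ?mulr1//; field.
  rewrite ler_wpM2l ?powR_ge0// lerXn2r ?nnegrE ?mulr_ge0 ?addr_ge0 ?powR_ge0//.
  exact: ltW.
have lip : `|mean_phase B (pi2 * x1) (pi2 * x2) a w - mean_phase B (pi2 * y1) (pi2 * y2) a w|
    <= pi2 * (1 + b) * n%:R `^ (- (be / 2)).
  rewrite (le_trans (mean_phase_lip cont_B _ _ _ _ _ Bb))// -!mulrBr !(normrM pi2) (ger0_norm pi20).
  rewrite (@le_trans _ _ (pi2 * (1 + b) * n%:R^-1))//.
    have h1 : pi2 * `|x1 - y1| <= pi2 * n%:R^-1 by rewrite ler_wpM2l.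
    have h2 : pi2 * `|x2 - y2| * b <= pi2 * n%:R^-1 * b by rewrite ler_wpM2r// ler_wpM2l.
    rewrite (le_trans (lerD h1 h2))// le_eqVlt; apply/orP; left; apply/eqP; ring.
  have b1 : 0 <= pi2 * (1 + b) by rewrite mulr_ge0// addr_ge0.
  rewrite ler_wpM2l//.
  have -> : n%:R^-1 = n%:R `^ (- 1) :> R by rewrite powR_inv1.
  by rewrite ler_powR ?ler1n// lerN2.
have -> : mean_phase B (pi2 * x1) (pi2 * x2) a w = mean_phase B (pi2 * y1) (pi2 * y2) a w +
  (mean_phase B (pi2 * x1) (pi2 * x2) a w - mean_phase B (pi2 * y1) (pi2 * y2) a w).
  by rewrite addrC subrK.
rewrite (le_trans (ler_normD _ _))// (le_trans (lerD Fn lip))// -mulrDl -/D.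
rewrite (@le_trans _ _ (D * 2 * X `^ (- (be / 2))))//; first by rewrite -mulrA ler_wpM2l.
by rewrite ler_wpM2r// lerDr powR_ge0.
Qed.

End fourier_decay.

(** * The upper bound *)

Section power_sums.
Context (R : realType).

(** Comparison with the integral of [x^(- 1 - eta)], cell by cell through the mean value theorem.
    What matters is the uniformity in [N]; [maxn p 1] gives the index 0 a finite weight. *)
Lemma zeta_sum_le (eta : R) (N : nat) : 0 < eta ->
  \sum_(p < N) (maxn p 1)%:R `^ (- (1 + eta)) <= 2 + eta^-1.
Proof.
move=> e0; pose a (p : nat) : R := (maxn p 1)%:R `^ (- (1 + eta)).
have a0 p : 0 <= a p by exact: powR_ge0.
have step (p : nat) : a p.+2 <= eta^-1 * (p.+1%:R `^ (- eta) - p.+2%:R `^ (- eta)).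
  have p12 : (p.+1%:R : R) <= p.+2%:R by rewrite ler_nat.
  have p10 : 0 < p.+1%:R :> R by [].
  have dp (x : R) : 0 < x ->
      is_derive x (1 : R) (fun x => x `^ (- eta)) (- eta * x `^ (- eta - 1)).
    by move=> x0; exact: is_derive1_powR.
  have [x||c] := @MVT_segment R (fun x => x `^ (- eta)) (fun x => - eta * x `^ (- eta - 1))
     p.+1%:R p.+2%:R p12.
  - by rewrite in_itv/= => /andP[x0 _]; apply: dp; exact: lt_trans x0.
  - apply: continuous_in_subspaceT => x; rewrite inE/= in_itv/= => /andP[x0 _].
    apply: differentiable_continuous; apply/derivable1_diffP.
    by have /dp[] : 0 < x by exact: lt_le_trans x0.
  rewrite in_itv/= => /andP[c1 c2] E.
  have -> : p.+1%:R `^ (- eta) - p.+2%:R `^ (- eta) = eta * c `^ (- eta - 1).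
    by rewrite -opprB E -[p.+2%:R]natr1 addrAC subrr add0r mulr1 mulNr opprK.
  rewrite mulKf ?gt_eqF// /a maxnC/=.
  have -> : - (1 + eta) = - eta - 1 by ring.
  apply: ler_powR_npos => //; last exact: lt_le_trans c1.
  by rewrite subr_le0 (le_trans _ ler01)// oppr_le0 ltW.
have P2 n : \sum_(p < n.+2) a p <= 2 + eta^-1 * (1 - n.+1%:R `^ (- eta)).
  elim: n => [|n IH].
    rewrite !big_ord_recl big_ord0 addr0 /a/= !powR1 subrr mulr0 addr0.
    by rewrite /bump.
  rewrite big_ord_recr/= (le_trans (lerD IH (step n)))// -addrA -mulrDr.
  by rewrite addrA subrK.
apply: (@le_trans _ _ (\sum_(p < N.+2) a p)).
  by rewrite 2!big_ord_recr/= -addrA lerDl addr_ge0.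
by rewrite (le_trans (P2 N))// lerD2l ler_piMr ?invr_ge0 ?(ltW e0)// lerBlDr lerDl powR_ge0.
Qed.

Lemma cesaro_powR (eta e : R) : 0 < eta -> 0 < e ->
  exists M0 : nat, forall M, (M0 <= M)%N ->
    \sum_(s < M) (maxn s 1)%:R `^ (- eta) <= e * M%:R.
Proof.
move=> eta0 e0.
have e20 : 0 < e / 2 by rewrite divr_gt0.
have [X0 X01 HX] := powR_small eta0 e20.
pose S := (Num.truncn X0).+1.
exists (Num.truncn (S%:R / (e / 2))).+1 => M hM.
have b1 (s : nat) : (maxn s 1)%:R `^ (- eta) <= (s < S)%:R + e / 2 :> R.
  have [sS|Ss] := ltnP s S.
    rewrite (@le_trans _ _ 1)//; last by rewrite lerDl ltW.
    rewrite -[leRHS](powRr0 (maxn s 1)%:R) ler_powR ?oppr_le0 ?(ltW eta0)//.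
    by rewrite ler1n leq_max orbT.
  rewrite add0r; apply: HX; rewrite (le_trans (ltW (truncnS_gt X0)))// ler_nat.
  by rewrite leq_max Ss.
apply: (@le_trans _ _ (\sum_(s < M) ((s < S)%:R + e / 2))); first exact: ler_sum.
rewrite big_split/= sumr_const card_ord -[_ *+ M]mulr_natr.
rewrite (@le_trans _ _ (S%:R + e / 2 * M%:R))//.
  rewrite lerD2r -natr_sum ler_nat.
  have h m : (\sum_(s < m) (s < S) <= minn m S)%N.
    elim: m => [|m IH]; first by rewrite big_ord0.
    rewrite big_ord_recr/= (leq_trans (leq_add IH (leqnn _)))//.
    by case: (ltnP m S) => mS; move: mS; move: (S) => k; clear; lia.
  by rewrite (leq_trans (h M))// geq_minr.
have : S%:R <= e / 2 * M%:R.
  rewrite mulrC -ler_pdivrMr// (le_trans (ltW (truncnS_gt _)))// ler_nat//.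
have -> : e * M%:R = e / 2 * M%:R + e / 2 * M%:R by field.
by rewrite lerD2r.
Qed.

(** Every distance to [k] is attained by at most two indices, one on either side. *)
Lemma sum_dist_le (a : nat -> R) (N k : nat) : (forall p, 0 <= a p) -> (k < N)%N ->
  \sum_(j < N) a `|k%:Z - j%:Z|%N <= 2 * \sum_(p < N) a p.
Proof.
move=> a0 kN.
have u1 (Q : pred 'I_N) : (forall i j, Q i -> Q j -> i = j) -> \sum_j (Q j)%:R <= 1 :> R.
  move=> uQ; have [i Qi|Q0] := pickP Q; last by rewrite big1// => j _; rewrite Q0.
  rewrite (bigD1 i)//= Qi big1 ?addr0// => j /eqP ji.
  by case Qj : (Q j) => //; case: ji; exact: uQ.
apply: (@le_trans _ _ (\sum_(j < N) \sum_(p < N) a p * ((j + p == k)%N%:R + (k + p == j)%N%:R))).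
  apply: ler_sum => j _.
  have dN : (`|k%:Z - j%:Z| < N)%N by have := ltn_ord j; lia.
  rewrite (bigD1 (Ordinal dN))//= -[leLHS]addr0 lerD//; last first.
    by apply: sumr_ge0 => p _; rewrite mulr_ge0// addr_ge0.
  rewrite ler_peMr// -natrD (ler_nat _ 1).
  have [jk|kj] := leqP j k.
    by rewrite (_ : (j + _ == k)%N = true)//; apply/eqP; lia.
  by rewrite (_ : (k + _ == j)%N = true) ?addn1//; apply/eqP; lia.
rewrite exchange_big/= mulr_sumr; apply: ler_sum => p _.
rewrite -mulr_sumr [leRHS]mulrC ler_wpM2l// big_split/= mulr2n lerD//.
- by apply: u1 => i j /eqP h1 /eqP h2; apply: val_inj => /=; move: h1 h2; clear; lia.
- by apply: u1 => i j /eqP h1 /eqP h2; apply: val_inj => /=; move: h1 h2; clear; lia.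
Qed.

End power_sums.

(** * A lower bound for the energy of a measure split into cells *)

Section energy.
Context d (T : measurableType d) (R : realType) (mu : probability T R).
Context (I J : finType) (phi : I -> T -> R) (A : set T) (cell : T -> J) (ka : R).
Hypothesis mphi : forall i, measurable_fun setT (phi i).
Hypothesis mA : measurable A.
Hypothesis mcell : forall j, measurable (A `&` cell @^-1` [set j]).
Hypothesis ka_ge0 : 0 <= ka.
Hypothesis cell_cos : forall x y, A x -> A y -> cell x = cell y ->
  ka <= \sum_i cos (phi i x - phi i y).

Lemma sum_cosB (th : I -> R) :
  \sum_i \sum_j cos (th i - th j) = (\sum_i cos (th i)) ^+ 2 + (\sum_i sin (th i)) ^+ 2.
Proof.
rewrite !expr2 !mulr_suml -big_split/=; apply: eq_bigr => i _.
by rewrite !mulr_sumr -big_split/=; apply: eq_bigr => j _; rewrite cosB.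
Qed.

Let mcos (f : T -> R) : measurable_fun setT f -> measurable_fun setT (fun x => cos (f x)).
Proof.
move=> mf; apply: measurableT_comp mf.
exact: continuous_measurable_fun (@continuous_cos R).
Qed.

Let msin (f : T -> R) : measurable_fun setT f -> measurable_fun setT (fun x => sin (f x)).
Proof.
move=> mf; apply: measurableT_comp mf.
exact: continuous_measurable_fun (@continuous_sin R).
Qed.

Let psi i j x := phi i x - phi j x.

Let mpsi i j : measurable_fun setT (psi i j).
Proof. exact: measurable_funB. Qed.

Let C i j := \int[mu]_x cos (psi i j x).
Let S i j := \int[mu]_x sin (psi i j x).

Let icos f : measurable_fun setT f -> mu.-integrable setT (EFin \o (fun x => cos (f x))).
Proof.
move=> mf; apply: (@integrable_bounded _ _ _ mu _ 1); first exact: mcos.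
by move=> x; rewrite ler_norml cos_geN1 cos_le1.
Qed.

Let isin f : measurable_fun setT f -> mu.-integrable setT (EFin \o (fun x => sin (f x))).
Proof.
move=> mf; apply: (@integrable_bounded _ _ _ mu _ 1); first exact: msin.
by move=> x; rewrite ler_norml sin_geN1 sin_le1.
Qed.

Let E j : set T := A `&` cell @^-1` [set j].
Let m j := fine (mu (E j)).
Let Phi x := \sum_i \sum_j (C i j * cos (psi i j x) + S i j * sin (psi i j x)).

Let Rintegral_sum2 (f : I -> I -> T -> R) :
  (forall i j, mu.-integrable setT (EFin \o f i j)) ->
  mu.-integrable setT (EFin \o (fun x => \sum_i \sum_j f i j x)) /\
  \int[mu]_x (\sum_i \sum_j f i j x) = \sum_i \sum_j \int[mu]_x f i j x.
Proof.
move=> If; have h i := @Rintegral_sum_seq _ _ _ mu _ (index_enum I)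
  (fun j => f i j) (fun j _ => If i j).
have [i1 e1] := @Rintegral_sum_seq _ _ _ mu _ (index_enum I)
  (fun i w => \sum_j f i j w) (fun i _ => (h i).1).
by split => //; rewrite e1; apply: eq_bigr => i _; exact: (h i).2.
Qed.

Let iCS i j a b : mu.-integrable setT
  (EFin \o (fun x => a * cos (psi i j x) + b * sin (psi i j x))).
Proof.
exact: (eq_integrable measurableT _ _ _ (integrableD measurableT
  (integrableZl measurableT a (icos (mpsi i j)))
  (integrableZl measurableT b (isin (mpsi i j))))).
Qed.

Let intCS i j a b : \int[mu]_x (a * cos (psi i j x) + b * sin (psi i j x)) =
  a * C i j + b * S i j.
Proof.
rewrite RintegralD//.
- by rewrite !RintegralZl//; [exact: isin|exact: icos].
- exact: (integrableZl measurableT a (icos (mpsi i j))).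
- exact: (integrableZl measurableT b (isin (mpsi i j))).
Qed.

Let PhiE x : Phi x = \int[mu]_y (\sum_i \sum_j cos (psi i j x - psi i j y)).
Proof.
pose f i j y := cos (psi i j x) * cos (psi i j y) + sin (psi i j x) * sin (psi i j y).
rewrite (_ : \int[mu]_y _ = \int[mu]_y (\sum_i \sum_j f i j y)); last first.
  apply: eq_Rintegral => y _; apply: eq_bigr => i _; apply: eq_bigr => j _.
  by rewrite cosB.
have [_ ->] := Rintegral_sum2 (fun i j => iCS i j (cos (psi i j x)) (sin (psi i j x))).
by apply: eq_bigr => i _; apply: eq_bigr => j _; rewrite intCS mulrC [S i j * _]mulrC.
Qed.

Let mE j : measurable (E j). Proof. exact: mcell. Qed.

Let i1 j : mu.-integrable setT (EFin \o \1_(E j)).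
Proof.
apply: (@integrable_bounded _ _ _ mu _ 1) => [|x]; first exact: measurable_indic.
by rewrite indicE ger0_norm// lern1 leq_b1.
Qed.

Let int1 j : \int[mu]_x (\1_(E j) x : R) = m j.
Proof. by rewrite /Rintegral integral_indic// setIT. Qed.

(** For fixed [x] and [y] the double sum of cosines is a sum of two squares, hence nonnegative, and
    the first square is at least [ka ^+ 2] when [x] and [y] lie in the same cell of [A]. *)
Let PhiS x : Phi x >= \sum_j ka ^+ 2 * m j * \1_(E j) x.
Proof.
have e : \sum_j ka ^+ 2 * m j * \1_(E j) x =
    \int[mu]_y (\sum_j (ka ^+ 2 * \1_(E j) x) * \1_(E j) y).
  have [j _|_ ->] := @Rintegral_sum_seq _ _ _ mu _ (index_enum J)
    (fun j y => (ka ^+ 2 * \1_(E j) x) * \1_(E j) y).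
    exact: (integrableZl measurableT _ (i1 j)).
  by apply: eq_bigr => j _; rewrite RintegralZl// int1 mulrAC.
rewrite e PhiE; apply: le_Rintegral => //.
- have [j _|//] := @Rintegral_sum_seq _ _ _ mu _ (index_enum J)
    (fun j y => (ka ^+ 2 * \1_(E j) x) * \1_(E j) y).
  exact: (integrableZl measurableT _ (i1 j)).
- have [i j|//] := Rintegral_sum2 (f := fun i j y => cos (psi i j x - psi i j y)).
  by apply: icos; apply: measurable_funB.
move=> y _.
have -> : \sum_i \sum_j cos (psi i j x - psi i j y) =
    (\sum_i cos (phi i x - phi i y)) ^+ 2 + (\sum_i sin (phi i x - phi i y)) ^+ 2.
  rewrite -sum_cosB; apply: eq_bigr => i _; apply: eq_bigr => j _.
  by congr cos; rewrite /psi; ring.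
have [[Ax Ay cxy]|nE] := pselect [/\ A x, A y & cell x = cell y].
  rewrite (bigD1 (cell x))//= big1 => [|j jx]; last first.
    rewrite indicE memNset ?mulr0 ?mul0r// => -[_ /= cj].
    by move: jx; rewrite cj eqxx.
  rewrite !indicE !mem_set//.
  rewrite !mulr1 addr0 -[leLHS]addr0 lerD ?sqr_ge0//.
  have h := cell_cos Ax Ay cxy.
  by apply: lerXn2r => //; rewrite nnegrE// (le_trans ka_ge0 h).
rewrite big1 ?addr_ge0 ?sqr_ge0// => j _; rewrite !indicE.
case xE : (x \in E j); last by rewrite mulr0 mul0r.
case yE : (y \in E j); last by rewrite mulr0.
case: nE; move/set_mem : xE => -[Ax /= cx]; move/set_mem : yE => -[Ay /= cy].
by split => //; rewrite cx cy.
Qed.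

(* Up to the factor [ka ^+ 2], the right-hand side dominates the sum of the
   squares of the measures of the cells, by the identity [sum_cosB] applied
   to [phi i x - phi i y] and integrated in [x] and [y]. *)
Lemma energy_lower : mu A = 1%E ->
  ka ^+ 2 / #|J|%:R <= \sum_i \sum_j (C i j ^+ 2 + S i j ^+ 2).
Proof.
move=> muA.
have [iPhi EPhi0] := Rintegral_sum2 (fun i j => iCS i j (C i j) (S i j)).
have EPhi : \int[mu]_x Phi x = \sum_i \sum_j (C i j ^+ 2 + S i j ^+ 2).
  by rewrite EPhi0; apply: eq_bigr => i _; apply: eq_bigr => j _; rewrite intCS !expr2.
have [j _|iS eS] := @Rintegral_sum_seq _ _ _ mu _ (index_enum J)
    (fun j x => ka ^+ 2 * m j * \1_(E j) x).
  exact: (integrableZl measurableT _ (i1 j)).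
have lb : \sum_j ka ^+ 2 * m j * m j <= \int[mu]_x Phi x.
  rewrite (_ : \sum_j _ = \int[mu]_x (\sum_j ka ^+ 2 * m j * \1_(E j) x)).
    by apply: le_Rintegral => // x _; exact: PhiS.
  by rewrite eS; apply: eq_bigr => j _; rewrite RintegralZl// int1.
have [j _|_ em] := @Rintegral_sum_seq _ _ _ mu _ (index_enum J) (fun j => \1_(E j)).
  exact: i1.
have sm : \sum_j m j = 1.
  rewrite (eq_bigr (fun j => \int[mu]_x (\1_(E j) x : R))); last by move=> j _; rewrite int1.
  rewrite -em (_ : \int[mu]_x _ = \int[mu]_x (\1_A x : R)).
    by rewrite /Rintegral integral_indic// setIT; exact: (congr1 fine muA).
  apply: eq_Rintegral => x _; rewrite (bigD1 (cell x))//= big1 => [|j jx]; last first.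
    by rewrite indicE memNset// => -[_ /= cj]; move: jx; rewrite cj eqxx.
  rewrite addr0 !indicE; congr (nat_of_bool _)%:R.
  by apply: asbool_equiv_eq; split => [[]|].
rewrite -EPhi (le_trans _ lb)//.
under eq_bigr do rewrite -mulrA.
rewrite -mulr_sumr ler_wpM2l ?sqr_ge0//.
have [->|J0] := eqVneq #|J| 0%N; first by rewrite invr0 sumr_ge0// => j _; rewrite -expr2 sqr_ge0.
have J0' : #|J|%:R != 0 :> R by rewrite pnatr_eq0.
(* Cauchy-Schwarz in the form of a nonnegative variance: masses of sum 1 have squares of sum at
   least [1 / #|J|]. *)
have : 0 <= \sum_j (m j - #|J|%:R^-1) ^+ 2 by apply: sumr_ge0 => j _; exact: sqr_ge0.
rewrite (eq_bigr (fun j => m j * m j - (2 * #|J|%:R^-1 * m j - #|J|%:R^-2))); last first.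
  by move=> j _; field.
rewrite sumrB sumrB -mulr_sumr sm sumr_const.
rewrite [_ ^- 2 *+ _](_ : _ = #|J|%:R^-1); last by rewrite -mulr_natr; field.
by rewrite subr_ge0 mulr1 mulr2n mulrDl !mul1r addrK.
Qed.

End energy.

Section borel_plane.
Context (R : realType).
Local Open Scope complex_scope.

Lemma measurable_open_borelRV n (A : set 'rV[R]_n) : open A ->
  measurable (A : set (borelRV R n)).
Proof. by move=> oA; apply: sub_sigma_algebra. Qed.

Lemma measurable_fun_borelRV n (f : 'rV[R]_n -> R) : continuous f ->
  measurable_fun [set: borelRV R n] (f : borelRV R n -> R).
Proof.
move=> /continuousP cf; apply: (measurability _ (RGenOpens.measurableE R)).
move=> _ [_ [a [b ->] <-]]; rewrite setTI; apply: measurable_open_borelRV.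
exact/cf/interval_open.
Qed.

Lemma measurable_coord n (i : 'I_n) :
  measurable_fun [set: borelRV R n] (fun x : borelRV R n => (x : 'rV[R]_n) 0 i).
Proof. exact: (measurable_fun_borelRV (@coord_continuous R 1 n 0 i)). Qed.

Lemma measurable_dotp n (xi : 'rV[R]_n) :
  measurable_fun [set: borelRV R n] (fun x : borelRV R n => dotp xi x).
Proof.
apply: measurable_sum => i; apply: measurable_funM => //.
exact: measurable_coord.
Qed.

Lemma normc_le (x y r : R) : `|x +i* y| <= r%:C -> x ^+ 2 + y ^+ 2 <= r ^+ 2.
Proof.
rewrite normc_def lecR => h; have h0 : 0 <= x ^+ 2 + y ^+ 2 by rewrite addr_ge0 ?sqr_ge0.
rewrite -(sqr_sqrtr h0); apply: lerXn2r => //; rewrite nnegrE ?sqrtr_ge0//.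
by rewrite (le_trans _ h) ?sqrtr_ge0.
Qed.

Lemma normc_ge (x y : R) : `|x +i* y| <= (`|x| + `|y|)%:C.
Proof.
rewrite normc_def lecR -[leRHS]ger0_norm ?addr_ge0// -sqrtr_sqr.
rewrite ler_sqrt ?sqr_ge0// sqrrD !real_normK ?num_real//.
by rewrite lerD2r lerDl mulrn_wge0// mulr_ge0.
Qed.

Lemma fourier_transformE n (mu : probability (borelRV R n) R) (xi : 'rV[R]_n) :
  fourier_transform mu xi = (\int[mu]_x cos (2 * pi * dotp xi x)) +i*
    (- \int[mu]_x sin (2 * pi * dotp xi x)).
Proof.
rewrite /fourier_transform /cintegral /expi /=; congr (_ +i* _).
  by apply: eq_Rintegral => x _; rewrite cosN.
rewrite -mulN1r -RintegralZl//; first by apply: eq_Rintegral => x _; rewrite sinN mulN1r.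
apply: (@integrable_bounded _ _ _ mu _ 1) => [|x].
  apply: measurableT_comp; first exact: continuous_measurable_fun (@continuous_sin R).
  by apply: measurable_funM => //; exact: measurable_dotp.
by rewrite ler_norml sin_geN1 sin_le1.
Qed.

End borel_plane.

Section graph_energy.
Context (R : realType) (f : R -> R).
Hypothesis cf : continuous (fun t => f (clamp t)).

Let A : set (borelRV R 2) := graph01 f.

Lemma graph01P (x : 'rV[R]_2) : graph01 f x <-> 0 <= x 0 0 <= 1 /\ x 0 1 = f (x 0 0).
Proof.
split=> [[t /= +] <-|[x01 xf]]; first by rewrite in_itv/= !mxE.
exists (x 0 0); first by rewrite /= in_itv.
apply/rowP => i; rewrite mxE; case: i => [[|[|//]] i2].
  by rewrite (_ : Ordinal i2 = 0)//; exact: val_inj.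
by rewrite (_ : Ordinal i2 = 1) ?xf//; exact: val_inj.
Qed.

Lemma measurable_graph01 : measurable A.
Proof.
have m0 := @measurable_coord R 2 0; have m1 := @measurable_coord R 2 1.
have mf : measurable_fun [set: borelRV R 2] (fun x : borelRV R 2 =>
    (x : 'rV[R]_2) 0 1 - f (clamp ((x : 'rV[R]_2) 0 0))).
  by apply: measurable_funB => //; exact: (measurableT_comp (continuous_measurable_fun cf) m0).
have -> : A = ((fun x : borelRV R 2 => (x : 'rV[R]_2) 0 0) @^-1` `[0, 1]) `&`
    ((fun x : borelRV R 2 => (x : 'rV[R]_2) 0 1 - f (clamp ((x : 'rV[R]_2) 0 0))) @^-1` [set 0]).
  apply/seteqP; split => x.
    move=> /graph01P[x01 xf]; split; first by rewrite /= in_itv.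
    by rewrite /= clamp_id// xf subrr.
  move=> [/= + /eqP]; rewrite in_itv/= => x01; rewrite clamp_id// subr_eq0 => /eqP xf.
  exact/graph01P.
apply: measurableI; rewrite -[X in measurable X]setTI.
  by apply: m0 => //; exact: measurable_itv.
by apply: mf => //; exact: measurable_set1.
Qed.

(** There are [J.+1] cells because the abscissa 1 has index [J]. *)
Let cell (J : nat) (x : borelRV R 2) : 'I_J.+1 :=
  inord (Num.truncn (J%:R * (x : 'rV[R]_2) 0 0)).

Let cellP (J : nat) (j : 'I_J.+1) (x : 'rV[R]_2) : (0 < J)%N -> 0 <= x 0 0 <= 1 ->
  cell J x = j <-> j%:R <= J%:R * x 0 0 < j.+1%:R.
Proof.
move=> J0 /andP[x0 x1]; have Jx : 0 <= J%:R * x 0 0 by rewrite mulr_ge0.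
have tJ : (Num.truncn (J%:R * x 0 0)%R < J.+1)%N.
  have h : (Num.truncn (J%:R * x 0 0)%R)%:R <= J%:R * x 0 0 by rewrite truncn_le.
  by rewrite ltnS -(ler_nat R) (le_trans h)// ler_piMr.
split=> [<-|h]; first by rewrite /cell inordK// truncn_itv.
by apply: val_inj; rewrite /cell /= inordK//; exact: truncn_def.
Qed.

Let measurable_cell (J : nat) (j : 'I_J.+1) : (0 < J)%N ->
  measurable (A `&` cell J @^-1` [set j]).
Proof.
move=> J0; have J0' : 0 < J%:R :> R by rewrite ltr0n.
have -> : A `&` cell J @^-1` [set j] = A `&`
    ((fun x : borelRV R 2 => (x : 'rV[R]_2) 0 0) @^-1` `[j%:R / J%:R, j.+1%:R / J%:R[).
  apply/seteqP; split => x [Ax] /=; have /graph01P[x01 _] := Ax.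
    move=> /(cellP _ J0 x01) h; split => //=.
    by rewrite in_itv/= ler_pdivrMr// ltr_pdivlMr// mulrC.
  rewrite in_itv/= ler_pdivrMr// ltr_pdivlMr// mulrC => h; split => //=.
  exact/(cellP _ J0 x01).
apply: measurableI; first exact: measurable_graph01.
rewrite -[X in measurable X]setTI.
by apply: (@measurable_coord R 2 0) => //; exact: measurable_itv.
Qed.

Let freq N M (i : 'I_N * 'I_M) (x : borelRV R 2) : R :=
  2 * pi * (i.1%:R * (x : 'rV[R]_2) 0 0 + i.2%:R * (x : 'rV[R]_2) 0 1).

Let mfreq N M i : measurable_fun setT (@freq N M i).
Proof.
apply: measurable_funM => //; apply: measurable_funD; apply: measurable_funM => //.
  exact: (@measurable_coord R 2 0).
exact: (@measurable_coord R 2 1).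
Qed.

(** [N] is chosen from the modulus of continuity of [f], so that two points of one cell have
    abscissas within [1 / (32 N)] and ordinates within [1 / (32 M)]. All phases are then at most
    [2 pi / 16 < 1/2], all cosines at least [1/2], and [ka = N M / 2]. As there are at most [33 N]
    cells, [ka^2 / (33 N) = N M^2 / 132] bounds the energy from below. *)
Lemma graph_energy (M : nat) (mu : probability (borelRV R 2) R) : (0 < M)%N ->
  mu A = 1%E -> exists2 N, (0 < N)%N & N%:R * M%:R ^+ 2 / 132 <=
  \sum_(i : 'I_N * 'I_M) \sum_(j : 'I_N * 'I_M)
    ((\int[mu]_x cos (freq i x - freq j x)) ^+ 2 + (\int[mu]_x sin (freq i x - freq j x)) ^+ 2).
Proof.
have pi8 : 2 * pi * (32^-1 + 32^-1) <= 2^-1 :> R by have := pihalf_lt2 R; lra.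
move=> M0 muA; have M0' : 0 < M%:R :> R by rewrite ltr0n.
have e0 : 0 < (32 * M%:R)^-1 :> R by rewrite invr_gt0 mulr_gt0.
have [dl dl0 dlP] := unif_cont_segment 0 1 cf e0.
pose N := (Num.truncn dl^-1).+1; exists N => //.
have N0' : 0 < N%:R :> R by rewrite ltr0n.
pose J := (32 * N)%N.
have J0 : (0 < J)%N by [].
have J0' : 0 < J%:R :> R by rewrite ltr0n.
have Jdl : J%:R^-1 <= dl.
  rewrite invf_ple ?posrE// (le_trans (ltW (truncnS_gt _)))// ler_nat /J.
  by rewrite leq_pmull.
have ka0 : 0 <= N%:R * M%:R / 2 :> R by rewrite divr_ge0 ?mulr_ge0.
apply: (@le_trans _ _ ((N%:R * M%:R / 2) ^+ 2 / #|'I_J.+1|%:R)).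
  rewrite card_ord.
  have h : N%:R * M%:R ^+ 2 / 132 = (N%:R * M%:R / 2) ^+ 2 / (33 * N%:R) :> R.
    by field; rewrite gt_eqF.
  rewrite h ler_wpM2l ?sqr_ge0// lef_pV2 ?posrE ?mulr_gt0// -natrM ler_nat.
  by rewrite /J; have : (0 < N)%N by []; move: (N) => k; clear; lia.
apply: (@energy_lower _ _ R mu _ _ (@freq N M) A (cell J) (N%:R * M%:R / 2)) => //.
- exact: measurable_graph01.
- by move=> j; exact: measurable_cell.
move=> x y /graph01P[x01 xf] /graph01P[y01 yf] cxy.
have /(cellP _ J0 y01) /andP[y1 y2] := erefl (cell J y).
have /(cellP _ J0 x01) /andP[x1 x2] := cxy.
have u : `|(x : 'rV[R]_2) 0 0 - (y : 'rV[R]_2) 0 0| < J%:R^-1.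
  rewrite -(ltr_pM2l J0') mulfV ?gt_eqF// -[X in X * _]ger0_norm// -normrM mulrBr.
  rewrite -natr1 in y2 x2; rewrite ltr_norml.
  by clear -y1 y2 x1 x2; apply/andP; split; lra.
have v : `|(x : 'rV[R]_2) 0 1 - (y : 'rV[R]_2) 0 1| < (32 * M%:R)^-1.
  have := dlP _ ((y : 'rV[R]_2) 0 0) x01 (lt_le_trans u Jdl).
  by rewrite !clamp_id// -xf -yf.
rewrite (@le_trans _ _ (\sum_(i : 'I_N * 'I_M) 2^-1))//.
  by rewrite sumr_const card_prod !card_ord -[leRHS]mulr_natr natrM mulrC.
apply: ler_sum => -[k l] _; rewrite /freq /=.
set th := (X in cos X).
have : `|th| <= 2^-1.
  have -> : th = 2 * pi * (k%:R * ((x : 'rV[R]_2) 0 0 - (y : 'rV[R]_2) 0 0) +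
      l%:R * ((x : 'rV[R]_2) 0 1 - (y : 'rV[R]_2) 0 1)) by rewrite /th; ring.
  have h1 : k%:R * `|(x : 'rV[R]_2) 0 0 - (y : 'rV[R]_2) 0 0| <= 32^-1.
    rewrite (@le_trans _ _ (N%:R * J%:R^-1))//.
      by apply: ler_pM => //; [rewrite ler_nat ltnW|exact: ltW].
    by rewrite le_eqVlt; apply/orP; left; apply/eqP; rewrite /J natrM; field; rewrite gt_eqF.
  have h2 : l%:R * `|(x : 'rV[R]_2) 0 1 - (y : 'rV[R]_2) 0 1| <= 32^-1.
    rewrite (@le_trans _ _ (M%:R * (32 * M%:R)^-1))//.
      by apply: ler_pM => //; [rewrite ler_nat ltnW|exact: ltW].
    by rewrite le_eqVlt; apply/orP; left; apply/eqP; field; rewrite gt_eqF.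
  have pi0 : 0 <= 2 * pi :> R by rewrite mulr_ge0 ?pi_ge0.
  rewrite normrM (ger0_norm pi0) (@le_trans _ _ (2 * pi * (32^-1 + 32^-1)))//.
    rewrite ler_wpM2l// (le_trans (ler_normD _ _))// lerD// normrM ger0_norm//.
have := cos_lip th 0; rewrite cos0 subr0 => h1 h2.
by have := le_trans h1 h2; rewrite ler_norml => /andP[h3 _]; clear -h3; lra.
Qed.
Let wave N M (i j : 'I_N * 'I_M) : 'rV[R]_2 :=
  \row_m (if m == 0 then i.1%:R - j.1%:R else i.2%:R - j.2%:R).

Let waveE N M (i j : 'I_N * 'I_M) x : freq i x - freq j x = 2 * pi * dotp (wave i j) x.
Proof.
rewrite /freq /dotp !big_ord_recl big_ord0 !mxE /= addr0.
by rewrite (_ : lift ord0 ord0 = 1) //=; [ring|exact: val_inj].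
Qed.

Let natr_dist (k l : nat) : (k%:R - l%:R : R) ^+ 2 = `|k%:Z - l%:Z|%N%:R ^+ 2.
Proof. by rewrite natr_absz intr_norm real_normK ?num_real// intrB. Qed.

Let enorm_wave N M (i j : 'I_N * 'I_M) :
  enorm (wave i j) ^+ 2 = (`|i.1%:Z - j.1%:Z| ^ 2 + `|i.2%:Z - j.2%:Z| ^ 2)%N%:R.
Proof.
rewrite sqr_sqrtr /dotp !big_ord_recl big_ord0 !mxE/= addr0 -!expr2; last first.
  by rewrite addr_ge0// sqr_ge0.
by rewrite !natr_dist natrD !natrX.
Qed.

Let max1_sqr (u v : nat) : (0 < u + v)%N -> (maxn u 1 ^ 2 <= u ^ 2 + v ^ 2)%N.
Proof.
case: u => [|u _]; last by rewrite (maxn_idPl _)// leq_addr.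
by rewrite max0n !expn_gt0 => ->.
Qed.

Let enorm_ge0 (x : 'rV[R]_2) : 0 <= enorm x. Proof. exact: sqrtr_ge0. Qed.

(** Let [b = 1 + 2 eta], and let [p], [s] be the absolute values of the coordinates of a nonzero
    frequency. Its norm is at least [max(p, 1)] and at least [max(s, 1)], so its power [- b] is at
    most [max(p, 1)^(- 1 - eta) max(s, 1)^(- eta)]. The sum over [p] is bounded uniformly in [N],
    and the sum over [s] is [o(M)]. *)
Lemma graph_fourier_decay_le1 (mu : probability (borelRV R 2) R) (C b : R) :
  mu A = 1%E -> 1 < b -> (forall xi : 'rV[R]_2, xi != 0 ->
     (`|fourier_transform mu xi| <= (C * enorm xi `^ (- (b / 2)))%:C)%C) -> False.
Proof.
(* The 1 in [K] accounts for the zero frequency, at which the integral of the cosine is 1. *)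
move=> muA b1 HC; pose eta := (b - 1) / 2; pose K := 1 + C ^+ 2; pose Z := 2 + eta^-1.
have eta0 : 0 < eta by rewrite divr_gt0// subr_gt0.
have K0 : 0 < K by rewrite ltr_wpDr ?sqr_ge0.
have Z0 : 0 < Z by rewrite ltr_wpDr ?invr_ge0// ltW.
(* The three factors 10 bring the total down to [4 N M^2 / 1000], below [N M^2 / 132]. *)
have e0 : 0 < (10 * (10 * (10 * (K * Z))))^-1 by rewrite invr_gt0 !(mulr_gt0, K0, Z0).
have [M0 HM] := cesaro_powR eta0 e0; pose M := M0.+1.
have [|N N0 energy] := @graph_energy M mu _ muA; first by [].
have N0' : 0 < N%:R :> R by rewrite ltr0n.
have M0' : 0 < M%:R :> R by rewrite ltr0n.
pose a (p : nat) : R := (maxn p 1)%:R `^ (- (1 + eta)).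
pose bb (s : nat) : R := (maxn s 1)%:R `^ (- eta).
have a0 p : 0 <= a p by exact: powR_ge0.
have bb0 p : 0 <= bb p by exact: powR_ge0.
have entry (i j : 'I_N * 'I_M) : (\int[mu]_x cos (freq i x - freq j x)) ^+ 2 +
    (\int[mu]_x sin (freq i x - freq j x)) ^+ 2 <=
    K * (a `|i.1%:Z - j.1%:Z|%N * bb `|i.2%:Z - j.2%:Z|%N).
  have [w0|w0] := eqVneq (wave i j) 0.
    have fij x : freq i x - freq j x = 0.
      by rewrite waveE w0 /dotp big1 ?mulr0// => m _; rewrite mxE mul0r.
    under eq_Rintegral do rewrite fij cos0.
    under [in X in _ + X]eq_Rintegral do rewrite fij sin0.
    rewrite !Rintegral_cst//= probability_setT !mul1r mul0r expr1n expr0n addr0.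
    have := enorm_wave i j; rewrite w0 /enorm /dotp big1 => [|m _]; last by rewrite !mxE mul0r.
    rewrite sqrtr0 expr0n /= => /esym/eqP; rewrite pnatr_eq0 addn_eq0 !expn_eq0 !andbT.
    by move=> /andP[/eqP -> /eqP ->]; rewrite /a /bb !powR1 !mulr1 lerDl sqr_ge0.
  have := HC _ w0; rewrite fourier_transformE => /normc_le; rewrite sqrrN.
  under eq_Rintegral do rewrite -waveE.
  under [in X in _ + X]eq_Rintegral do rewrite -waveE.
  move=> h; apply: (le_trans h); rewrite exprMn powR_exprn.
  have := enorm_wave i j; set p := `|_|%N; set s := `|_ - _|%N; set E := enorm _ => Eps.
  have ps : (0 < p + s)%N.
    rewrite lt0n; apply: contra_neqN w0; rewrite addn_eq0 => /andP[/eqP p0 /eqP s0].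
    have i1 : i.1 = j.1 :> nat by move: p0; rewrite /p; clear; lia.
    have i2 : i.2 = j.2 :> nat by move: s0; rewrite /s; clear; lia.
    by apply/rowP => m; rewrite !mxE i1 i2 !subrr; case: ifP.
  have E1 : 0 <= E by exact: enorm_ge0.
  have Ep : (maxn p 1)%:R <= E.
    by rewrite -(@ler_sqr R _ E) ?nnegrE// Eps -natrX ler_nat max1_sqr.
  have Es : (maxn s 1)%:R <= E.
    by rewrite -(@ler_sqr R _ E) ?nnegrE// Eps -natrX ler_nat addnC max1_sqr// addnC.
  have E0 : 0 < E by rewrite (lt_le_trans _ Ep)// ltr0n leq_max orbT.
  rewrite (_ : - (b / 2) * 2%:R = - (1 + eta) - eta); last by rewrite /eta; field.
  rewrite powRD; last by rewrite (gt_eqF E0) implybT.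
  apply: ler_pM; rewrite ?sqr_ge0 ?mulr_ge0 ?powR_ge0//; first by rewrite lerDr.
  by apply: ler_pM; rewrite ?powR_ge0//; apply: ler_powR_npos; rewrite ?ltr0n ?leq_max ?orbT//;
    rewrite oppr_le0 ?addr_ge0 ?ltW.
have rows (i : 'I_N * 'I_M) : \sum_(j : 'I_N * 'I_M)
    K * (a `|i.1%:Z - j.1%:Z|%N * bb `|i.2%:Z - j.2%:Z|%N) <=
    K * ((2 * Z) * (2 * ((10 * (10 * (10 * (K * Z))))^-1 * M%:R))).
  rewrite -mulr_sumr ler_wpM2l ?(ltW K0)//.
  rewrite -(pair_bigA _ (fun j k => a `|i.1%:Z - (nat_of_ord j)%:Z|%N *
    bb `|i.2%:Z - (nat_of_ord k)%:Z|%N))/=.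
  rewrite -big_distrlr/=; apply: ler_pM; rewrite ?sumr_ge0//.
    rewrite (le_trans (sum_dist_le a0 (ltn_ord _)))// ler_wpM2l//.
    exact: zeta_sum_le.
  rewrite (le_trans (sum_dist_le bb0 (ltn_ord _)))// ler_wpM2l//.
  by apply: HM; exact: leqnSn.
have : N%:R * M%:R ^+ 2 / 132 <= \sum_(i : 'I_N * 'I_M)
   K * ((2 * Z) * (2 * ((10 * (10 * (10 * (K * Z))))^-1 * M%:R))).
  rewrite (le_trans energy)//; apply: ler_sum => i _; rewrite (le_trans _ (rows i))//.
  by apply: ler_sum => j _; exact: entry.
rewrite sumr_const card_prod !card_ord -[leRHS]mulr_natl natrM.
rewrite (_ : _ * (K * _) = N%:R * M%:R ^+ 2 * (4 / (10 * (10 * 10)))); last by field; rewrite !gt_eqF.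
rewrite ler_pM2l ?mulr_gt0 ?exprn_gt0//; apply/negP; rewrite -ltNge.
lra.
Qed.

End graph_energy.

(** * The image measure on the graph *)

Section graph_measure.
Context (R : realType) (f : R -> R).
Hypothesis cf : continuous (fun t => f (clamp t)).
Local Open Scope complex_scope.

Definition graph_point (t : R) : 'rV[R]_2 :=
  \row_(i < 2) (if i == 0 then clamp t else f (clamp t)).

Let cclamp : continuous (@clamp R).
Proof. by apply: (@continuous_clamp R id); apply: continuous_subspaceT => x; exact: cvg_id. Qed.

Lemma continuous_graph_point : continuous graph_point.
Proof.
move=> t; apply/cvg_ballP => e e0; near=> s; split => // i j; rewrite !mxE.
case: ifP => _.
- near: s; by have /cvg_ballP := @cclamp t; apply.
- near: s; by have /cvg_ballP := @cf t; apply.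
Unshelve. all: by end_near.
Qed.

Lemma measurable_graph_point :
  measurable_fun [set: measurableTypeR R] (graph_point : measurableTypeR R -> borelRV R 2).
Proof.
apply: (@measurability _ _ (measurableTypeR R) (borelRV R 2) setT _
  (@open 'rV[R]_2)) => // _ [V oV <-].
rewrite setTI; apply: open_measurable.
by move/continuousP : continuous_graph_point; exact.
Qed.

Let point_rv : {mfun measurableTypeR R >-> borelRV R 2} :=
  mfun_Sub (mem_set measurable_graph_point).

Definition graph_law : probability (borelRV R 2) R := distribution (@unif R) point_rv.

Lemma graph_law_graph01 : graph_law (graph01 f) = 1%E.
Proof.
rewrite -(probability_setT (@unif R)) /graph_law /distribution /pushforward.
rewrite (_ : setT = point_rv @^-1` graph01 f)//; apply/seteqP; split => // t _.
exists (clamp t) => //.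
by rewrite /= in_itv/= clamp01.
Qed.

Lemma Rintegral_graph_law (g : borelRV R 2 -> R) : measurable_fun setT g ->
  (forall x, `|g x| <= 1) -> \int[graph_law]_x g x = \int[@unif R]_t g (graph_point t).
Proof.
move=> mg g1; apply/esym.
apply: (@Rintegral_law _ (measurableTypeR R) R (@unif R) _ (borelRV R 2) graph_law
  graph_point g measurable_graph_point _ mg _).2 => //.
apply: (@integrable_bounded _ (measurableTypeR R) R (@unif R) _ 1) => //.
exact: (measurableT_comp mg measurable_graph_point).
Qed.

End graph_measure.

(** * The Fourier transform of the image measure and the dimension *)

Section fourier_graph.
Context (R : realType).
Local Open Scope complex_scope.

Lemma dotp2 (x y : 'rV[R]_2) : dotp x y = x 0 0 * y 0 0 + x 0 1 * y 0 1.
Proof.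
rewrite /dotp !big_ord_recl big_ord0 addr0.
by rewrite (_ : lift ord0 ord0 = 1)//; exact: val_inj.
Qed.

Lemma enorm_max (x : 'rV[R]_2) :
  Num.max `|x 0 0| `|x 0 1| <= enorm x <= 2 * Num.max `|x 0 0| `|x 0 1|.
Proof.
have E : enorm x ^+ 2 = `|x 0 0| ^+ 2 + `|x 0 1| ^+ 2.
  by rewrite sqr_sqrtr dotp2 -!expr2 ?addr_ge0 ?sqr_ge0// !real_normK ?num_real.
have e0 : 0 <= enorm x by exact: sqrtr_ge0.
set u := `|x 0 0| in E *; set v := `|x 0 1| in E *; set m := Num.max u v.
have u0 : 0 <= u by exact: normr_ge0.
have v0 : 0 <= v by exact: normr_ge0.
have um : u <= m by rewrite le_max lexx.
have vm : v <= m by rewrite le_max lexx orbT.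
have m0 : 0 <= m by exact: le_trans um.
apply/andP; split.
  rewrite ge_max; apply/andP; split; rewrite -ler_sqr ?nnegrE// E.
    by rewrite lerDl sqr_ge0.
  by rewrite lerDr sqr_ge0.
rewrite -ler_sqr ?nnegrE ?mulr_ge0// E exprMn.
have h1 : u ^+ 2 <= m ^+ 2 by rewrite ler_sqr ?nnegrE.
have h2 : v ^+ 2 <= m ^+ 2 by rewrite ler_sqr ?nnegrE.
have h3 : 0 <= m ^+ 2 by rewrite sqr_ge0.
by clear -h1 h2 h3; lra.
Qed.

Context d (T : measurableType d) (B : R -> T -> R).
Hypothesis cont_B : forall w, {within `[0, +oo[, continuous (fun t => B t w)}.

Let cB w : continuous (fun t => B (clamp t) w).
Proof. exact: (continuous_clamp (@cont_B w)). Qed.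

(** As [- sin x = cos (x + pi / 2)], both parts are mean phases. *)
Lemma fourier_graph_law w (xi : 'rV[R]_2) :
  fourier_transform (@graph_law R (B^~ w) (@cB w)) xi =
  mean_phase B (2 * pi * xi 0 0) (2 * pi * xi 0 1) 0 w +i*
  mean_phase B (2 * pi * xi 0 0) (2 * pi * xi 0 1) (pi / 2) w.
Proof.
have mcs (g : R -> R) : continuous g ->
    measurable_fun [set: borelRV R 2] (fun x : borelRV R 2 => g (2 * pi * dotp xi x)).
  move=> cg; apply: measurableT_comp; first exact: continuous_measurable_fun cg.
  by apply: measurable_funM => //; exact: measurable_dotp.
have E t : 2 * pi * dotp xi (graph_point (B^~ w) t) =
    2 * pi * xi 0 0 * clamp t + 2 * pi * xi 0 1 * B (clamp t) w.
  by rewrite dotp2 !mxE/=; ring.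
rewrite fourier_transformE; congr (_ +i* _).
- rewrite Rintegral_graph_law; last 2 first.
  + exact: (mcs cos (@continuous_cos R)).
  + by move=> x; rewrite ler_norml cos_geN1 cos_le1.
  by apply: eq_Rintegral => t _; rewrite E /phase add0r.
- have mns : measurable_fun [set: borelRV R 2] (fun x : borelRV R 2 => sin (2 * pi * dotp xi x)).
    exact: (mcs sin (@continuous_sin R)).
  have bns x : `|sin (2 * pi * dotp xi x)| <= 1 by rewrite ler_norml sin_geN1 sin_le1.
  rewrite -mulN1r -RintegralZl//; last exact: (@integrable_bounded _ _ _ _ _ 1).
  rewrite Rintegral_graph_law; last 2 first.
  + exact: measurable_funM.
  + by move=> x; rewrite mulN1r normrN.
  apply: eq_Rintegral => t _; rewrite E mulN1r /phase -addrA [pi / 2 + _]addrC.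
  by rewrite cosDpihalf.
Qed.

(** The estimates concern frequencies of sup norm at least 1. For the others the Euclidean norm is
    at most 2, so its power [- be / 2] is at least [1/2], and the trivial bound 2 on the transform
    suffices. *)
Lemma graph_law_decay w (be C1 C2 : R) : 0 < be < 1 ->
  (forall x1 x2, 1 <= Num.max `|x1| `|x2| ->
    `|mean_phase B (2 * pi * x1) (2 * pi * x2) 0 w| <=
    C1 * (Num.max `|x1| `|x2|) `^ (- (be / 2))) ->
  (forall x1 x2, 1 <= Num.max `|x1| `|x2| ->
    `|mean_phase B (2 * pi * x1) (2 * pi * x2) (pi / 2) w| <=
    C2 * (Num.max `|x1| `|x2|) `^ (- (be / 2))) ->
  exists C, forall xi : 'rV[R]_2, xi != 0 ->
    `|fourier_transform (@graph_law R (B^~ w) (@cB w)) xi| <= (C * enorm xi `^ (- (be / 2)))%:C.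
Proof.
move=> /andP[be0 be1] h1 h2; exists ((`|C1| + `|C2| + 2) * 2) => xi xi0.
rewrite fourier_graph_law (le_trans (normc_ge _ _))// lecR.
have /andP[Xe eX] := enorm_max xi; set X := Num.max _ _ in Xe eX *.
have be2 : 0 < be / 2 by rewrite divr_gt0.
have be21 : be / 2 <= 1 by rewrite ler_pdivrMr// mul1r (le_trans (ltW be1))// ler1n.
have beN : - (be / 2) <= 0 by rewrite oppr_le0 ltW.
have E0 : 0 < enorm xi.
  rewrite (lt_le_trans _ Xe)// lt_max !normr_gt0; apply: contra_neqT xi0.
  rewrite negb_or !negbK => /andP[/eqP x0 /eqP x1]; apply/rowP => i; rewrite mxE.
  case: i => [[|[|//]] i2]; first by rewrite -x0; congr (xi _ _); exact: val_inj.
  by rewrite -x1; congr (xi _ _); exact: val_inj.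
have two : 2^-1 `^ (- (be / 2)) <= 2 :> R.
  have -> (e : R) : 2^-1 `^ (- e) = 2 `^ e :> R.
    by rewrite -powR_inv1// -powRrM mulN1r opprK.
  by rewrite ler1_powR ?ler1n.
have half (e : R) : 0 < e -> (e / 2) `^ (- (be / 2)) <= 2 * e `^ (- (be / 2)).
  by move=> e0; rewrite powRM ?invr_ge0 ?(ltW e0)// mulrC ler_wpM2r ?powR_ge0.
have Eb : 0 <= enorm xi `^ (- (be / 2)) by exact: powR_ge0.
have [X1|X1] := leP 1 X.
  have hX : X `^ (- (be / 2)) <= 2 * enorm xi `^ (- (be / 2)).
    rewrite (le_trans _ (half _ E0))//; apply: ler_powR_npos => //; first by rewrite divr_gt0.
    by rewrite ler_pdivrMr// mulrC.
  have X0 : 0 <= X `^ (- (be / 2)) by exact: powR_ge0.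
  have h1' := h1 (xi 0 0) (xi 0 1) X1; have h2' := h2 (xi 0 0) (xi 0 1) X1.
  rewrite (@le_trans _ _ ((`|C1| + `|C2| + 2) * X `^ (- (be / 2))))//; last first.
    by rewrite -mulrA ler_wpM2l// !addr_ge0.
  rewrite (@le_trans _ _ ((`|C1| + `|C2|) * X `^ (- (be / 2))))//; last first.
    by rewrite ler_wpM2r// lerDl.
  rewrite [leRHS]mulrDl; apply: lerD.
    by apply: (le_trans h1'); rewrite ler_wpM2r// ler_norm.
  by apply: (le_trans h2'); rewrite ler_wpM2r// ler_norm.
have e2 : enorm xi / 2 <= 1.
  by rewrite ler_pdivrMr// mul1r (le_trans eX)// ler_piMr// ltW.
have lb : 1 <= 2 * enorm xi `^ (- (be / 2)).
  rewrite (le_trans _ (half _ E0))// [leLHS](_ : 1 = 1 `^ (- (be / 2))); last by rewrite powR1.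
  by apply: ler_powR_npos => //; rewrite divr_gt0.
rewrite (@le_trans _ _ 2)//.
  by rewrite [leRHS](_ : 2 = 1 + 1) ?lerD ?mean_phase_le1.
rewrite -mulrA (@le_trans _ _ (2 * (2 * enorm xi `^ (- (be / 2)))))//.
  by rewrite ler_peMr.
by rewrite ler_wpM2r ?mulr_ge0// lerDr addr_ge0.
Qed.

(** The exponents [1 - 1 / (k + 2)] are admissible, all with the same measure, and tend to 1, while
    no exponent above 1 is admissible. Approaching 1 along a sequence asks for countably many almost
    sure events only. *)
Lemma fourier_dim_graph01_eq1 w :
  (forall k : nat, exists C, forall xi : 'rV[R]_2, xi != 0 ->
    `|fourier_transform (@graph_law R (B^~ w) (@cB w)) xi| <=
    (C * enorm xi `^ (- ((1 - k.+2%:R^-1) / 2)))%:C) ->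
  fourier_dim (graph01 (fun t => B t w)) = 1.
Proof.
move=> dec; rewrite /fourier_dim; set S := [set b | _].
have S1 (k : nat) : S (1 - k.+2%:R^-1).
  have k1 : k.+2%:R^-1 <= 1 :> R by rewrite invf_le1// ler1n.
  split.
    by rewrite subr_ge0 k1/= lerBlDr (le_trans (ler1n R 2))// ?lerDl ?invr_ge0.
  have [C HC] := dec k; exists (@graph_law R (B^~ w) (@cB w)), C; split => //.
  exact: graph_law_graph01.
have ubS : ubound S 1.
  move=> b [b02 [mu [C [muA HC]]]]; rewrite leNgt; apply/negP => b1.
  exact: (@graph_fourier_decay_le1 R (B^~ w) (@cB w) mu C b muA b1 HC).
apply/eqP; rewrite eq_le ge_sup//=; last by exists (1 - 2^-1); exact: S1.
rewrite leNgt; apply/negP => s1.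
have s0 : 0 < 1 - sup S by rewrite subr_gt0.
pose k := Num.truncn (1 - sup S)^-1.
have hk : (1 - sup S)^-1 < k.+2%:R.
  by rewrite (lt_trans (truncnS_gt _))// ltr_nat.
have hk' : k.+2%:R^-1 < 1 - sup S by rewrite invf_plt ?posrE.
have : 1 - k.+2%:R^-1 <= sup S by apply: ub_le_sup; [exists 1|exact: S1].
by apply/negP; rewrite -ltNge ltrBrDr addrC -ltrBrDr.
Qed.

End fourier_graph.

Theorem theorem1p1 (R : realType) (d : measure_display) (T : measurableType d)
    (P : probability T R) (complete_P : measure_is_complete P)
    (H : R) (H_gt0 : 0 < H) (H_lt1 : H < 1)
    (B : R -> T -> R) (fbm_B : fractional_brownian_motion P H B)
    (cont_B : forall w : T, {within `[0, +oo[, continuous (fun t => B t w)}) :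
  {ae P, forall w : T, fourier_dim (graph01 (fun t => B t w)) = 1}.
Proof.
have decay (k : nat) (a : R) : {ae P, forall w, exists C, forall x1 x2 : R,
    1 <= Num.max `|x1| `|x2| ->
    `|mean_phase B (2 * pi * x1) (2 * pi * x2) a w| <=
    C * (Num.max `|x1| `|x2|) `^ (- ((1 - k.+2%:R^-1) / 2))}.
  apply: (ae_mean_phase_decay H_gt0 H_lt1 fbm_B cont_B a).
  by rewrite subr_gt0 invf_lt1// ltr1n/= ltrBlDr ltrDl invr_gt0.
(* Countably many exponents and two phases: a single null set serves for all. *)
have := ae_foralln (fun k => decay k 0); have := ae_foralln (fun k => decay k (pi / 2)).
apply: filterS2 => w h2 h1; apply: (@fourier_dim_graph01_eq1 R d T B cont_B w) => k.
have [C1 HC1] := h1 k; have [C2 HC2] := h2 k.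
apply: (@graph_law_decay R d T B cont_B w _ C1 C2 _ HC1 HC2).
by rewrite subr_gt0 invf_lt1// ltr1n/= ltrBlDr ltrDl invr_gt0.
Qed.
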